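(* Let $X$ be a complex Banach space and $2\le p<\infty$. The following statements are equivalent: (a) $(x_n n^{-s})_n$ is RUC in $\mathcal H_p(X)$ for every $(x_n)_n\subset X$. (b) There is $C\ge1$ such that for every $N\in\mathbb N$ and every $(x_n)_{n=1}^N\subset X$, $$\Big\|\sum_{n=1}^N x_n n^{-s}\Big\|_{\mathcal H^{rad}_p(X)}\le C\Big\|\sum_{n=1}^N x_n n^{-s}\Big\|_{\mathcal H_p(X)}.$$ (c) $\mathcal H_p(X)\subseteq\mathcal H^{rad}_p(X)$. (d) There is $C\ge1$ such that for every $N\in\mathbb N$ and every $(x_n)_{n=1}^N\subset X$, $$\mathbb E\Big\|\sum_{n=1}^N\varepsilon_n x_n\Big\|\le C\bigg(\int_{\mathbb T}\Big\|\sum_{n=1}^N x_n z^n\Big\|^p\,dz\bigg)^{1/p}.$$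
   Context: $\mathbb N=\{1,2,\dots\}$, $\mathbb T=\{z\in\mathbb C:|z|=1\}$; $\mathbb T$ and $\mathbb T^{\mathbb N}$ carry normalized Haar measure. $\mathbb Z^{(\mathbb N)}$ and $\mathbb N_0^{(\mathbb N)}$ are the sets of eventually null sequences of integers and of non-negative integers, respectively; $z^\alpha=\prod_i z_i^{\alpha_i}$. Let $p_1<p_2<\cdots$ be the primes; for $\alpha\in\mathbb N_0^{(\mathbb N)}$ put $n(\alpha)=\prod_i p_i^{\alpha_i}$ (a bijection onto $\mathbb N$). Hardy spaces. For $1\le p<\infty$ and $f\in L_p(\mathbb T^{\mathbb N},X)$ (Bochner space), $\hat f(\alpha)=\int_{\mathbb T^{\mathbb N}}f(w)w^{-\alpha}\,dw$. $H_p(\mathbb T^{\mathbb N},X)$ is the closed subspace of those $f\in L_p(\mathbb T^{\mathbb N},X)$ with $\hat f(\alpha)=0$ for all $\alpha\in\mathbb Z^{(\mathbb N)}\setminus\mathbb N_0^{(\mathbb N)}$. A formal Dirichlet series $D=\sum_n x_n n^{-s}$ with $x_n\in X$ belongs to $\mathcal H_p(X)$ if there is $f\in H_p(\mathbb T^{\mathbb N},X)$ with $\hat f(\alpha)=x_{n(\alpha)}$ for all $\alpha\in\mathbb N_0^{(\mathbb N)}$, and then $\|D\|_{\mathcal H_p(X)}=\|f\|_{L_p(\mathbb T^{\mathbb N},X)}$. $\mathcal H^{rad}_p(X)$ is the set of formal Dirichlet series $\sum_n x_n n^{-s}$ with $x_n\in X$ such that $\sum_n\varepsilon_n x_n n^{-s}\in\mathcal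 H_p(X)$ for almost every $(\varepsilon_n)_n\in\{-1,+1\}^{\mathbb N}$ (Haar probability measure). It is normed by $\|\sum_n x_n n^{-s}\|_{\mathcal H^{rad}_p(X)}=\mathbb E\|\sum_n\varepsilon_n x_n n^{-s}\|_{\mathcal H_p(X)}$, where $\mathbb E$ is the expectation over independent uniform signs $\varepsilon_n=\pm1$. A sequence $(y_n)_n$ in a Banach space is RUC if there is a constant $C$ such that $\mathbb E\|\sum_{n=1}^m\varepsilon_n a_n y_n\|\le C\|\sum_{n=1}^m a_n y_n\|$ for every $m\in\mathbb N$ and all scalars $(a_n)_{n=1}^m\subset\mathbb C$. For $(x_n n^{-s})_n$ in $\mathcal H_p(X)$ this inequality is the definition (some $x_n$ may be zero). *)

(* Defs.v *)
From HB Require Import structures.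
From mathcomp Require Import all_boot all_order all_algebra finmap.
From mathcomp Require Import complex.
From mathcomp Require Import all_classical all_reals all_analysis.

Set Implicit Arguments.
Unset Strict Implicit.
Unset Printing Implicit Defensive.

Import Order.TTheory GRing.Theory Num.Theory.
Import numFieldNormedType.Exports.

Local Open Scope classical_set_scope.
Local Open Scope ring_scope.
Local Open Scope complex_scope.

(* Numbering convention: a sequence (u_n)_{n >= 1} is a function on nat whose
   value at 0 is never used.  The coordinates of T^N and of multi-indices are
   numbered from 0, coordinate i being attached to the (i+1)-st prime. *)

(* In a normed space over R[i] the norm `|x| is a (real) element of R[i]; this
   is the same norm as an element of R. *)
Definition rnorm (R : realType) (X : normedModType R[i]) (x : X) : R :=
  complex.Re `|x|.

(** ** The circle, countable powers, and Haar probability measures *)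

Definition circle (R : realType) : Type := {z : R[i] | `|z| == 1}.

HB.instance Definition _ (R : realType) := Choice.on (circle R).

Definition circle_one (R : realType) : circle R :=
  exist _ 1 (introT eqP (normr1 _)).

HB.instance Definition _ (R : realType) :=
  isPointed.Build (circle R) (circle_one R).

Lemma circle_mul_subproof (R : realType) (z w : circle R) :
  `|sval z * sval w| == 1.
Proof. by rewrite normrM (eqP (svalP z)) (eqP (svalP w)) mulr1. Qed.

Definition circle_mul (R : realType) (z w : circle R) : circle R :=
  exist _ (sval z * sval w) (circle_mul_subproof z w).

(* The Borel sigma-algebra: traces on the circle of Borel subsets of R[i]. *)
Definition borelC (R : realType) := g_sigma_algebraType (@open R[i]^o).

Definition circle_val (R : realType) (z : circle R) : borelC R := sval z.

HB.instance Definition _ (R : realType) :=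
  Measurable.copy (circle R) (g_sigma_algebra_preimageType (@circle_val R)).

(* nat -> G with the product sigma-algebra.  For the circle and for the
   two-point group it is the Borel sigma-algebra of the product topology. *)
Definition cylinder d (G : measurableType d) : set (set (nat -> G)) :=
  [set A | exists i (B : set G), measurable B /\ A = [set w | B (w i)]].

Definition powN d (G : measurableType d) := g_sigma_algebraType (@cylinder d G).

Definition powN_mul (G : Type) (mul : G -> G -> G) (v w : nat -> G) : nat -> G :=
  fun i => mul (v i) (w i).

(* For the multiplication mul of a compact group G, the Haar probability
   measure is the unique translation invariant probability measure. *)
Definition is_haar d (G : measurableType d) (R : realType)
    (mul : G -> G -> G) (mu : probability G R) : Prop :=
  forall (g : G) (A : set G), measurable A -> mu (mul g @^-1` A) = mu A.

Definition torus (R : realType) := powN (circle R).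

(* {-1,+1}^N: the boolean b stands for the sign (-1)^b, so that the product of
   signs is addb. *)
Definition signs := powN bool.

Definition is_haar_circle (R : realType) (mu : probability (circle R) R) :=
  is_haar (@circle_mul R) mu.

Definition is_haar_torus (R : realType) (mu : probability (torus R) R) :=
  @is_haar _ (torus R) R (powN_mul (@circle_mul R)) mu.

Definition is_haar_signs (R : realType) (mu : probability signs R) :=
  @is_haar _ signs R (powN_mul addb) mu.

Definition sgn (R : realType) (e : signs) (n : nat) : R[i] :=
  (-1) ^+ nat_of_bool (e n).

(** ** Bochner spaces and the Bochner integral for a probability measure *)

Definition simple_fun d (T : measurableType d) (X : Type) (s : T -> X) : Prop :=
  finite_set (range s) /\ forall x : X, measurable (s @^-1` [set x]).

(* Every a.e. limit of simple functions agrees a.e. with an everywhere limit of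
   simple functions, so the classes modulo null sets are the usual ones. *)
Definition strongly_measurable d (T : measurableType d) (R : realType)
    (X : normedModType R[i]) (f : T -> X) : Prop :=
  exists s : nat -> T -> X,
    (forall k, simple_fun (s k)) /\ forall t, s ^~ t @ \oo --> f t.

Definition simple_integral d (T : measurableType d) (R : realType)
    (X : normedModType R[i]) (mu : probability T R) (s : T -> X) : X :=
  \sum_(x \in range s) (fine (mu (s @^-1` [set x])))%:C *: x.

Definition is_bochner_integral d (T : measurableType d) (R : realType)
    (X : normedModType R[i]) (mu : probability T R) (f : T -> X) (v : X) : Prop :=
  strongly_measurable f /\
  exists s : nat -> T -> X,
    [/\ forall k, simple_fun (s k),
        (fun k => (\int[mu]_t (rnorm (f t - s k t))%:E)%E) @ \oo --> 0%E
      & (fun k => simple_integral mu (s k)) @ \oo --> v].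

(* 0 if f is not Bochner integrable. *)
Definition bochner_integral d (T : measurableType d) (R : realType)
    (X : normedModType R[i]) (mu : probability T R) (f : T -> X) : X :=
  xget 0 [set v | is_bochner_integral mu f v].

Definition Lp_norm d (T : measurableType d) (R : realType)
    (X : normedModType R[i]) (mu : probability T R) (p : R) (f : T -> X) : \bar R :=
  Lnorm mu p%:E (fun t => (rnorm (f t))%:E).

Definition in_Lp d (T : measurableType d) (R : realType)
    (X : normedModType R[i]) (mu : probability T R) (p : R) (f : T -> X) : Prop :=
  strongly_measurable f /\ (Lp_norm mu p f < +oo)%E.

(** ** Hardy spaces on the infinite torus and Hardy spaces of Dirichlet series *)

Definition Zindex := {fsfun nat -> int with 0}.

Definition nonneg_index (alpha : Zindex) : Prop := forall i, 0 <= alpha i.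

Definition monomial (R : realType) (w : torus R) (alpha : Zindex) : R[i] :=
  \prod_(i <- finsupp alpha) (sval (w i)) ^ (alpha i).

Definition fourier_coef (R : realType) (X : normedModType R[i])
    (mT : probability (torus R) R) (f : torus R -> X) (alpha : Zindex) : X :=
  bochner_integral mT (fun w => (monomial w alpha)^-1 *: f w).

Definition in_Hardy (R : realType) (X : normedModType R[i])
    (mT : probability (torus R) R) (p : R) (f : torus R -> X) : Prop :=
  in_Lp mT p f /\
  forall alpha : Zindex, ~ nonneg_index alpha -> fourier_coef mT f alpha = 0.

Lemma ex_prime_gt (m : nat) : exists q : nat, (m < q)%N && prime q.
Proof. by have [q mq pq] := prime_above m; exists q; rewrite mq pq. Qed.

Definition next_prime (m : nat) : nat := ex_minn (ex_prime_gt m).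

Definition nth_prime (i : nat) : nat := iter i.+1 next_prime 0%N.

(* n(alpha), for alpha with non-negative entries. *)
Definition index_nat (alpha : Zindex) : nat :=
  (\prod_(i <- finsupp alpha) nth_prime i ^ `|alpha i|)%N.

(* The formal Dirichlet series sum_{n >= 1} D_n n^{-s} is the function D. *)
Definition dirichlet (X : Type) := nat -> X.

Definition is_lift (R : realType) (X : normedModType R[i])
    (mT : probability (torus R) R) (p : R) (D : dirichlet X)
    (f : torus R -> X) : Prop :=
  in_Hardy mT p f /\
  forall alpha : Zindex, nonneg_index alpha ->
    fourier_coef mT f alpha = D (index_nat alpha).

Definition in_Hp (R : realType) (X : normedModType R[i])
    (mT : probability (torus R) R) (p : R) (D : dirichlet X) : Prop :=
  exists f : torus R -> X, is_lift mT p D f.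

(* Two functions with the same Fourier coefficients agree a.e., so the choice
   of f is immaterial.  Only meaningful when in_Hp mT p D holds. *)
Definition Hp_norm (R : realType) (X : normedModType R[i])
    (mT : probability (torus R) R) (p : R) (D : dirichlet X) : \bar R :=
  Lp_norm mT p (xget (fun _ : torus R => 0) [set f : torus R -> X | is_lift mT p D f]).

Definition randomize (R : realType) (X : normedModType R[i])
    (e : signs) (D : dirichlet X) : dirichlet X :=
  fun n => sgn R e n *: D n.

Definition in_Hp_rad (R : realType) (X : normedModType R[i])
    (mT : probability (torus R) R) (mS : probability signs R) (p : R)
    (D : dirichlet X) : Prop :=
  {ae mS, forall e, in_Hp mT p (randomize e D)}.

Definition Hp_rad_norm (R : realType) (X : normedModType R[i])
    (mT : probability (torus R) R) (mS : probability signs R) (p : R)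
    (D : dirichlet X) : \bar R :=
  (\int[mS]_e Hp_norm mT p (randomize e D))%E.

(* The Dirichlet series x n^{-s}, with a single term. *)
Definition dterm (R : realType) (X : normedModType R[i]) (n : nat) (x : X) :
    nat -> X :=
  fun k => if k == n then x else 0.

(* RUC for a sequence in a space V normed by N. *)
Definition RUC (R : realType) (V : lmodType R[i]) (mS : probability signs R)
    (N : V -> \bar R) (y : nat -> V) : Prop :=
  exists C : R, forall (m : nat) (a : nat -> R[i]),
    (\int[mS]_e N (\sum_(1 <= n < m.+1) (sgn R e n * a n) *: y n)%R <=
     C%:E * N (\sum_(1 <= n < m.+1) a n *: y n)%R)%E.

(* Main.v *)
Require Import Defs.
From mathcomp Require Import all_boot all_order all_algebra finmap.
From mathcomp Require Import complex.
From mathcomp Require Import all_classical all_reals all_analysis.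
From mathcomp Require Import measurable_realfun cyclic separable cyclotomic.
From mathcomp Require Import ring lra zify.
Import Order.TTheory GRing.Theory Num.Theory.
Import numFieldNormedType.Exports.
Set Implicit Arguments.
Unset Strict Implicit.
Unset Printing Implicit Defensive.
Local Open Scope classical_set_scope.
Local Open Scope ring_scope.
Local Open Scope complex_scope.

(** Condition (d) compares random sums with polynomials in one variable on the
    circle, and (b) compares them with polynomials in many variables on the torus,
    the Bohr lifts of Dirichlet polynomials.

    From (d) to (b): the prime exponents of the integers up to [N] are digits in
    base [N.+1], so that a linear form is injective on their multi-indices
    ([kronecker_inj]).  Along the corresponding one-parameter subgroup of the torus
    through a point [w], a Bohr lift is, up to a unimodular factor, a polynomial in
    one variable whose coefficients are the terms of the lift at [w].  The bound (d)
    controls the random sum of these terms, and an integration over [w] gives (b)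
    ([circle_bound_rad]).  Two facts enter: Haar measure is invariant along the
    subgroup ([integral_subgroup]), and by Kahane's inequality the moment of order
    [p] of a random sum is controlled by its mean ([kahane]), which lets
    expectation and integral commute.  Kahane's inequality follows from the
    hypercontractive inequality of Bonami, which is an elementary inequality for
    one sign and tensorizes ([bonami]).

    From (b) to (a): the constant in (b) does not depend on the coefficients, which
    may absorb the scalars ([rad_bound_RUC]).

    From (b) to (c): Fejer means approximate a lift by Dirichlet polynomials as fast
    as desired.  By (b) the increments of such an approximation have small
    randomizations in the mean, hence almost surely summable ones, and completeness
    provides a lift of the randomized series ([rad_bound_inclusion]).

    From (a) or (c) to (d), by a gliding hump: if (d) fails, there are polynomials on
    the circle with norm at most [2 ^- k] and random norm at least [2 ^+ k]
    ([hump_exists]).  The powers of a single prime form an isometric copy of the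
    circle ([block_norm]), so the polynomial of index [k] is placed on the powers of
    the prime of index [k].  The scalars in (a) may select one of these blocks,
    which contradicts unconditionality ([RUC_circle_bound]).  The sum of the blocks
    belongs to the Hardy space.  If almost all of its randomizations belonged to it
    as well, then the random blocks would be almost surely bounded, since the
    restriction to one coordinate is a contraction ([restrict_coord]).  But the
    first and second moments of random sums are comparable ([rademacher_L2_L1]), so
    that random sums with unbounded means are not almost surely bounded
    ([rademacher_ae_unbounded]).

    The norm of a Dirichlet polynomial is the norm of its Bohr lift because lifts
    are unique ([fourier_inj]).  This and the approximation by polynomials rest on
    the Fejer means of vector-valued functions on the torus, which are contractions
    because Haar measure is invariant ([fejer_contraction]) and converge because the
    trigonometric polynomials are dense ([tp_density]). *)

(** * Averages over finitely many signs *)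

Definition upd (n : nat) (b : bool) (e : nat -> bool) : nat -> bool :=
  fun k => if k == n then b else e k.

Definition flip (n : nat) (e : nat -> bool) : nat -> bool :=
  fun k => if k == n then ~~ e k else e k.

(** The numbering of signs starts at 1, like that of the terms of a series. *)
Definition depends (T : Type) (n : nat) (F : (nat -> bool) -> T) : Prop :=
  forall e e' : nat -> bool,
    (forall i, (0 < i <= n)%N -> e i = e' i) -> F e = F e'.

Lemma flip_upd n b e : flip n (upd n b e) = upd n (~~ b) e.
Proof. by apply/funext => k; rewrite /upd /flip; case: eqP. Qed.

Lemma flip_updC n m b e : n != m -> flip n (upd m b e) = upd m b (flip n e).
Proof.
move=> nm; apply/funext => k; rewrite /upd /flip.
by case: (eqVneq k n) => // ->; rewrite (negbTE nm).
Qed.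

Lemma upd_id n e : upd n (e n) e = e.
Proof. by apply/funext => k; rewrite /upd; case: eqP => // ->. Qed.

Lemma upd_flip n e : upd n (~~ e n) e = flip n e.
Proof. by apply/funext => k; rewrite /upd /flip; case: eqP => // ->. Qed.

Lemma depends_upd (T : Type) n (F : (nat -> bool) -> T) b :
  depends n.+1 F -> depends n (F \o upd n.+1 b).
Proof.
move=> dF e e' ee'; apply: dF => i /andP[i0 iN]; rewrite /upd.
by case: eqP => // /eqP ni; apply: ee'; rewrite i0 -ltnS ltn_neqAle ni.
Qed.

Section Average.
Context {R : realType}.
Implicit Types (F G : (nat -> bool) -> R) (n : nat).

(** The expectation of [F] when the signs of index 1 to [n] are independent and
    uniform, the other coordinates being frozen. *)
Fixpoint ave n F : R :=
  if n is m.+1 then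
    (ave m (F \o upd m.+1 false) + ave m (F \o upd m.+1 true)) / 2
  else F (fun=> false).

Lemma eq_ave n F G : F =1 G -> ave n F = ave n G.
Proof. by move=> /funext ->. Qed.

Lemma ler_ave n F G : (forall e, F e <= G e) -> ave n F <= ave n G.
Proof.
elim: n F G => [|n IH] F G FG /=; first exact: FG.
have := IH (F \o upd n.+1 false) (G \o upd n.+1 false) (fun e => FG _).
have := IH (F \o upd n.+1 true) (G \o upd n.+1 true) (fun e => FG _).
lra.
Qed.

Lemma ave_cst n (c : R) : ave n (fun=> c) = c.
Proof. by elim: n => [|n IH] //=; rewrite /comp IH; lra. Qed.

Lemma aveD n F G : ave n (fun e => F e + G e) = ave n F + ave n G.
Proof.
elim: n F G => [|n IH] F G //=.
have := IH (F \o upd n.+1 false) (G \o upd n.+1 false).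
have := IH (F \o upd n.+1 true) (G \o upd n.+1 true).
rewrite /comp => -> ->; lra.
Qed.

Lemma aveZ n (c : R) F : ave n (fun e => c * F e) = c * ave n F.
Proof.
elim: n F => [|n IH] F //=.
have := IH (F \o upd n.+1 false); have := IH (F \o upd n.+1 true).
rewrite /comp => -> ->; lra.
Qed.

Lemma aveB n F G : ave n (fun e => F e - G e) = ave n F - ave n G.
Proof.
rewrite (@eq_ave n _ (fun e => F e + (-1) * G e)); last by move=> e; lra.
by rewrite aveD aveZ; lra.
Qed.

Lemma ave_ge0 n F : (forall e, 0 <= F e) -> 0 <= ave n F.
Proof. by move=> F0; rewrite -(ave_cst n 0); exact: ler_ave. Qed.

Lemma ave_flip n F k : (0 < k <= n)%N -> ave n (F \o flip k) = ave n F.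
Proof.
elim: n F => [|n IH] F; first by case: k.
case: (eqVneq k n.+1) => [-> _ /=|kn kN /=].
  rewrite (@eq_ave n _ (F \o upd n.+1 true)); last by move=> e /=; rewrite flip_upd.
  rewrite (@eq_ave n ((F \o flip n.+1) \o upd n.+1 true) (F \o upd n.+1 false)).
    by rewrite addrC.
  by move=> e /=; rewrite flip_upd.
have kN' : (0 < k <= n)%N by move/eqP in kn; lia.
rewrite -(IH (F \o upd n.+1 false) kN') -(IH (F \o upd n.+1 true) kN').
by congr ((_ + _) / 2); apply: eq_ave => e /=; rewrite flip_updC.
Qed.

(** The quadratic polynomial [l |-> ave n (fun e => (F e - l * G e) ^+ 2)] is
    nonnegative; its minimum, or its slope if it is affine, gives the bound. *)
Lemma ave_CS n F G :
  ave n (fun e => F e * G e) ^+ 2 <=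
  ave n (fun e => F e ^+ 2) * ave n (fun e => G e ^+ 2).
Proof.
set X := ave n (fun e => F e ^+ 2); set Y := ave n (fun e => G e ^+ 2).
set Z := ave n _.
have q (l : R) : 0 <= X - 2 * l * Z + l ^+ 2 * Y.
  rewrite -!aveZ -aveB -aveD; apply: ave_ge0 => e.
  by rewrite [leRHS](_ : _ = (F e - l * G e) ^+ 2) ?sqr_ge0//; ring.
have Y0 : 0 <= Y by apply: ave_ge0 => e; exact: sqr_ge0.
have [Y1|Y1] := ltP 0 Y.
  have := q (Z / Y); rewrite -(ler_pM2r Y1) mul0r.
  have -> : (X - 2 * (Z / Y) * Z + (Z / Y) ^+ 2 * Y) * Y = X * Y - Z ^+ 2.
    by field; rewrite gt_eqF.
  by rewrite subr_ge0.
have YE : Y = 0 by apply/eqP; rewrite eq_le Y1.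
rewrite YE mulr0.
have [->|Z0] := eqVneq Z 0; first by rewrite expr0n.
have := q ((X + 1) / (2 * Z)); rewrite YE mulr0 addr0.
have -> : X - 2 * ((X + 1) / (2 * Z)) * Z = - 1 by field; rewrite Z0.
by rewrite lerNr oppr0 ler10.
Qed.

End Average.

(** * Hypercontractivity and the inequalities of Kahane *)

Section Hypercontractivity.
Context {R : realType}.
Implicit Types (F G : (nat -> bool) -> R) (n : nat).

(** The noise operator of parameter 1/2 on the signs of index 1 to [n]: it
    multiplies by 1/2 each of these signs in a Rademacher sum. *)
Fixpoint noise n F : (nat -> bool) -> R :=
  if n is m.+1 then noise m (fun e => 3/4 * F e + 1/4 * F (flip m.+1 e)) else F.

Lemma ler_noise n F G : (forall e, F e <= G e) -> forall e, noise n F e <= noise n G e.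
Proof.
elim: n F G => [|n IH] F G FG e //=; apply: IH => e'.
by have := FG e'; have := FG (flip n.+1 e'); lra.
Qed.

Lemma noise_ge0 n F : (forall e, 0 <= F e) -> forall e, 0 <= noise n F e.
Proof.
elim: n F => [|n IH] F F0 e //=; apply: IH => e'.
by have := F0 e'; have := F0 (flip n.+1 e'); lra.
Qed.

Lemma noise_lin n (a b : R) F G e :
  noise n (fun e => a * F e + b * G e) e = a * noise n F e + b * noise n G e.
Proof.
elim: n F G e => [|n IH] F G e //=; rewrite -IH; congr (noise n _ e).
by apply/funext => e'; ring.
Qed.

Lemma noise_upd n F m b e : (n < m)%N -> noise n F (upd m b e) = noise n (F \o upd m b) e.
Proof.
elim: n F e => [|n IH] F e nm //=; rewrite IH ?(ltnW nm)//.
by congr (noise n _ e); apply/funext => e' /=; rewrite flip_updC// ltn_eqF.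
Qed.

Lemma noise_sqr n F e : noise n F e ^+ 2 <= noise n (fun e => F e ^+ 2) e.
Proof.
elim: n F e => [|n IH] F e //=; apply: le_trans (IH _ _) _.
apply: ler_noise => e'; rewrite -subr_ge0.
rewrite [leRHS](_ : _ = 3 / 16 * (F e' - F (flip n.+1 e')) ^+ 2); last by field.
by rewrite mulr_ge0 ?sqr_ge0//; lra.
Qed.

(** Bonami's inequality.  In one variable it reads
    [a^4 + (3/2) a^2 b^2 + b^4/16 <= (a^2 + b^2)^2]; the products of several
    variables follow by induction, the mixed term being handled by the
    inequality of Cauchy and Schwarz. *)
Lemma bonami n F :
  ave n (fun e => noise n F e ^+ 4) <= ave n (fun e => F e ^+ 2) ^+ 2.
Proof.
elim: n F => [|n IH] F /=; first by rewrite -exprM.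
pose F0 := F \o upd n.+1 false; pose F1 := F \o upd n.+1 true.
pose A := fun e => 1/2 * F0 e + 1/2 * F1 e.
pose B := fun e => 1/2 * F0 e + (-1/2) * F1 e.
pose a := noise n A; pose b := noise n B.
have E0 e : noise n (fun e0 => 3/4 * F e0 + 1/4 * F (flip n.+1 e0)) (upd n.+1 false e)
    = a e + 1/2 * b e.
  rewrite noise_upd//; transitivity (noise n (fun e => 3/4 * F0 e + 1/4 * F1 e) e).
    by congr (noise n _ e); apply/funext => e' /=; rewrite flip_upd.
  by rewrite /a /b !noise_lin; field.
have E1 e : noise n (fun e0 => 3/4 * F e0 + 1/4 * F (flip n.+1 e0)) (upd n.+1 true e)
    = a e - 1/2 * b e.
  rewrite noise_upd//; transitivity (noise n (fun e => 3/4 * F1 e + 1/4 * F0 e) e).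
    by congr (noise n _ e); apply/funext => e' /=; rewrite flip_upd.
  by rewrite /a /b !noise_lin; field.
rewrite (@eq_ave _ n _ (fun e => (a e + 1/2 * b e) ^+ 4)); last by move=> e /=; rewrite E0.
rewrite (@eq_ave _ n (_ \o upd n.+1 true) (fun e => (a e - 1/2 * b e) ^+ 4)); last first.
  by move=> e /=; rewrite E1.
have -> : (ave n (fun e => (a e + 1/2 * b e) ^+ 4) + ave n (fun e => (a e - 1/2 * b e) ^+ 4)) / 2
   = ave n (fun e => a e ^+ 4) + 3/2 * ave n (fun e => a e ^+ 2 * b e ^+ 2)
     + 1/16 * ave n (fun e => b e ^+ 4).
  by rewrite -aveD -!aveZ -!aveD mulrC -aveZ; apply: eq_ave => e; field.
have -> : (ave n ((fun e => F e ^+ 2) \o upd n.+1 false) +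
            ave n ((fun e => F e ^+ 2) \o upd n.+1 true)) / 2 =
    ave n (fun e => A e ^+ 2) + ave n (fun e => B e ^+ 2).
  by rewrite -!aveD mulrC -aveZ; apply: eq_ave => e; rewrite /A /B /F0 /F1 /=; field.
have := IH A; have := IH B; rewrite -/a -/b.
have := ave_CS n (fun e => a e ^+ 2) (fun e => b e ^+ 2).
rewrite (@eq_ave _ n (fun e => (a e ^+ 2) ^+ 2) (fun e => a e ^+ 4)); last by move=> e; rewrite -exprM.
rewrite (@eq_ave _ n (fun e => (b e ^+ 2) ^+ 2) (fun e => b e ^+ 4)); last by move=> e; rewrite -exprM.
set x := ave n (fun e => A e ^+ 2); set y := ave n (fun e => B e ^+ 2).
set u := ave n (fun e => a e ^+ 4); set v := ave n (fun e => b e ^+ 4).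
set z := ave n (fun e => a e ^+ 2 * b e ^+ 2) => zuv vy ux.
have x0 : 0 <= x by apply: ave_ge0 => e; exact: sqr_ge0.
have y0 : 0 <= y by apply: ave_ge0 => e; exact: sqr_ge0.
have u0 : 0 <= u by apply: ave_ge0 => e; exact: exprn_even_ge0.
have v0 : 0 <= v by apply: ave_ge0 => e; exact: exprn_even_ge0.
have z0 : 0 <= z by apply: ave_ge0 => e; rewrite mulr_ge0// sqr_ge0.
have zxy : z <= x * y.
  rewrite -(@ler_pXn2r _ 2)// ?nnegrE ?mulr_ge0//; apply: le_trans zuv _.
  by rewrite exprMn ler_pM.
have : 0 <= x * y by rewrite mulr_ge0.
rewrite sqrrD -[x * y *+ 2]mulr_natr; lra.
Qed.

End Hypercontractivity.

Section Kahane.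
Context {R : realType}.

(** Rademacher sums of length [n] enter only through the seminorm that they
    induce on real coefficients.  This covers at once sums in the space of values
    and sums of functions, measured by an Lp norm. *)
Definition rademacher_seminorm (n : nat) (N : (nat -> R) -> R) : Prop :=
  [/\ forall c, 0 <= N c,
      forall c d, N (fun i => c i + d i) <= N c + N d,
      forall (t : R) c, N (fun i => t * c i) = `|t| * N c
    & forall c d, (forall i, (0 < i <= n)%N -> c i = d i) -> N c = N d].

Definition rsgn (e : nat -> bool) (i : nat) : R := (-1) ^+ nat_of_bool (e i).

Lemma rsgn_flip k e i :
  rsgn (flip k e) i = if i == k then - rsgn e i else rsgn e i.
Proof. by rewrite /rsgn /flip; case: eqP => // _; case: (e i); rewrite ?expr0 ?expr1 ?opprK. Qed.

Section Fixed.
Context (n : nat) (N : (nat -> R) -> R) (hN : rademacher_seminorm n N).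

Let S (e : nat -> bool) : R := N (rsgn e).

Lemma rademacher_depends1 : depends n S.
Proof. by case: hN => _ _ _ NE e e' ee'; apply: NE => i /ee' ie; rewrite /rsgn ie. Qed.

Let N_comb (a b : R) c d : 0 <= a -> 0 <= b ->
  N (fun i => a * c i + b * d i) <= a * N c + b * N d.
Proof.
case: hN => _ ND NZ _ a0 b0; apply: le_trans (ND _ _) _.
by rewrite !NZ !ger0_norm.
Qed.

(** Applied to the signs themselves the noise operator is multiplication by 1/2,
    and by convexity it may be moved out of the seminorm. *)
Lemma rademacher_noise e : S e <= 2 * noise n S e.
Proof.
case: hN => N0 ND NZ NE.
suff H m c : noise m (fun e => N (fun i => c i * rsgn e i)) e >=
    N (fun i => (if (0 < i <= m)%N then 1/2 * c i else c i) * rsgn e i).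
  have /(_ (fun=> 1)) := H n.
  rewrite (_ : (fun e => N (fun i => 1 * rsgn e i)) = S); last first.
    by apply/funext => e'; congr N; apply/funext => i; rewrite mul1r.
  rewrite (NE _ (fun i => 1/2 * rsgn e i)); last by move=> i ->; rewrite mulr1.
  by rewrite NZ ger0_norm ?divr_ge0// /S; lra.
elim: m c => [|m IH] c /=.
  rewrite [leLHS](_ : _ = N (fun i => c i * rsgn e i))//.
  by congr N; apply/funext => i; case: ifP => //; lia.
pose c' i := if i == m.+1 then 1/2 * c i else c i.
apply: le_trans (_ : noise m (fun e => N (fun i => c' i * rsgn e i)) e <= _).
  apply: le_trans (IH c'); rewrite le_eqVlt; apply/orP; left; apply/eqP.
  congr N; apply/funext => i; congr (_ * _); rewrite /c'.
  have [->|im] := eqVneq i m.+1; first by rewrite ltnn leqnn andbF.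
  have -> : (i <= m.+1)%N = (i <= m)%N by rewrite leq_eqVlt (negbTE im) ltnS.
  by [].
apply: ler_noise => e'.
have h34 : 0 <= 3 / 4 :> R by lra.
have h14 : 0 <= 1 / 4 :> R by lra.
apply: le_trans (N_comb (fun i => c i * rsgn e' i)
  (fun i => c i * rsgn (flip m.+1 e') i) h34 h14).
rewrite le_eqVlt; apply/orP; left; apply/eqP; congr N; apply/funext => i.
by rewrite rsgn_flip /c'; case: eqP => _; field.
Qed.

Let S0 e : 0 <= S e. Proof. by case: hN => N0 _ _ _; exact: N0. Qed.

Lemma rademacher_noiseX j e :
  S e ^+ (2 ^ j) <= 2 ^+ (2 ^ j) * noise n (fun e => S e ^+ (2 ^ j)) e.
Proof.
elim: j e => [|j IH] e; first by rewrite !expn0 expr1; exact: rademacher_noise.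
rewrite expnS mulnC !exprM.
have S0' := exprn_ge0 (2 ^ j) (S0 e).
apply: (@le_trans _ _ ((2 ^+ (2 ^ j) * noise n (fun e => S e ^+ (2 ^ j)) e) ^+ 2)).
  by rewrite ler_pXn2r// nnegrE ?mulr_ge0 ?noise_ge0// => e'; rewrite exprn_ge0.
rewrite exprMn ler_pM2l ?exprn_gt0//.
apply: le_trans (noise_sqr _ _ _) _; apply: ler_noise => e'; by rewrite -exprM.
Qed.

(** Bonami's inequality for the power [2 ^ j] of the random seminorm. *)
Lemma rademacher_moment_double j :
  ave n (fun e => S e ^+ (2 ^ j.+2)) <=
  (2 ^+ (2 ^ j)) ^+ 4 * ave n (fun e => S e ^+ (2 ^ j.+1)) ^+ 2.
Proof.
apply: le_trans (_ : (2 ^+ (2 ^ j)) ^+ 4 *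
   ave n (fun e => noise n (fun e => S e ^+ (2 ^ j)) e ^+ 4) <= _).
  rewrite -aveZ; apply: ler_ave => e; rewrite -exprMn.
  rewrite (_ : (2 ^ j.+2 = 2 ^ j * 4)%N); last by rewrite !expnS; lia.
  rewrite exprM; apply: lerXn2r; last exact: rademacher_noiseX.
    by rewrite nnegrE exprn_ge0.
  by rewrite nnegrE mulr_ge0 ?exprn_ge0 ?noise_ge0// => e'; rewrite exprn_ge0.
rewrite ler_pM2l ?exprn_gt0//; apply: le_trans (bonami _ _) _.
rewrite le_eqVlt; apply/orP; left; apply/eqP; congr (_ ^+ 2).
by apply: eq_ave => e; rewrite -exprM expnSr.
Qed.

(** Hypercontractivity bounds the fourth moment by the square of the second;
    splitting [S^2] at the level [l] gives [S^2 <= l S + S^4 / l^2], and a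
    level [l] of the order of the second moment gives the bound. *)
Lemma rademacher_L2_L1 :
  ave n (fun e => S e ^+ 2) <= 128 * ave n S ^+ 2.
Proof.
have := rademacher_moment_double 0; rewrite expn0 expr1 expn1.
set M := ave n (fun e => S e ^+ 2); rewrite (_ : (2 ^ 2 = 4)%N)// => M4.
have M0 : 0 <= M by apply: ave_ge0 => e; exact: sqr_ge0.
have A0 : 0 <= ave n S by apply: ave_ge0 => e; exact: S0.
have [ME|Mn0] := eqVneq M 0; first by rewrite ME mulr_ge0 ?sqr_ge0.
have Mp : 0 < M by rewrite lt_def Mn0.
pose l := Num.sqrt (32 * M).
have lp : 0 < l by rewrite sqrtr_gt0 mulr_gt0.
have l2 : l ^+ 2 = 32 * M by rewrite sqr_sqrtr// mulr_ge0.
have H : M <= l * ave n S + (l ^- 2) * ave n (fun e => S e ^+ 4).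
  rewrite -!aveZ -aveD; apply: ler_ave => e.
  have Se := S0 e; have l20 : 0 < l ^- 2 by rewrite invr_gt0 exprn_gt0.
  have [Sl|lS] := leP (S e) l.
    rewrite ler_wpDr ?mulr_ge0 ?exprn_ge0 ?(ltW l20) ?(ltW lp)//.
    by rewrite expr2 ler_wpM2r.
  rewrite ler_wpDl ?mulr_ge0 ?(ltW lp)// (_ : 4 = 2 + 2)%N// exprD mulrA.
  rewrite ler_peMl ?sqr_ge0// mulrC ler_pdivlMr ?exprn_gt0// mul1r.
  by rewrite ler_pXn2r ?nnegrE ?(ltW lp)// ltW.
have H2 : (l ^- 2) * ave n (fun e => S e ^+ 4) <= M / 2.
  rewrite l2 mulrC ler_pdivrMr ?mulr_gt0//; apply: le_trans M4 _.
  by rewrite expr2; lra.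
have H3 : M / 2 <= l * ave n S by lra.
have : (M / 2) ^+ 2 <= 32 * M * ave n S ^+ 2.
  by rewrite -l2 -exprMn ler_pXn2r ?nnegrE ?divr_ge0 ?mulr_ge0 ?(ltW lp).
rewrite (_ : (M / 2) ^+ 2 = M * (M / 4)); last by field.
by rewrite (mulrC 32) -mulrA ler_pM2l//; lra.
Qed.

Lemma rademacher_moment j :
  ave n (fun e => S e ^+ (2 ^ j.+1)) <=
  (128 ^+ (4 ^ j)) * ave n S ^+ (2 ^ j.+1).
Proof.
have A0 : 0 <= ave n S by apply: ave_ge0 => e; exact: S0.
elim: j => [|j IH]; first by rewrite expn0 expr1 expn1; exact: rademacher_L2_L1.
apply: le_trans (rademacher_moment_double _) _.
apply: (@le_trans _ _ ((2 ^+ (2 ^ j)) ^+ 4 * (128 ^+ (4 ^ j) * ave n S ^+ (2 ^ j.+1)) ^+ 2)).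
  rewrite ler_pM2l ?exprn_gt0// ler_pXn2r ?nnegrE ?mulr_ge0 ?exprn_ge0//.
  by apply: ave_ge0 => e; rewrite exprn_ge0.
rewrite exprMn mulrA -[(_ ^+ (2 ^ j.+1)) ^+ 2]exprM -expnSr.
rewrite ler_wpM2r ?exprn_ge0// -!exprM.
apply: (@le_trans _ _ (128 ^+ (2 ^ j * 2) * 128 ^+ (4 ^ j * 2))).
  rewrite ler_pM2r ?exprn_gt0// (_ : 2 ^ j * 4 = 2 * (2 ^ j * 2))%N; last by lia.
  by rewrite exprM ler_pXn2r ?nnegrE ?muln_gt0 ?expn_gt0//; lra.
rewrite -exprD ler_weXn2l//; first by lra.
have : (2 ^ j <= 4 ^ j)%N by case: (j) => // k; rewrite leq_exp2r.
by rewrite expnS; move: (2 ^ j)%N (4 ^ j)%N => a b; lia.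
Qed.

End Fixed.
End Kahane.

Section KahanePower.
Context {R : realType}.

Lemma ave_eq0 n (F : (nat -> bool) -> R) (g : R -> R) : (forall e, 0 <= F e) ->
  ave n F = 0 -> ave n (g \o F) = g 0.
Proof.
elim: n F => [|n IH] F F0 /=; first by move=> ->.
have := ave_ge0 n (fun e => F0 (upd n.+1 true e)).
have := ave_ge0 n (fun e => F0 (upd n.+1 false e)) => a0 b0 ab.
have E0 : ave n (F \o upd n.+1 false) = 0 by move: a0 b0 ab; rewrite /comp; lra.
have E1 : ave n (F \o upd n.+1 true) = 0 by move: a0 b0 ab; rewrite /comp; lra.
have := IH (F \o upd n.+1 false) (fun e => F0 _) E0.
have := IH (F \o upd n.+1 true) (fun e => F0 _) E1.
by rewrite /comp => -> ->; lra.
Qed.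

Lemma powR_midpoint (p a b : R) : 1 <= p -> 0 <= a -> 0 <= b ->
  ((a + b) / 2) `^ p <= (a `^ p + b `^ p) / 2.
Proof.
move=> p1 a0 b0.
have ha : 0 <= (1/2 : R) by lra.
have hb : (1/2 : R) <= 1 by lra.
have conv2 (x y : R^o) : conv (Itv01 ha hb) x y = (x + y) / 2.
  by rewrite convRE /= /unstable.onem; field.
have := convex_powR p1 (Itv01 ha hb) (x := a) (y := b).
rewrite !inE /= !in_itv /= !andbT => /(_ a0 b0).
by rewrite [leRHS]conv2 [X in X `^ _]conv2.
Qed.

(** Jensen's inequality follows from the midpoint inequality, one sign at a
    time. *)
Lemma ave_powR n (p : R) (F : (nat -> bool) -> R) : 1 <= p -> (forall e, 0 <= F e) ->
  ave n F `^ p <= ave n (fun e => F e `^ p).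
Proof.
move=> p1; elim: n F => [|n IH] F F0 //=.
apply: le_trans (powR_midpoint p1 _ _) _; try by apply: ave_ge0 => e; exact: F0.
have := IH (F \o upd n.+1 true) (fun e => F0 _).
have := IH (F \o upd n.+1 false) (fun e => F0 _).
by rewrite /comp; lra.
Qed.

(** The Khintchine-Kahane inequality.  If [p <= 2 ^ j.+1] and [t] is the quotient
    of the random seminorm by its mean, then [t ^ p <= 1 + t ^ (2 ^ j.+1)], and
    [rademacher_moment] bounds the moments whose order is a power of two. *)
Lemma kahane (p : R) : 0 <= p -> exists2 K : R, 0 <= K &
  forall n (N : (nat -> R) -> R), rademacher_seminorm n N ->
  ave n (fun e => N (rsgn e) `^ p) <= K * ave n (fun e => N (rsgn e)) `^ p.
Proof.
move=> p0; pose j := Num.truncn p.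
have pj : p <= (2 ^ j.+1)%:R.
  rewrite (le_trans (ltW (truncnS_gt p)))// ler_nat.
  exact: ltnW (ltn_expl _ _).
exists (1 + 128 ^+ (4 ^ j)); first by rewrite addr_ge0// exprn_ge0.
move=> n N hN; case: (hN) => N0 _ _ _.
have S0 e : 0 <= N (rsgn e) by [].
set A := ave n (fun e => N (rsgn e)); have A0 : 0 <= A by exact: ave_ge0.
have [AE|An0] := eqVneq A 0.
  have := ave_eq0 (fun x => x `^ p) S0 AE; rewrite /comp AE => ->.
  by rewrite ler_peMl ?powR_ge0// lerDl exprn_ge0.
have Ap : 0 < A by rewrite lt_def An0.
have H e : N (rsgn e) `^ p <= A `^ p * (1 + A ^- (2 ^ j.+1) * N (rsgn e) ^+ (2 ^ j.+1)).
  set s := N (rsgn e); have s0 : 0 <= s by exact: S0.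
  have sE : s = A * (s / A) by rewrite mulrC divfK.
  rewrite {1}sE powRM ?divr_ge0// ler_wpM2l ?powR_ge0//.
  rewrite (_ : A ^- _ * s ^+ _ = (s / A) ^+ (2 ^ j.+1)); last by rewrite expr_div_n mulrC.
  set t := s / A.
  have t0 : 0 <= t by rewrite divr_ge0.
  have [t1|t1] := leP t 1.
    apply: (@le_trans _ _ 1); last by rewrite lerDl exprn_ge0.
    by have := ge0_ler_powR p0 (x := t) (y := 1); rewrite powR1 !nnegrE; apply.
  apply: (@le_trans _ _ (t ^+ (2 ^ j.+1))); last by rewrite lerDr.
  by rewrite -powR_mulrn// ler_powR// ltW.
apply: le_trans (ler_ave n H) _; rewrite aveZ mulrC ler_wpM2r ?powR_ge0//.
rewrite aveD ave_cst aveZ lerD2l mulrC ler_pdivrMr ?exprn_gt0//.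
exact: rademacher_moment.
Qed.

(** The contraction principle: as a function of one real coefficient the
    expectation is even and convex, hence increasing on the positive axis. *)
Lemma contraction n (N : (nat -> R) -> R) (t : nat -> R) :
  rademacher_seminorm n N -> (forall i, `|t i| <= 1) ->
  ave n (fun e => N (fun i => t i * rsgn e i)) <= ave n (fun e => N (rsgn e)).
Proof.
move=> hN t1; case: (hN) => N0 ND NZ NE.
pose u m i : R := if (i <= m)%N then t i else 1.
suff H m : (m <= n)%N ->
    ave n (fun e => N (fun i => u m i * rsgn e i)) <= ave n (fun e => N (rsgn e)).
  apply: le_trans (H n (leqnn n)); rewrite le_eqVlt; apply/orP; left; apply/eqP.
  by apply: eq_ave => e; apply: NE => i /andP[_ iN]; rewrite /u iN.
elim: m => [|m IH] mn.
  rewrite le_eqVlt; apply/orP; left; apply/eqP.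
  by apply: eq_ave => e; apply: NE => i /andP[i0 _]; rewrite /u leqNgt i0 mul1r.
apply: le_trans (IH (ltnW mn)).
pose F e := N (fun i => u m i * rsgn e i).
rewrite -/F; set a := (1 + t m.+1) / 2; set b := (1 - t m.+1) / 2.
have ab : a + b = 1 by rewrite /a /b; lra.
have := t1 m.+1; rewrite ler_norml => /andP[tm1 t1m].
have a0 : 0 <= a by rewrite /a; lra.
have b0 : 0 <= b by rewrite /b; lra.
apply: le_trans (_ : ave n (fun e => a * F e + b * F (flip m.+1 e)) <= _).
  apply: ler_ave => e; rewrite /F -[a in leRHS]ger0_norm// -[b in leRHS]ger0_norm//.
  rewrite -!NZ; apply: le_trans (ND _ _).
  rewrite le_eqVlt; apply/orP; left; apply/eqP; congr N; apply/funext => i.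
  rewrite rsgn_flip /u; case: (eqVneq i m.+1) => [->|im].
    by rewrite leqnn ltnn /a /b; field.
  by rewrite leq_eqVlt (negbTE im) ltnS -mulrDl ab mul1r.
rewrite aveD !aveZ (_ : ave n (fun e => F (flip m.+1 e)) = ave n F); last first.
  by rewrite -(@ave_flip _ n F m.+1).
by rewrite -mulrDl ab mul1r.
Qed.

End KahanePower.

(** * Measure preserving maps and the measure on signs *)

Lemma ge0_integral_preserving d (T : measurableType d) (R : realType)
    (mu : probability T R) (phi : T -> T) (f : T -> \bar R) :
  measurable_fun setT phi ->
  (forall A, measurable A -> mu (phi @^-1` A) = mu A) ->
  measurable_fun setT f -> (forall x, (0 <= f x)%E) ->
  (\int[mu]_x f (phi x) = \int[mu]_x f x)%E.
Proof.
move=> mphi inv mf f0.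
rewrite -[RHS](@eq_measure_integral _ _ _ _ _ (pushforward mu phi)).
  by rewrite ge0_integral_pushforward.
by move=> A mA _ /=; rewrite /pushforward inv.
Qed.

Lemma measurable_coord d (G : measurableType d) i :
  measurable_fun setT (fun w : powN G => w i).
Proof.
move=> _ B mB; rewrite setTI; apply: sub_sigma_algebra.
by exists i, B.
Qed.

Lemma measurable_powN d (G : measurableType d) d' (T : measurableType d')
    (f : T -> powN G) :
  (forall i, measurable_fun setT (fun t => f t i)) -> measurable_fun setT f.
Proof.
move=> mf; apply: measurability => //= _ [_ [i [B [mB ->]]] <-].
exact: mf.
Qed.

Section Signs.
Context {R : realType}.

Lemma measurable_depends (n : nat) (F : (nat -> bool) -> R) (iota : nat -> nat) :
  depends n F -> measurable_fun setT (fun e : signs => F (e \o iota)).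
Proof.
elim: n F => [|n IH] F dF.
  rewrite [X in measurable_fun _ X](_ : _ = cst (F (fun=> false))).
    exact: measurable_cst.
  by apply/funext => e; apply: dF => i /andP[i0]; rewrite leqNgt i0.
rewrite [X in measurable_fun _ X](_ : _ = fun e : signs =>
   if e (iota n.+1) then (F \o upd n.+1 true) (e \o iota)
   else (F \o upd n.+1 false) (e \o iota)).
  apply: measurable_fun_ifT; first exact: measurable_coord.
    by apply: IH; exact: depends_upd.
  by apply: IH; exact: depends_upd.
apply/funext => e /=.
have := upd_id n.+1 (e \o iota); rewrite /comp.
by case: (e (iota n.+1)) => ->.
Qed.

Context (mS : probability signs R) (hS : is_haar_signs mS).

(** Flipping one sign preserves the measure, which allows to average over each
    of the signs on which the function depends.  The reindexing [iota] lets
    these signs sit at arbitrary places. *)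
Lemma integral_depends (n : nat) (F : (nat -> bool) -> R) (iota : nat -> nat) :
  {in [pred i | (0 < i <= n)%N] &, injective iota} ->
  depends n F -> (forall e, 0 <= F e) ->
  (\int[mS]_e (F (e \o iota))%:E = (ave n F)%:E)%E.
Proof.
elim: n F => [|n IH] F inj dF F0.
  rewrite (_ : (fun e => _) = cst (F (fun=> false))%:E).
    by rewrite integral_cst//= -[RHS]mule1; congr (_ * _)%E; exact: (@probability_setT _ _ _ mS).
  by apply/funext => e; congr _%:E; apply: dF => i /andP[i0]; rewrite leqNgt i0.
have mF b : measurable_fun setT (fun e : signs => ((F \o upd n.+1 b) (e \o iota))%:E).
  apply/measurable_EFinP; apply: (@measurable_depends n).
  exact: depends_upd.
have mF' : measurable_fun setT (fun e : signs => (F (e \o iota))%:E).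
  by apply/measurable_EFinP; apply: (@measurable_depends n.+1).
pose k := iota n.+1.
have invk : (\int[mS]_e (F (e \o iota))%:E = \int[mS]_e (F (flip k e \o iota))%:E)%E.
  pose g : signs := fun i => i == k.
  have gE e : flip k e = powN_mul addb g e.
    by apply/funext => i; rewrite /flip /powN_mul /g; case: eqP => _; case: (e i).
  apply/esym; under eq_integral => e _ do rewrite gE.
  apply: (@ge0_integral_preserving _ _ _ mS (powN_mul addb g)
    (fun e => (F (e \o iota))%:E)) => //; last by move=> e; rewrite lee_fin.
    apply: measurable_powN => i; rewrite /powN_mul.
    apply: (@measurableT_comp _ _ _ _ _ _ (addb (g i))) => //.
    exact: measurable_coord.
  by move=> B mB; exact: hS.
have hd e : ((F (e \o iota))%:E + (F (flip k e \o iota))%:E =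
   ((F \o upd n.+1 false) (e \o iota))%:E + ((F \o upd n.+1 true) (e \o iota))%:E)%E.
  have -> : F (flip k e \o iota) = F (flip n.+1 (e \o iota)).
    apply: dF => i i0; rewrite /flip /= /k; case: (eqVneq i n.+1) => [->|ni].
      by rewrite eqxx.
    by case: eqP => // /inj E; move: ni; rewrite E ?eqxx// inE /= ?i0 ?leqnn.
  rewrite -(upd_flip n.+1 (e \o iota)) /=.
  by have := upd_id n.+1 (e \o iota) => /=; case: (e (iota n.+1)) => {1}<- //; rewrite addeC.
have IHb b : (\int[mS]_e ((F \o upd n.+1 b) (e \o iota))%:E =
    (ave n (F \o upd n.+1 b))%:E)%E.
  have inj' : {in [pred i | (0 < i <= n)%N] &, injective iota}.
    move=> i j; rewrite !inE => /andP[i0 iN] /andP[j0 jN].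
    by apply: inj; rewrite inE ?i0 ?j0 leqW.
  apply: (IH _ inj') => [|e]; last exact: F0.
  exact: (depends_upd b dF).
have h2 : (\int[mS]_e (F (e \o iota))%:E + \int[mS]_e (F (e \o iota))%:E =
    (ave n (F \o upd n.+1 false))%:E + (ave n (F \o upd n.+1 true))%:E)%E.
  rewrite {2}invk -ge0_integralD//; first last.
  - rewrite (_ : (fun e => _) = (fun e : signs => ((F (flip k e \o iota))%:E : \bar R)))//.
    have -> : (fun e : signs => (F (flip k e \o iota))%:E) = (fun e =>
       ((F \o upd n.+1 false) (e \o iota))%:E + ((F \o upd n.+1 true) (e \o iota))%:E
        - (F (e \o iota))%:E)%E.
      by apply/funext => e; rewrite -hd addeAC subee ?add0e.
    by apply: emeasurable_funB => //; exact: emeasurable_funD.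
  - by move=> e _; rewrite lee_fin.
  - by move=> e _; rewrite lee_fin.
  under eq_integral => e _ do rewrite hd.
  rewrite ge0_integralD//; try by move=> e _; rewrite lee_fin /=.
  by rewrite !IHb.
have I0 : (0 <= \int[mS]_e (F (e \o iota))%:E)%E.
  by apply: integral_ge0 => e _; rewrite lee_fin.
move: h2 I0; case: (\int[mS]_e (F (e \o iota))%:E)%E => [r||]//= h2 _.
by move: h2; rewrite -!EFinD => -[] h2; congr _%:E; lra.
Qed.

End Signs.

(** * Strongly measurable functions *)

Section RealNorm.
Context {R : realType} {X : normedModType R[i]}.
Implicit Types (x y : X) (c : R[i]).

Lemma rnormE x : `|x| = (rnorm x)%:C.
Proof. by rewrite /rnorm RRe_real// ger0_real. Qed.

Lemma rnorm_ge0 x : 0 <= rnorm x.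
Proof. by rewrite -ler0c -rnormE. Qed.

Lemma rnorm0 : rnorm (0 : X) = 0.
Proof. by rewrite /rnorm normr0. Qed.

Lemma rnorm_eq0 x : rnorm x = 0 -> x = 0.
Proof. by move=> x0; apply/eqP; rewrite -normr_eq0 rnormE x0. Qed.

Lemma ler_rnormD x y : rnorm (x + y) <= rnorm x + rnorm y.
Proof. by rewrite -lecR rmorphD/= -!rnormE ler_normD. Qed.

Lemma rnormN x : rnorm (- x) = rnorm x.
Proof. by rewrite /rnorm normrN. Qed.

Lemma ler_rnormB x y : rnorm (x - y) <= rnorm x + rnorm y.
Proof. by rewrite (le_trans (ler_rnormD _ _))// rnormN. Qed.

Lemma rnormBC x y : rnorm (x - y) = rnorm (y - x).
Proof. by rewrite -rnormN opprB. Qed.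

Lemma rnorm_dist x y : `|rnorm x - rnorm y| <= rnorm (x - y).
Proof.
rewrite ler_norml lerNl opprB !lerBlDr; apply/andP; split.
  by rewrite rnormBC (le_trans _ (ler_rnormD _ _))// subrK.
by rewrite (le_trans _ (ler_rnormD _ _))// subrK.
Qed.

Lemma rnormZ c x : rnorm (c *: x) = rnorm (c : R[i]^o) * rnorm x.
Proof.
apply: complexI; rewrite rmorphM/= -!rnormE normrZ; congr (_ * _).
Qed.

Lemma ler_rnorm_sum I (s : seq I) (F : I -> X) :
  rnorm (\sum_(i <- s) F i) <= \sum_(i <- s) rnorm (F i).
Proof.
elim/big_ind2 : _ => //; first by rewrite rnorm0.
by move=> x a y b xa yb; rewrite (le_trans (ler_rnormD _ _))// lerD.
Qed.

Lemma cvg_rnorm (s : nat -> X) x :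
  s @ \oo --> x <-> (fun n => rnorm (s n - x)) @ \oo --> (0 : R).
Proof.
split.
  move=> /cvgrPdist_lt sx; apply/cvgrPdist_lt => eps eps0.
  have e0 : 0 < eps%:C by rewrite ltcR.
  have := sx _ e0; apply: filterS => n.
  by rewrite rnormE ltcR sub0r normrN ger0_norm ?rnorm_ge0// rnormBC.
move=> /cvgrPdist_lt sx; apply/cvgrPdist_lt => eps eps0.
have epsE : eps = (complex.Re eps)%:C by rewrite RRe_real// gtr0_real.
have e0 : 0 < complex.Re eps by rewrite -ltcR -epsE.
have := sx _ e0; apply: filterS => n.
by rewrite sub0r normrN ger0_norm ?rnorm_ge0// rnormE epsE ltcR rnormBC.
Qed.

End RealNorm.

Lemma squeeze0 (R : realType) (u v : nat -> R) :
  (forall n, 0 <= u n <= v n) -> v @ \oo --> (0 : R) -> u @ \oo --> (0 : R).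
Proof.
move=> uv v0; apply: (squeeze_cvgr _ (cvg_cst 0) v0).
exact: nearW.
Qed.

Section SimpleFunctions.
Context d (T : measurableType d).

Lemma simple_preimage (Y : Type) (s : T -> Y) (B : set Y) :
  simple_fun s -> measurable (s @^-1` B).
Proof.
move=> [fs ms].
rewrite (_ : s @^-1` B = \bigcup_(y in range s `&` B) (s @^-1` [set y])).
  apply: fin_bigcup_measurable => //; exact: finite_setIl.
apply/seteqP; split=> [t Bt|t [y [_ By] /= ->//]].
by exists (s t) => //; split => //; exists t.
Qed.

Lemma simple_comp (Y Z : Type) (F : Y -> Z) (s : T -> Y) :
  simple_fun s -> simple_fun (F \o s).
Proof.
move=> hs; case: (hs) => fs _.
split; last by move=> z; rewrite comp_preimage; exact: simple_preimage.
by rewrite -(image_comp s F); exact: finite_image.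
Qed.

Lemma simple_pair (Y Z : Type) (s : T -> Y) (t : T -> Z) :
  simple_fun s -> simple_fun t -> simple_fun (fun w => (s w, t w)).
Proof.
move=> [fs ms] [ft mt]; split.
  apply: (@sub_finite_set _ _ (range s `*` range t)); last exact: finite_setX.
  by move=> _ [w _ <-]; split; exists w.
move=> [y z].
rewrite (_ : _ @^-1` _ = (s @^-1` [set y]) `&` (t @^-1` [set z])).
  exact: measurableI.
by apply/seteqP; split => w /=; [case | case=> -> ->].
Qed.

Lemma simple_comp2 (Y Z W : Type) (F : Y -> Z -> W) (s : T -> Y) (t : T -> Z) :
  simple_fun s -> simple_fun t -> simple_fun (fun w => F (s w) (t w)).
Proof.
move=> hs ht.
exact: (simple_comp (fun yz => F yz.1 yz.2) (simple_pair hs ht)).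
Qed.

Lemma simple_cst (Y : Type) (y : Y) : simple_fun (fun _ : T => y).
Proof.
split=> [|z]; first by apply: (sub_finite_set _ (finite_set1 y)) => _ [_ _ <-].
by rewrite preimage_cst; case: ifP => _; [exact: measurableT|exact: measurable0].
Qed.

Lemma simple_indic (A : set T) : measurable A -> simple_fun (fun t => `[< A t >]).
Proof.
move=> mA; split; first exact: finite_finset.
case.
  by rewrite (_ : _ @^-1` _ = A)//; apply/seteqP; split => t /= /asboolP.
rewrite (_ : _ @^-1` _ = ~` A); first exact: measurableC.
by apply/seteqP; split => t /=; case: asboolP.
Qed.

Lemma simple_measurable d' (Y : measurableType d') (s : T -> Y) :
  simple_fun s -> measurable_fun setT s.
Proof. by move=> hs _ B _; rewrite setTI; exact: simple_preimage. Qed.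

Lemma simple_precomp d' (T' : measurableType d') (phi : T' -> T) (Y : Type)
    (s : T -> Y) :
  measurable_fun setT phi -> simple_fun s -> simple_fun (s \o phi).
Proof.
move=> mphi [fs ms]; split; first by apply: sub_finite_set fs => _ [t _ <-]; exists (phi t).
by move=> y; rewrite comp_preimage -[_ @^-1` _]setTI; apply: mphi => //; exact: ms.
Qed.

End SimpleFunctions.

Import HBSimple.

Section StronglyMeasurable.
Context d (T : measurableType d) (R : realType).
Implicit Types X Y Z : normedModType R[i].

Lemma sm_simple X (s : T -> X) : simple_fun s -> strongly_measurable s.
Proof. by move=> hs; exists (fun _ => s); split => // t; exact: cvg_cst. Qed.

Lemma sm_comp2 X Y Z (F : X -> Y -> Z) (f : T -> X) (g : T -> Y) :
  (forall (u : nat -> X) (v : nat -> Y) x y, u @ \oo --> x -> v @ \oo --> y ->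
     (fun n => F (u n) (v n)) @ \oo --> F x y) ->
  strongly_measurable f -> strongly_measurable g ->
  strongly_measurable (fun t => F (f t) (g t)).
Proof.
move=> cF [s [hs sf]] [s' [hs' sg]].
exists (fun k t => F (s k t) (s' k t)); split.
  by move=> k; exact: simple_comp2.
by move=> t; apply: cF; [exact: sf|exact: sg].
Qed.

Lemma sm_add X (f g : T -> X) : strongly_measurable f -> strongly_measurable g ->
  strongly_measurable (fun t => f t + g t).
Proof. by apply: (@sm_comp2 X X X (fun a b => a + b)) => u v x y ux vy; exact: cvgD. Qed.

Lemma sm_scale X (c : T -> R[i]^o) (f : T -> X) : strongly_measurable c ->
  strongly_measurable f -> strongly_measurable (fun t => c t *: f t).
Proof. by apply: (@sm_comp2 (R[i]^o) X X (fun a x => a *: x) c f) => u v x y ux vy; exact: cvgZ. Qed.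

Lemma sm_cst X (x : X) : strongly_measurable (fun _ : T => x).
Proof. exact/sm_simple/simple_cst. Qed.

Lemma sm_scaler X (c : R[i]) (f : T -> X) :
  strongly_measurable f -> strongly_measurable (fun t => c *: f t).
Proof. by apply: sm_scale; exact: sm_cst. Qed.

Lemma sm_sub X (f g : T -> X) : strongly_measurable f -> strongly_measurable g ->
  strongly_measurable (fun t => f t - g t).
Proof. by apply: (@sm_comp2 X X X (fun a b => a - b)) => u v x y ux vy; exact: cvgB. Qed.

Lemma sm_sum X I (s : seq I) (F : I -> T -> X) :
  (forall i, strongly_measurable (F i)) ->
  strongly_measurable (fun t => \sum_(i <- s) F i t).
Proof.
move=> mF; elim: s => [|i s IH].
  by under eq_fun do rewrite big_nil; exact: sm_cst.
by under eq_fun do rewrite big_cons; exact: sm_add.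
Qed.

Lemma sm_precomp d' (T' : measurableType d') (phi : T' -> T) X (f : T -> X) :
  measurable_fun setT phi -> strongly_measurable f -> strongly_measurable (f \o phi).
Proof.
move=> mphi [s [hs sf]]; exists (fun k => s k \o phi); split; last by move=> t; exact: sf.
by move=> k; exact: simple_precomp.
Qed.

Lemma sm_rnorm X (f : T -> X) : strongly_measurable f ->
  measurable_fun setT (fun t => rnorm (f t)).
Proof.
move=> [s [hs sf]].
apply: (@measurable_fun_cvg _ _ _ setT (fun k t => rnorm (s k t))).
  move=> k; apply: simple_measurable; exact: (simple_comp (@rnorm R X) (hs k)).
move=> t _; have /cvg_rnorm H := sf t.
apply/cvgrPdist_lt => e e0; move/cvgrPdist_lt : H => /(_ e e0); apply: filterS => k.
rewrite sub0r normrN ger0_norm ?rnorm_ge0// => H.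
by rewrite (le_lt_trans (rnorm_dist _ _))// rnormBC.
Qed.

(** Real measurable functions are pointwise limits of simple functions; this is
    applied to the real and to the imaginary part. *)
Lemma sm_complex (c : T -> R[i]^o) :
  measurable_fun setT (fun t => complex.Re (c t)) ->
  measurable_fun setT (fun t => complex.Im (c t)) -> strongly_measurable c.
Proof.
have H (u : T -> R) : measurable_fun setT u -> exists s : nat -> T -> R,
    (forall k, simple_fun (s k)) /\ forall t, s ^~ t @ \oo --> u t.
  move=> mu; have mu' : measurable_fun setT (EFin \o u) by exact/measurable_EFinP.
  have [g gu] := approximation_sfun (@measurableT _ T) mu'.
  exists (fun k => HBSimple.SimpleFun.sort (g k)); split=> [k|t].
    split; first exact: fimfunP.
    by move=> x; rewrite -[_ @^-1` _]setTI; apply: measurable_funP.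
  by have /fine_cvgP[_] := gu t I.
move=> /H[s [hs su]] /H[s' [hs' sv]].
exists (fun k t => Complex (s k t) (s' k t)); split.
  by move=> k; exact: simple_comp2.
move=> t; apply/cvg_rnorm.
apply: (@squeeze0 _ _ (fun k => `|s k t - complex.Re (c t)| + `|s' k t - complex.Im (c t)|)).
  move=> k; rewrite rnorm_ge0/=.
  set a := s k t - _; set b := s' k t - _.
  rewrite (_ : _ - _ = a%:C + 'i * b%:C); last first.
    by rewrite /a /b; case: (c t) => x y /=; simpc.
  apply: le_trans (ler_rnormD _ _) _.
  rewrite /rnorm !normc_def/= !(expr0n, addr0, mul0r, mul1r, add0r, sub0r, oppr0, mulr0).
  by rewrite !sqrtr_sqr.
rewrite -(addr0 0); apply: cvgD.
  apply/norm_cvg0P; apply/subr_cvg0; exact: su.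
apply/norm_cvg0P; apply/subr_cvg0; exact: sv.
Qed.

End StronglyMeasurable.

(** * Lebesgue-Bochner spaces *)

Lemma lee_poweR (R : realType) (r : R) (x y : \bar R) :
  0 <= r -> (0 <= x)%E -> (x <= y)%E -> (x `^ r <= y `^ r)%E.
Proof.
move=> r0 x0 xy; apply: gt0_ler_poweR => //; rewrite in_itv/= leey andbT//.
exact: le_trans xy.
Qed.

Lemma cvg_powR (R : realType) (p : R) (u : nat -> R) (l : R) :
  0 < p -> (forall n, 0 <= u n) -> 0 <= l -> u @ \oo --> l ->
  (fun n => u n `^ p) @ \oo --> l `^ p.
Proof.
move=> p0 u0; rewrite le_eqVlt => /predU1P[<-|l0] ul.
  rewrite powR0 ?gt_eqF//; apply/cvgrPdist_lt => eps eps0.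
  have d0 : 0 < eps `^ p^-1 by rewrite powR_gt0.
  have /cvgrPdist_lt/(_ _ d0) := ul; apply: filterS => k.
  rewrite !sub0r !normrN !ger0_norm ?powR_ge0// => ltk.
  rewrite -[eps]powRr1 ?(ltW eps0)// -(mulVf (lt0r_neq0 p0)) powRrM.
  by rewrite gt0_ltr_powR// ?nnegrE ?powR_ge0.
have up : \forall n \near \oo, 0 < u n by apply: (cvgr_gt _ ul).
rewrite (_ : l `^ p = expR (p * ln l)); last by rewrite /powR gt_eqF.
apply: (@cvg_trans _ ((fun n => expR (p * ln (u n))) @ \oo)).
  apply: near_eq_cvg; apply: filterS up => n un0; by rewrite /powR gt_eqF.
have lnu : (fun n => ln (u n)) @ \oo --> ln l.
  exact: (cvg_comp u (@ln R) ul (continuous_ln l0)).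
have plnu : (fun n => p * ln (u n)) @ \oo --> p * ln l.
  by apply: cvgM => //; exact: cvg_cst.
exact: (cvg_comp (fun n => p * ln (u n)) (@expR R) plnu (@continuous_expR R _)).
Qed.

Section LpNorm.
Context d (T : measurableType d) (R : realType) (mu : probability T R).
Context (p : R) (p1 : 1 <= p).
Implicit Types X Y : normedModType R[i].

Let p0 : 0 < p. Proof. exact: lt_le_trans p1. Qed.
Let pn0 : p != 0. Proof. by rewrite gt_eqF. Qed.

Lemma Lp_normE X (f : T -> X) :
  Lp_norm mu p f = ((\int[mu]_t (rnorm (f t) `^ p)%:E) `^ p^-1)%E.
Proof.
rewrite /Lp_norm Lnorm.unlock /=; under eq_integral => t _ do
  rewrite ger0_norm ?rnorm_ge0//.
by [].
Qed.

Lemma Lp_norm_ge0 X (f : T -> X) : (0 <= Lp_norm mu p f)%E.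
Proof. exact: Lnorm_ge0. Qed.

Lemma sm_powR X (f : T -> X) : strongly_measurable f ->
  measurable_fun setT (fun t => (rnorm (f t) `^ p)%:E).
Proof.
move=> mf; apply/measurable_EFinP.
by apply: (measurableT_comp (measurable_powR p)); exact: sm_rnorm.
Qed.

Lemma Lp_norm_leP X (f : T -> X) (e : R) : 0 <= e ->
  (Lp_norm mu p f <= e%:E)%E <-> (\int[mu]_t (rnorm (f t) `^ p)%:E <= (e `^ p)%:E)%E.
Proof.
move=> e0; rewrite Lp_normE.
have I0 : (0 <= \int[mu]_t (rnorm (f t) `^ p)%:E)%E.
  by apply: integral_ge0 => t _; rewrite lee_fin powR_ge0.
split => h.
  rewrite -(poweRe1 I0) -[X in (_ `^ X)%E](mulVf pn0) poweRrM -poweR_EFin.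
  by apply: lee_poweR (poweR_ge0 _ _) h; exact: ltW.
rewrite -[e%:E]poweRe1 ?lee_fin// -[X in (_ <= _ `^ X)%E](mulfV pn0) poweRrM poweR_EFin.
by apply: lee_poweR I0 h; rewrite invr_ge0 ltW.
Qed.

Lemma Lp_norm_powR X (f : T -> X) :
  (Lp_norm mu p f `^ p = \int[mu]_t (rnorm (f t) `^ p)%:E)%E.
Proof.
rewrite Lp_normE -poweRrM mulVf// poweRe1//.
by apply: integral_ge0 => t _; rewrite lee_fin powR_ge0.
Qed.

Lemma Lp_norm_mono X Y (f : T -> X) (g : T -> Y) :
  strongly_measurable f -> strongly_measurable g ->
  (forall t, rnorm (f t) <= rnorm (g t)) -> (Lp_norm mu p f <= Lp_norm mu p g)%E.
Proof.
move=> mf mg fg; rewrite !Lp_normE.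
apply: lee_poweR; first by rewrite invr_ge0 ltW.
  by apply: integral_ge0 => t _; rewrite lee_fin powR_ge0.
apply: ge0_le_integral => //; try exact: sm_powR.
  by move=> t _; rewrite lee_fin powR_ge0.
by move=> t _; rewrite lee_fin ge0_ler_powR ?nnegrE ?rnorm_ge0 ?(ltW p0).
Qed.

Lemma eq_Lp_norm X Y (f : T -> X) (g : T -> Y) :
  (forall t, rnorm (f t) = rnorm (g t)) -> Lp_norm mu p f = Lp_norm mu p g.
Proof.
by move=> fg; rewrite !Lp_normE; under eq_integral => t _ do rewrite fg.
Qed.

Lemma Lp_normD X (f g : T -> X) : strongly_measurable f -> strongly_measurable g ->
  (Lp_norm mu p (fun t => f t + g t)%R <= Lp_norm mu p f + Lp_norm mu p g)%E.
Proof.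
move=> mf mg.
have := @minkowski_EFin _ _ _ mu (fun t => rnorm (f t)) (fun t => rnorm (g t)) p (sm_rnorm mf) (sm_rnorm mg) p1.
rewrite -[X in (_ <= X)%E -> _]/(Lp_norm mu p f + Lp_norm mu p g)%E.
apply: le_trans.
rewrite Lp_normE Lnorm.unlock /=.
under [X in (_ <= X `^ _)%E]eq_integral => t _ do
  rewrite ger0_norm ?addr_ge0 ?rnorm_ge0//.
apply: lee_poweR; first by rewrite invr_ge0 ltW.
  by apply: integral_ge0 => t _; rewrite lee_fin powR_ge0.
apply: ge0_le_integral => //.
- by move=> t _; rewrite lee_fin powR_ge0.
- by apply: sm_powR; exact: sm_add.
- apply/measurable_EFinP; apply: (measurableT_comp (measurable_powR p)).
  by apply: measurable_funD; exact: sm_rnorm.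
- move=> t _; rewrite lee_fin ge0_ler_powR ?nnegrE ?addr_ge0 ?rnorm_ge0 ?(ltW p0)//.
  exact: ler_rnormD.
Qed.

Lemma Lp_normN X (f : T -> X) : Lp_norm mu p (fun t => - f t)%R = Lp_norm mu p f.
Proof. by apply: eq_Lp_norm => t; rewrite rnormN. Qed.

Lemma Lp_normB X (f g : T -> X) : strongly_measurable f -> strongly_measurable g ->
  (Lp_norm mu p (fun t => f t - g t)%R <= Lp_norm mu p f + Lp_norm mu p g)%E.
Proof.
move=> mf mg; rewrite -(Lp_normN g); apply: Lp_normD => //.
by rewrite (_ : (fun t => _) = fun t => 0 - g t)%R; [exact/sm_sub/mg/sm_cst|
  apply/funext => t; rewrite sub0r].
Qed.

Lemma Lp_normBC X (f g : T -> X) :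
  Lp_norm mu p (fun t => f t - g t)%R = Lp_norm mu p (fun t => g t - f t)%R.
Proof. by apply: eq_Lp_norm => t; rewrite rnormBC. Qed.

Lemma Lp_norm_tri X (f g h : T -> X) : strongly_measurable f ->
  strongly_measurable g -> strongly_measurable h ->
  (Lp_norm mu p (fun t => f t - h t)%R <=
   Lp_norm mu p (fun t => f t - g t)%R + Lp_norm mu p (fun t => g t - h t)%R)%E.
Proof.
move=> mf mg mh; rewrite (_ : (fun t => f t - h t) = fun t => (f t - g t) + (g t - h t)).
  by apply: Lp_normD; exact: sm_sub.
by apply/funext => t; rewrite addrA subrK.
Qed.

Lemma Lp_norm_tri0 X (f g : T -> X) : strongly_measurable f ->
  strongly_measurable g ->
  (Lp_norm mu p f <= Lp_norm mu p (fun t => f t - g t)%R + Lp_norm mu p g)%E.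
Proof.
move=> mf mg; rewrite {1}(_ : f = fun t => (f t - g t) + g t).
  by apply: Lp_normD => //; exact: sm_sub.
by apply/funext => t; rewrite subrK.
Qed.

Lemma Lp_normZ X (c : R[i]) (f : T -> X) : strongly_measurable f ->
  (Lp_norm mu p (fun t => c *: f t)%R = (rnorm (c : R[i]^o))%:E * Lp_norm mu p f)%E.
Proof.
move=> mf; rewrite !Lp_normE.
under eq_integral => t _ do rewrite rnormZ powRM ?rnorm_ge0// EFinM.
rewrite ge0_integralZl_EFin ?powR_ge0//; last 2 first.
- by move=> t _; rewrite lee_fin powR_ge0.
- exact: sm_powR.
rewrite poweRM ?lee_fin ?powR_ge0//; last first.
  by apply: integral_ge0 => t _; rewrite lee_fin powR_ge0.
by rewrite -poweR_EFin -poweRrM mulfV// poweRe1// lee_fin rnorm_ge0.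
Qed.

Lemma Lp_norm_bounded X (f : T -> X) (M : R) : strongly_measurable f -> 0 <= M ->
  (forall t, rnorm (f t) <= M) -> (Lp_norm mu p f <= M%:E)%E.
Proof.
move=> mf M0 fM; apply/Lp_norm_leP => //.
apply: (@le_trans _ _ (\int[mu]_t (cst (M `^ p)%:E) t)%E).
  apply: ge0_le_integral => //.
  - by move=> t _; rewrite lee_fin powR_ge0.
  - exact: sm_powR.
  - by move=> t _; rewrite lee_fin ge0_ler_powR ?nnegrE ?rnorm_ge0 ?(ltW p0).
by rewrite integral_cst//= [X in (_ * X)%E](@probability_setT _ _ _ mu) mule1.
Qed.

Lemma Lp_norm_cst X (x : X) : Lp_norm mu p (fun=> x) = (rnorm x)%:E.
Proof.
rewrite Lp_normE integral_cst//= [X in (_ * X)%E](@probability_setT _ _ _ mu) mule1.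
by rewrite poweR_EFin -powRrM mulfV// powRr1// rnorm_ge0.
Qed.

Lemma Lp_norm_sum X I (s : seq I) (F : I -> T -> X) :
  (forall i, strongly_measurable (F i)) ->
  (Lp_norm mu p (fun t => \sum_(i <- s) F i t)%R <= \sum_(i <- s) Lp_norm mu p (F i))%E.
Proof.
move=> mF; elim: s => [|i s IH].
  under eq_fun do rewrite big_nil; by rewrite Lp_norm_cst rnorm0 big_nil.
under eq_fun do rewrite big_cons; rewrite big_cons.
apply: le_trans (Lp_normD (mF i) _) _; first exact: sm_sum.
exact: leeD2l.
Qed.

(** Hoelder's inequality against the constant function 1, on a probability
    space. *)
Lemma L1_le_Lp X (f : T -> X) : strongly_measurable f ->
  (\int[mu]_t (rnorm (f t))%:E <= Lp_norm mu p f)%E.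
Proof.
move=> mf; have [->|p1'] := eqVneq p 1.
  rewrite /Lp_norm Lnorm1 le_eqVlt; apply/orP; left; apply/eqP.
  by apply: eq_integral => t _; rewrite abse_EFin ger0_norm ?rnorm_ge0.
have pp1 : 1 < p by rewrite lt_def p1' p1.
have q0 : 0 < (1 - p^-1)^-1 by rewrite invr_gt0 subr_gt0 invf_lt1.
have := @hoelder _ _ _ mu (fun t => rnorm (f t)) (cst 1) p (1 - p^-1)^-1 _ _ p0 q0.
move=> /(_ (sm_rnorm mf) (@measurable_cst _ _ _ _ _ _)).
rewrite invrK subrKC => /(_ erefl).
rewrite [X in (_ <= _ * X)%E -> _](_ : _ = 1%E); last first.
  have := @Lnorm_cst1 _ _ _ mu (1 - p^-1)^-1; rewrite /comp/= => ->.
  by rewrite [X in (X `^ _)%E](@probability_setT _ _ _ mu) poweR_EFin powR1.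
rewrite mule1 Lnorm1 => H; apply: le_trans H.
rewrite le_eqVlt; apply/orP; left; apply/eqP.
by apply: eq_integral => t _; rewrite /= mulr1 ger0_norm ?rnorm_ge0.
Qed.

Lemma in_Lp_bounded X (f : T -> X) (M : R) : strongly_measurable f ->
  (forall t, rnorm (f t) <= M) -> in_Lp mu p f.
Proof.
move=> mf fM; split => //.
have M0 : 0 <= Num.max 0 M by rewrite le_max lexx.
apply: le_lt_trans (Lp_norm_bounded mf M0 _) (ltry _) => t.
by rewrite le_max fM orbT.
Qed.

Lemma in_Lp_sub X (f g : T -> X) : in_Lp mu p f -> in_Lp mu p g ->
  in_Lp mu p (fun t => f t - g t).
Proof.
move=> [mf ff] [mg fg]; split; first exact: sm_sub.
by apply: le_lt_trans (Lp_normB mf mg) _; exact: lte_add_pinfty.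
Qed.

Lemma Lp_norm_preserving X (phi : T -> T) (f : T -> X) :
  measurable_fun setT phi -> (forall A, measurable A -> mu (phi @^-1` A) = mu A) ->
  strongly_measurable f -> Lp_norm mu p (f \o phi) = Lp_norm mu p f.
Proof.
move=> mphi inv mf; rewrite !Lp_normE.
have <- // := @ge0_integral_preserving _ _ _ mu phi (fun t => (rnorm (f t) `^ p)%:E) mphi inv.
  exact: sm_powR.
by move=> t; rewrite lee_fin powR_ge0.
Qed.

Lemma Lp_norm_ae_eq X (f g : T -> X) : strongly_measurable f -> strongly_measurable g ->
  {ae mu, forall t, f t = g t} -> Lp_norm mu p f = Lp_norm mu p g.
Proof.
move=> mf mg fg; rewrite !Lp_normE.
have <- // := @ge0_ae_eq_integral _ _ _ mu setT _ _ measurableT (sm_powR mf) (sm_powR mg).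
- by move=> t _; rewrite lee_fin powR_ge0.
- by move=> t _; rewrite lee_fin powR_ge0.
- by apply: filterS fg => t ->.
Qed.

Lemma Lp_norm_dominated X Y (u : nat -> T -> X) (g : T -> Y) :
  (forall k, strongly_measurable (u k)) -> in_Lp mu p g ->
  (forall k t, rnorm (u k t) <= rnorm (g t)) ->
  (forall t, (fun k => rnorm (u k t)) @ \oo --> (0 : R)) ->
  forall e : R, 0 < e -> \forall k \near \oo, (Lp_norm mu p (u k) <= e%:E)%E.
Proof.
move=> mu_ [mg fg] ug u0 e e0.
pose F k t := (rnorm (u k t) `^ p)%:E.
have ig : mu.-integrable setT (fun t => (rnorm (g t) `^ p)%:E).
  apply/integrableP; split; first exact: sm_powR.
  under eq_integral => t _ do rewrite gee0_abs ?lee_fin ?powR_ge0//.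
  by rewrite -Lp_norm_powR poweR_lty.
have := @dominated_cvg _ _ _ mu setT measurableT F (cst 0%E) _
  (fun k => sm_powR (mu_ k)) _ _ ig.
have -> : (\int[mu]_(x in setT) cst 0 x)%E = 0%:E :> \bar R by rewrite integral_cst// mul0e.
move=> H; have {H} H : (\int[mu]_(x in setT) F n x)%E @[n --> \oo] --> (0%:E : \bar R).
  apply: H => //.
  - move=> t _; rewrite /F; apply/cvg_EFin; first exact: nearW.
    rewrite [X in X @ _ --> _](_ : _ = (fun k => rnorm (u k t) `^ p))//.
    by have := cvg_powR p0 (fun k => rnorm_ge0 (u k t)) (lexx 0) (u0 t); rewrite powR0.
  - move=> k t _; rewrite /F abse_EFin ger0_norm ?powR_ge0// lee_fin.
    by rewrite ge0_ler_powR ?nnegrE ?rnorm_ge0 ?(ltW p0).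
have ep : 0 < e `^ p by rewrite powR_gt0.
have : \forall k \near \oo, (\int[mu]_(x in setT) F k x < (e `^ p)%:E)%E.
  have /fine_cvgP[fin /cvgrPdist_lt/(_ _ ep)] := H.
  apply: filterS2 fin => k kfin; rewrite sub0r normrN => /(le_lt_trans (ler_norm _)).
  by rewrite -lte_fin fineK.
by apply: filterS => k /ltW ?; apply/Lp_norm_leP => //; exact: ltW.
Qed.

Lemma Lp_norm_fatou X (u : nat -> T -> X) (v : T -> X) (e : R) : 0 <= e ->
  (forall k, strongly_measurable (u k)) -> strongly_measurable v ->
  (forall t, u ^~ t @ \oo --> v t) ->
  (forall k, (Lp_norm mu p (u k) <= e%:E)%E) -> (Lp_norm mu p v <= e%:E)%E.
Proof.
move=> e0 mu_ mv uv ue; apply/Lp_norm_leP => //.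
pose F k t := (rnorm (u k t) `^ p)%:E.
have := @fatou _ _ _ mu setT measurableT F (fun k => sm_powR (mu_ k)).
have F0 : forall (n : nat) (x : T), [set: T] x -> (0%R <= F n x)%E.
  by move=> n t _; rewrite lee_fin powR_ge0.
move=> /(_ F0).
under eq_integral => t _.
  have H : F ^~ t @ \oo --> (rnorm (v t) `^ p)%:E.
    apply/cvg_EFin; first exact: nearW.
    rewrite [X in X @ _ --> _](_ : _ = (fun k => rnorm (u k t) `^ p))//.
    have cn : (fun k => rnorm (u k t)) @ \oo --> rnorm (v t).
      have /cvg_rnorm/cvgrPdist_lt H := uv t.
      apply/cvgrPdist_lt => eps eps0; apply: filterS (H _ eps0) => k.
      rewrite sub0r normrN ger0_norm ?rnorm_ge0// => ?.
      by rewrite (le_lt_trans (rnorm_dist _ _))// rnormBC.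
    by apply: cvg_powR => // [n|]; exact: rnorm_ge0.
  rewrite is_cvg_limn_einfE; last by apply/cvg_ex; eexists; exact: H.
  rewrite (cvg_lim _ H)//.
  over.
move=> /le_trans; apply.
rewrite limn_einf_lim; apply: lime_le; first exact: is_cvg_einfs.
apply: nearW => n; apply: (@le_trans _ _ (\int[mu]_(x in setT) F n x)%E).
  by apply: ereal_inf_lbound; exists n => //=.
by apply/Lp_norm_leP.
Qed.

End LpNorm.

(** * Density of simple functions, completeness *)

Section Density.
Context d (T : measurableType d) (R : realType) (mu : probability T R).
Context (p : R) (p1 : 1 <= p).

Lemma simple_density (X : normedModType R[i]) (f : T -> X) (e : R) :
  in_Lp mu p f -> 0 < e ->
  exists s : T -> X, simple_fun s /\ (Lp_norm mu p (fun t => f t - s t)%R <= e%:E)%E.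
Proof.
move=> [mf ff] e0; have [s [hs sf]] := mf.
(* truncating where [s k] is too large makes the approximation dominated *)
pose A k := [set t | rnorm (s k t) <= 2 * rnorm (f t)].
have mA k : measurable (A k).
  rewrite -[A k]setTI; apply: measurable_fun_le => //.
    exact: (simple_measurable (simple_comp (@rnorm R X) (hs k))).
  by apply: measurable_funM => //; exact: sm_rnorm.
pose s' k t := if `[< A k t >] then s k t else 0.
have hs' k : simple_fun (s' k).
  apply: (simple_comp2 (fun (b : bool) x => if b then x else 0)) => //.
  exact: simple_indic.
have s's k t : rnorm (s' k t - f t) <= rnorm ((3%:C : R[i]) *: f t).
  rewrite rnormZ (_ : rnorm (3%:C : R[i]^o) = 3); last first.
    by rewrite /rnorm ger0_norm// ler0c.
  rewrite /s'; case: asboolP => [At|_]; last first.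
    by rewrite sub0r rnormN ler_peMl ?rnorm_ge0//; lra.
  by rewrite (le_trans (ler_rnormB _ _))//; move: At; rewrite /A/=; lra.
have s'f t : (fun k => rnorm (s' k t - f t)) @ \oo --> (0 : R).
  have /cvg_rnorm H := sf t.
  have [ft0|ft0] := eqVneq (f t) 0.
    apply: (@squeeze0 _ _ (fun k => rnorm (s k t - f t))) => // k.
    rewrite rnorm_ge0/= /s'; case: ifP => // _.
    by rewrite ft0 subr0 rnorm0 rnorm_ge0.
  have f0 : 0 < rnorm (f t).
    rewrite lt_def rnorm_ge0 andbT; apply: contra ft0 => /eqP/rnorm_eq0 ->//.
  move/cvgrPdist_lt : (H) => /(_ _ f0) nearA.
  apply/cvgrPdist_lt => eps eps0; move/cvgrPdist_lt : H => /(_ _ eps0).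
  apply: filterS2 nearA => k.
  rewrite !sub0r !normrN !ger0_norm ?rnorm_ge0// => H1 H2.
  rewrite /s'; case: asboolP => // -[]; rewrite /A/=.
  rewrite -[s k t](subrK (f t)) (le_trans (ler_rnormD _ _))//; lra.
have [] := @Lp_norm_dominated _ _ _ mu p p1 X X (fun k t => s' k t - f t)
   (fun t => (3%:C : R[i]) *: f t) _ _ s's s'f e e0.
- by move=> k; apply: sm_sub => //; exact: sm_simple.
- split; first exact: sm_scaler.
  by rewrite Lp_normZ//; apply: lte_mul_pinfty => //; rewrite lee_fin rnorm_ge0.
move=> k _ /(_ k (leqnn k)) H; exists (s' k); split => //.
by rewrite Lp_normBC.
Qed.

Lemma rnorm_telescope (X : normedModType R[i]) (s : nat -> X) m n : (m <= n)%N ->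
  rnorm (s n - s m) <= \sum_(m <= k < n) rnorm (s k.+1 - s k).
Proof.
elim: n => [|n IH]; first by rewrite leqn0 => /eqP ->; rewrite subrr rnorm0 big_geq.
rewrite leq_eqVlt => /predU1P[->|mn]; first by rewrite subrr rnorm0 big_geq.
rewrite big_nat_recr//= addrC -(subrKA (s n)) (le_trans (ler_rnormD _ _))// lerD2l.
exact: IH.
Qed.

Lemma summable_cvg (X : completeNormedModType R[i]) (s : nat -> X) (M : R) :
  (forall n, \sum_(0 <= k < n) rnorm (s k.+1 - s k) <= M) -> cvg (s @ \oo).
Proof.
move=> sM; pose v n := \sum_(0 <= k < n) rnorm (s k.+1 - s k).
have v_nd : nondecreasing_seq v.
  apply/nondecreasing_seqP => n; rewrite /v big_nat_recr//= lerDl; exact: rnorm_ge0.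
have cv : cvgn v.
  apply: nondecreasing_is_cvgn => //; exists M => _ [n _ <-]; exact: sM.
have vlel n : v n <= limn v by exact: nondecreasing_cvgn_le.
have vl : v @ \oo --> limn v by exact: cv.
set l := limn v in vl vlel.
apply: cauchy_cvg; apply: cauchy_exP => eps eps0.
have epsE : eps = (complex.Re eps)%:C by rewrite RRe_real// gtr0_real.
have e0 : 0 < complex.Re eps by rewrite -ltcR -epsE.
move/cvgrPdist_lt : vl => /(_ _ e0) [N _ H].
exists (s N); exists N => // n /= Nn.
rewrite -ball_normE /ball_/= rnormE epsE ltcR rnormBC.
apply: le_lt_trans (rnorm_telescope s Nn) _.
have := H N (leqnn N); rewrite /= ger0_norm ?subr_ge0//; apply: le_lt_trans.
rewrite lerBrDr; apply: le_trans (vlel n).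
by rewrite /v addrC -big_cat_nat.
Qed.

Lemma sum_geometric_tail (a : R) m n : (m <= n)%N -> 0 <= a ->
  \sum_(m <= k < n) a * 2 ^- k <= 2 * a * 2 ^- m.
Proof.
move=> mn a0.
suff -> : \sum_(m <= k < n) a * 2 ^- k = 2 * a * 2 ^- m - 2 * a * 2 ^- n.
  by rewrite gerBl mulr_ge0// ?mulr_ge0// invr_ge0 exprn_ge0.
elim: n mn => [|n IH]; first by rewrite leqn0 => /eqP ->; rewrite big_geq// subrr.
rewrite leq_eqVlt => /predU1P[->|mn]; first by rewrite big_geq// subrr.
rewrite big_nat_recr//= IH// exprS invfM; field.
by rewrite !expf_neq0.
Qed.

(** The sum of the integrals is the integral of the sum, which is therefore
    finite almost everywhere. *)
Lemma ae_summable (g : nat -> T -> R) (a : R) :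
  0 <= a -> (forall j t, 0 <= g j t) -> (forall j, measurable_fun setT (g j)) ->
  (forall j, (\int[mu]_t (g j t)%:E <= (a * 2 ^- j)%:E)%E) ->
  {ae mu, forall t, exists M : R, forall n, \sum_(0 <= k < n) g k t <= M}.
Proof.
move=> a0 g0 mg ga.
have mG j : measurable_fun setT (fun t => (g j t)%:E) by exact/measurable_EFinP.
have G0 j t : (0 <= (g j t)%:E)%E by rewrite lee_fin.
pose G t := (\sum_(0 <= j <oo) (g j t)%:E)%E.
have mGs : measurable_fun setT G by apply: ge0_emeasurable_sum.
have iG : (\int[mu]_t G t < +oo)%E.
  rewrite integral_nneseries//.
  apply: (@le_lt_trans _ _ (2 * a * 2 ^- 0)%:E); last exact: ltry.
  apply: lime_le; first by apply: is_cvg_nneseries => n _ _; exact: integral_ge0.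
  apply: nearW => n; apply: (@le_trans _ _ (\sum_(0 <= i < n) a * 2 ^- i)%:E).
    rewrite -sumEFin; apply: lee_sum => i _; exact: ga.
  by rewrite lee_fin sum_geometric_tail.
have : mu.-integrable setT G.
  apply/integrableP; split => //; under eq_integral => t _ do
    rewrite gee0_abs ?nneseries_ge0//.
  by [].
move=> /(integrable_ae measurableT); apply: filterS => t /(_ I) fG.
exists (fine (G t)) => n; rewrite -lee_fin fineK// -sumEFin.
by apply: nneseries_lim_ge => k _ _; exact: G0.
Qed.

(** The partial sums of the norms of the increments converge almost everywhere,
    because their integrals do; off the exceptional set the sequence converges
    by completeness of the space of values, and Fatou's lemma identifies the
    limit in norm. *)
Lemma simple_completeness (X : completeNormedModType R[i]) (s : nat -> T -> X) (a : R) :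
  0 <= a -> (forall j, simple_fun (s j)) ->
  (forall j, (Lp_norm mu p (fun t => s j.+1 t - s j t)%R <= (a * 2 ^- j)%:E)%E) ->
  exists f : T -> X, strongly_measurable f /\
    forall j, (Lp_norm mu p (fun t => f t - s j t)%R <= (2 * a * 2 ^- j)%:E)%E.
Proof.
move=> a0 hs sa.
have ms j : strongly_measurable (s j) by exact: sm_simple.
pose g j t := rnorm (s j.+1 t - s j t).
have [|B [mB B0 gB]] := @ae_summable g a a0 (fun j t => rnorm_ge0 _)
  (fun j => sm_rnorm (sm_sub (ms _) (ms _))).
  by move=> j; apply: le_trans (sa j); apply: (L1_le_Lp mu p1); exact: sm_sub.
pose s' j t := if `[< (~` B) t >] then s j t else 0.
have hs' j : simple_fun (s' j).
  apply: (simple_comp2 (fun (b : bool) x => if b then x else 0)) => //.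
  exact/simple_indic/measurableC.
have cs t : cvg (s' ^~ t @ \oo).
  rewrite /s'; case: asboolP => [Bt|_]; last exact: is_cvg_cst.
  have [M sM] : exists M : R, forall n, \sum_(0 <= k < n) g k t <= M.
    by apply: contrapT => /gB.
  exact: (@summable_cvg _ (s ^~ t) M).
pose f t := lim (s' ^~ t @ \oo).
have s'f t : s' ^~ t @ \oo --> f t by exact: cs.
have mf : strongly_measurable f by exists s'.
have ms' j : strongly_measurable (s' j) by exact: sm_simple.
have s'E j : {ae mu, forall t, s' j t = s j t}.
  exists B; split => // t /= H; apply: contrapT => Bt; apply: H.
  by rewrite /s' asboolT.
have tele n j : (Lp_norm mu p (fun t => s (j + n)%N t - s j t)%R <=
    (\sum_(j <= k < j + n) a * 2 ^- k)%:E)%E.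
  elim: n => [|n IH].
    rewrite addn0 big_geq//; under eq_fun => t do rewrite subrr.
    by rewrite Lp_norm_cst// rnorm0.
  rewrite addnS; apply: le_trans (Lp_norm_tri mu p1 (ms _) (ms (j + n)%N) (ms _)) _.
  rewrite big_nat_recr ?leq_addr//= EFinD addeC; exact: leeD.
exists f; split => // j.
have -> : Lp_norm mu p (fun t => f t - s j t) = Lp_norm mu p (fun t => f t - s' j t).
  apply: Lp_norm_ae_eq; [exact: sm_sub|exact: sm_sub|].
  by apply: filterS (s'E j) => t ->.
apply: (@Lp_norm_fatou _ _ _ mu p p1 _ (fun n t => s' (j + n)%N t - s' j t)).
- by rewrite !mulr_ge0// invr_ge0 exprn_ge0.
- by move=> n; exact: sm_sub.
- exact: sm_sub.
- move=> t; apply: cvgB; last exact: cvg_cst.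
  have := s'f t; rewrite -(cvg_shiftn j).
  by under eq_fun do rewrite addnC.
move=> n; have -> : Lp_norm mu p (fun t => s' (j + n)%N t - s' j t) =
    Lp_norm mu p (fun t => s (j + n)%N t - s j t).
  apply: Lp_norm_ae_eq; [exact: sm_sub|exact: sm_sub|].
  by apply: filterS2 (s'E j) (s'E (j + n)%N) => t -> ->.
by apply: le_trans (tele n j) _; rewrite lee_fin sum_geometric_tail ?leq_addr.
Qed.

(** Simple functions close to the given ones have the same limit, so that
    [simple_completeness] applies. *)
Lemma Lp_completeness (X : completeNormedModType R[i]) (u : nat -> T -> X) (a : R) :
  0 <= a -> (forall j, in_Lp mu p (u j)) ->
  (forall j, (Lp_norm mu p (fun t => u j.+1 t - u j t)%R <= (a * 2 ^- j)%:E)%E) ->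
  exists f : T -> X, in_Lp mu p f /\
    forall e : R, 0 < e -> \forall j \near \oo, (Lp_norm mu p (fun t => f t - u j t)%R <= e%:E)%E.
Proof.
move=> a0 iu ua.
have mu_ j : strongly_measurable (u j) by case: (iu j).
have pow0 j : 0 < 2 ^- j :> R by rewrite invr_gt0 exprn_gt0.
have [s hs] := choice (fun j => simple_density (iu j) (pow0 j)).
have ms j : strongly_measurable (s j) by apply: sm_simple; case: (hs j).
have sa j : (Lp_norm mu p (fun t => s j.+1 t - s j t)%R <= ((a + 2) * 2 ^- j)%:E)%E.
  apply: le_trans (Lp_norm_tri mu p1 (ms _) (mu_ j.+1) (ms _)) _.
  apply: (@le_trans _ _ ((2 ^- j.+1)%:E + ((a * 2 ^- j)%:E + (2 ^- j)%:E))%E).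
    apply: leeD; first by rewrite Lp_normBC; case: (hs j.+1).
    apply: le_trans (Lp_norm_tri mu p1 (mu_ _) (mu_ j) (ms _)) _.
    by apply: leeD => //; case: (hs j).
  rewrite -!EFinD lee_fin exprS invfM mulrDl.
  by have := pow0 j; move: (2 ^- j) => x; lra.
have [||f [mf fs]] := @simple_completeness X s (a + 2) _ _ sa.
- by rewrite addr_ge0.
- by move=> j; case: (hs j).
have fu j : (Lp_norm mu p (fun t => f t - u j t)%R <= ((2 * (a + 2) + 1) * 2 ^- j)%:E)%E.
  apply: le_trans (Lp_norm_tri mu p1 mf (ms j) (mu_ j)) _.
  rewrite mulrDl mul1r EFinD; apply: leeD => //.
  by rewrite Lp_normBC; case: (hs j).
exists f; split.
  split => //; apply: le_lt_trans (Lp_norm_tri0 mu p1 mf (mu_ 0%N)) _.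
  apply: lte_add_pinfty; last by case: (iu 0%N).
  exact: le_lt_trans (fu 0%N) (ltry _).
move=> e e0; pose c := 2 * (a + 2) + 1.
have c0 : 0 < c by rewrite /c; lra.
have : \forall j \near \oo, 2 ^- j < e / c :> R.
  have H : (fun j => 2 ^- j) @ \oo --> (0 : R).
    under eq_fun => j do rewrite -exprVn.
    by apply: cvg_expr; rewrite ger0_norm ?invr_ge0// invf_lt1//; lra.
  have ec : 0 < e / c by rewrite divr_gt0.
  move/cvgrPdist_lt : H => /(_ _ ec); apply: filterS => j.
  by rewrite sub0r normrN ger0_norm// ltW.
apply: filterS => j; rewrite ltr_pdivlMr// => /ltW H.
by apply: le_trans (fu j) _; rewrite lee_fin mulrC.
Qed.

End Density.

(** * The Bochner integral *)

Section SimpleIntegral.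
Context d (T : measurableType d) (R : realType) (mu : probability T R).

(** The measure is finite, so that its values may be used as real weights. *)
Definition pr (A : set T) : R := fine (mu A).

Lemma pr_ge0 A : 0 <= pr A. Proof. exact: fine_ge0. Qed.

Lemma prE A : measurable A -> mu A = (pr A)%:E.
Proof. by move=> mA; rewrite /pr fineK// fin_num_measure. Qed.

Lemma trivIset_fibers (I : choiceType) (h : T -> I) D :
  trivIset D (fun i => h @^-1` [set i]).
Proof. by move=> i j _ _ [t [/= -> ->]]. Qed.

Lemma pr_fiber_comp (I J : choiceType) (h : T -> I) (F : I -> J) (x : J) :
  simple_fun h ->
  pr ((F \o h) @^-1` [set x]) =
  \sum_(i <- fset_set (range h)) (if F i == x then pr (h @^-1` [set i]) else 0).
Proof.
move=> [fh mh]; rewrite /pr.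
rewrite (_ : (F \o h) @^-1` [set x] =
    \bigcup_(i in range h `&` F @^-1` [set x]) (h @^-1` [set i])); last first.
  apply/seteqP; split=> [t /= Fx|t [i [_ Fi] /= hi]]; last by rewrite hi.
  by exists (h t) => //; split => //; exists t.
rewrite measure_fin_bigcup//; last 2 first.
- exact: finite_setIl.
- exact: trivIset_fibers.
rewrite fsbig_mkcondr fsbig_finite//.
rewrite (_ : (\sum_(i <- _) _)%E = (\sum_(i <- fset_set (range h))
    (if F i == x then pr (h @^-1` [set i]) else 0))%:E)// -sumEFin.
apply: eq_bigr => i _.
rewrite (_ : (i \in F @^-1` [set x]) = (F i == x)); last first.
  by apply/idP/eqP; rewrite inE.
by case: ifP => // _; exact: (prE (mh i)).
Qed.

(** The integral may be computed over the fibres of any simple function [h] of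
    which the integrand is a function: for [h] a pair of simple functions, this
    integrates both over a common refinement. *)
Lemma simple_integralE (X : normedModType R[i]) (I : choiceType) (h : T -> I) (F : I -> X) :
  simple_fun h ->
  simple_integral mu (F \o h) =
  \sum_(i <- fset_set (range h)) (pr (h @^-1` [set i]))%:C *: F i.
Proof.
move=> hh; have [fh mh] := hh.
have [fF _] := simple_comp F hh.
rewrite /simple_integral fsbig_finite//.
transitivity (\sum_(x <- fset_set (range (F \o h))) \sum_(i <- fset_set (range h))
    (if F i == x then (pr (h @^-1` [set i]))%:C *: F i else 0)).
  apply: eq_bigr => x _; rewrite -/(pr _) pr_fiber_comp// rmorph_sum/= scaler_suml.
  by apply: eq_bigr => i _; case: eqP => [->//|_]; rewrite scale0r.
rewrite exchange_big/= big_seq [RHS]big_seq; apply: eq_bigr => i iA.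
have FiB : F i \in fset_set (range (F \o h)).
  move: iA; rewrite !in_fset_set// !inE => -[t _ <-]; by exists t.
rewrite (big_fsetD1 (F i))//= eqxx big_seq big1 ?addr0// => x.
by rewrite in_fsetD1 eq_sym => /andP[/negbTE ->].
Qed.

Lemma integral_simpleE (I : choiceType) (h : T -> I) (g : I -> R) :
  simple_fun h -> (forall i, 0 <= g i) ->
  (\int[mu]_t (g (h t))%:E =
   (\sum_(i <- fset_set (range h)) pr (h @^-1` [set i]) * g i)%:E)%E.
Proof.
move=> hh g0; have [fh mh] := hh.
transitivity (\int[mu]_t (\sum_(i <- fset_set (range h))
    ((g i)%:E * (\1_(h @^-1` [set i]) t)%:E)))%E.
  apply: eq_integral => t _.
  have ht : h t \in fset_set (range h) by rewrite in_fset_set// inE; exists t.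
  rewrite (big_fsetD1 (h t))//= indicE mem_set//= mule1 big_seq big1 ?adde0// => i.
  rewrite in_fsetD1 => /andP[/eqP ih _]; rewrite indicE memNset ?mule0//.
  by move=> /= E; apply: ih.
rewrite ge0_integral_sum//; last 2 first.
- by move=> i; apply/measurable_EFinP; apply: measurable_funM.
- by move=> i t _; rewrite mule_ge0// lee_fin.
rewrite -sumEFin; apply: eq_bigr => i _.
rewrite ge0_integralZl_EFin//.
- rewrite integral_indic// setIT muleC EFinM; congr (_ * _)%E; exact: (prE (mh i)).
- by apply/measurable_EFinP; apply: measurable_indic; exact: mh.
Qed.

Context (X : normedModType R[i]).

Lemma simple_integral_norm (s : T -> X) : simple_fun s ->
  ((rnorm (simple_integral mu s))%:E <= \int[mu]_t (rnorm (s t))%:E)%E.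
Proof.
move=> hs; rewrite (integral_simpleE hs (@rnorm_ge0 R X)) lee_fin.
rewrite (_ : s = id \o s)// simple_integralE//.
apply: le_trans (ler_rnorm_sum _ _) _; apply: ler_sum => i _.
by rewrite rnormZ {1}/rnorm ger0_norm ?ler0c ?pr_ge0.
Qed.

Lemma simple_integralD (s t : T -> X) : simple_fun s -> simple_fun t ->
  simple_integral mu (fun w => s w + t w) = simple_integral mu s + simple_integral mu t.
Proof.
move=> hs ht; have hst := simple_pair hs ht.
rewrite (simple_integralE (fun x => x.1 + x.2) hst).
rewrite (simple_integralE (fun x => x.1) hst) (simple_integralE (fun x => x.2) hst).
by rewrite -big_split/=; apply: eq_bigr => i _; rewrite scalerDr.
Qed.

Lemma simple_integralZ (c : R[i]) (s : T -> X) : simple_fun s ->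
  simple_integral mu (fun w => c *: s w) = c *: simple_integral mu s.
Proof.
move=> hs; rewrite (simple_integralE (fun x => c *: x) hs) (simple_integralE id hs).
by rewrite scaler_sumr; apply: eq_bigr => i _; rewrite !scalerA mulrC.
Qed.

Lemma simple_integral_cst (x : X) : simple_integral mu (fun=> x) = x.
Proof.
have rE : range (fun _ : T => x) = [set x].
  by apply/seteqP; split=> [_ [_ _ <-]//|_ ->]; exists point.
rewrite /simple_integral rE fsbig_set1 preimage_cst ifT ?inE//.
by rewrite (@probability_setT _ _ _ mu)/= scale1r.
Qed.

Lemma simple_integral_preserving (phi : T -> T) (s : T -> X) :
  measurable_fun setT phi -> (forall A, measurable A -> mu (phi @^-1` A) = mu A) ->
  simple_fun s -> simple_integral mu (s \o phi) = simple_integral mu s.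
Proof.
move=> mphi inv hs; have [_ ms] := hs.
rewrite /simple_integral (@fsbig_widen _ _ _ _ (range (s \o phi)) (range s)).
- by apply: eq_fsbigr => x _; rewrite comp_preimage inv.
- by move=> _ [t _ <-]; exists (phi t).
move=> x [_ nx] /=; rewrite (_ : _ @^-1` _ = set0) ?measure0 ?scale0r//.
by apply/seteqP; split=> // t /= sx; apply: nx; exists t.
Qed.

End SimpleIntegral.

Section Bochner.
Context d (T : measurableType d) (R : realType) (mu : probability T R).
Implicit Type X : normedModType R[i].

Lemma Lp_norm1 X (f : T -> X) : Lp_norm mu 1 f = (\int[mu]_t (rnorm (f t))%:E)%E.
Proof.
rewrite /Lp_norm Lnorm1; apply: eq_integral => t _.
by rewrite abse_EFin ger0_norm ?rnorm_ge0.
Qed.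

Lemma cvg0_le (u : nat -> \bar R) (e : R) : u @ \oo --> 0%E -> 0 < e ->
  \forall k \near \oo, (u k <= e%:E)%E.
Proof.
move=> /fine_cvgP[fin /cvgrPdist_lt H] e0; move: (H _ e0); apply: filterS2 fin => k kfin.
rewrite sub0r normrN => /(le_lt_trans (ler_norm _))/ltW.
by rewrite -lee_fin fineK.
Qed.

Lemma cvg0_squeeze (u v : nat -> \bar R) : (forall k, 0 <= u k <= v k)%E ->
  v @ \oo --> 0%E -> u @ \oo --> 0%E.
Proof.
by move=> uv v0; apply: (squeeze_cvge _ (cvg_cst 0%E) v0); exact: nearW.
Qed.

(** The inequality for simple functions passes to the limit. *)
Lemma bochner_norm X (f : T -> X) (v : X) : is_bochner_integral mu f v ->
  ((rnorm v)%:E <= \int[mu]_t (rnorm (f t))%:E)%E.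
Proof.
move=> [mf [s [hs fs sv]]]; apply/lee_addgt0Pr => e e0.
have e20 : 0 < e / 2 by rewrite divr_gt0.
have := cvg0_le fs e20; move/cvg_rnorm/cvgrPdist_lt : sv => /(_ _ e20) A B.
have [k [{}A {}B]] : exists k, `|0 - rnorm (simple_integral mu (s k) - v)| < e / 2 /\
   (\int[mu]_t (rnorm (f t - s k t))%:E <= (e / 2)%:E)%E.
  by have := filter_ex (filterI A B) => -[k [??]]; exists k.
have ms : strongly_measurable (s k) by exact: sm_simple.
apply: (@le_trans _ _ ((e / 2)%:E + (rnorm (simple_integral mu (s k)))%:E)%E).
  rewrite -EFinD lee_fin -{1}(subrK (simple_integral mu (s k)) v).
  apply: le_trans (ler_rnormD _ _) _; rewrite lerD2r rnormBC.
  by move: A; rewrite sub0r normrN ger0_norm ?rnorm_ge0// => /ltW.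
apply: (@le_trans _ _ ((e / 2)%:E + (\int[mu]_t (rnorm (f t))%:E + (e / 2)%:E))%E); last first.
  by rewrite addeCA -EFinD -splitr.
apply: leeD => //; apply: le_trans (simple_integral_norm mu (hs k)) _.
rewrite -!Lp_norm1; apply: le_trans (Lp_norm_tri0 mu (lexx 1) ms mf) _.
by rewrite addeC; apply: leeD => //; rewrite Lp_normBC Lp_norm1.
Qed.

Lemma bochner_add X (f g : T -> X) (v w : X) : is_bochner_integral mu f v ->
  is_bochner_integral mu g w -> is_bochner_integral mu (fun t => f t + g t) (v + w).
Proof.
move=> [mf [s [hs fs sv]]] [mg [s' [hs' gs sw]]]; split; first exact: sm_add.
exists (fun k t => s k t + s' k t); split.
- by move=> k; exact: simple_comp2.
- apply: (@cvg0_squeeze _ (fun k => \int[mu]_t (rnorm (f t - s k t))%:E +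
     \int[mu]_t (rnorm (g t - s' k t))%:E)%E).
    move=> k; rewrite integral_ge0/=; last by move=> t _; rewrite lee_fin rnorm_ge0.
    rewrite -!Lp_norm1; rewrite (_ : (fun t => f t + g t - _) =
      fun t => (f t - s k t) + (g t - s' k t)).
      by apply: Lp_normD => //; apply: sm_sub => //; exact: sm_simple.
    by apply/funext => t; rewrite opprD addrACA.
  by rewrite -(adde0 0%E); apply: cvgeD.
- under eq_fun => k do rewrite simple_integralD//.
  exact: cvgD.
Qed.

Lemma bochner_scale X (c : R[i]) (f : T -> X) (v : X) : is_bochner_integral mu f v ->
  is_bochner_integral mu (fun t => c *: f t) (c *: v).
Proof.
move=> [mf [s [hs fs sv]]]; split; first exact: sm_scaler.
exists (fun k t => c *: s k t); split.
- by move=> k; exact: (simple_comp (fun x => c *: x)).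
- rewrite (_ : (fun k => _) = fun k => ((rnorm (c : R[i]^o))%:E *
      \int[mu]_t (rnorm (f t - s k t))%:E)%E); last first.
    apply/funext => k; rewrite -!Lp_norm1 -Lp_normZ//.
      by congr (Lp_norm _ _ _); apply/funext => t; rewrite scalerBr.
    by apply: sm_sub => //; exact: sm_simple.
  rewrite -(mule0 (rnorm (c : R[i]^o))%:E).
  by apply: cvgeZl.
- under eq_fun => k do rewrite simple_integralZ//.
  exact: cvgZr.
Qed.

Lemma bochner_sub X (f g : T -> X) (v w : X) : is_bochner_integral mu f v ->
  is_bochner_integral mu g w -> is_bochner_integral mu (fun t => f t - g t) (v - w).
Proof.
move=> fv gw; rewrite -(scaleN1r w).
rewrite (_ : (fun t => _) = fun t => f t + (-1) *: g t); last first.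
  by apply/funext => t; rewrite scaleN1r.
by apply: bochner_add => //; exact: bochner_scale.
Qed.

Lemma bochner_unique X (f : T -> X) (v w : X) : is_bochner_integral mu f v ->
  is_bochner_integral mu f w -> v = w.
Proof.
move=> fv fw; apply/eqP; rewrite -subr_eq0; apply/eqP/rnorm_eq0/eqP.
rewrite eq_le rnorm_ge0 andbT -lee_fin.
apply: le_trans (bochner_norm (bochner_sub fv fw)) _.
by under eq_integral => t _ do rewrite subrr rnorm0; rewrite integral0.
Qed.

Lemma bochner_cst X (x : X) : is_bochner_integral mu (fun=> x) x.
Proof.
split; first exact: sm_cst.
exists (fun=> fun=> x); split.
- by move=> _; exact: simple_cst.
- under eq_fun => k do under eq_integral => t _ do rewrite subrr rnorm0.
  by under eq_fun => k do rewrite integral0; exact: cvg_cst.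
- by under eq_fun => k do rewrite simple_integral_cst; exact: cvg_cst.
Qed.

Lemma bochner_sum X I (r : seq I) (F : I -> T -> X) (v : I -> X) :
  (forall i, is_bochner_integral mu (F i) (v i)) ->
  is_bochner_integral mu (fun t => \sum_(i <- r) F i t) (\sum_(i <- r) v i).
Proof.
move=> Fv; elim: r => [|i r IH].
  by under eq_fun => t do rewrite big_nil; rewrite big_nil; exact: bochner_cst.
by under eq_fun => t do rewrite big_cons; rewrite big_cons; exact: bochner_add.
Qed.

Lemma bochner_preserving X (phi : T -> T) (f : T -> X) (v : X) :
  measurable_fun setT phi -> (forall A, measurable A -> mu (phi @^-1` A) = mu A) ->
  is_bochner_integral mu f v -> is_bochner_integral mu (f \o phi) v.
Proof.
move=> mphi inv [mf [s [hs fs sv]]]; split; first exact: sm_precomp.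
exists (fun k => s k \o phi); split.
- by move=> k; exact: simple_precomp.
- rewrite (_ : (fun k => _) = fun k => (\int[mu]_t (rnorm (f t - s k t))%:E)%E)//.
  apply/funext => k; rewrite -!Lp_norm1.
  apply: (@Lp_norm_preserving _ _ _ mu 1 X phi (fun t => f t - s k t)) => //.
  by apply: sm_sub => //; exact: sm_simple.
- by under eq_fun => k do rewrite (simple_integral_preserving mphi inv)//.
Qed.

(** Along simple functions at distance [2 ^- k] in the mean, the integrals form
    a sequence with summable increments, which converges by completeness. *)
Lemma bochner_exists (X : completeNormedModType R[i]) (f : T -> X) :
  in_Lp mu 1 f -> exists v, is_bochner_integral mu f v.
Proof.
move=> fL; have [mf _] := fL.
have pow0 j : 0 < 2 ^- j :> R by rewrite invr_gt0 exprn_gt0.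
have [s hs] := choice (fun j => simple_density (lexx 1) fL (pow0 j)).
have ss j : simple_fun (s j) by case: (hs j).
have ms j : strongly_measurable (s j) by exact: sm_simple.
have cI : cvg ((fun k => simple_integral mu (s k)) @ \oo).
  apply: (@summable_cvg _ _ _ (2 * 2 * 2 ^- 0)) => n.
  apply: le_trans (sum_geometric_tail (leq0n n) _) => //.
  apply: ler_sum => k _; rewrite -lee_fin.
  rewrite (_ : simple_integral mu (s k.+1) - simple_integral mu (s k) =
     simple_integral mu (fun t => s k.+1 t - s k t)); last first.
    rewrite -scaleN1r -simple_integralZ// -simple_integralD//.
      by congr (simple_integral _ _); apply/funext => t; rewrite scaleN1r.
    exact: (simple_comp (fun x => -1 *: x)).
  apply: le_trans (simple_integral_norm mu _) _.
    exact: (simple_comp2 (fun x y => x - y)).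
  rewrite -Lp_norm1; apply: le_trans (Lp_norm_tri mu (lexx 1) (ms _) mf (ms _)) _.
  rewrite mulrDl mul1r EFinD; apply: leeD; last by case: (hs k).
  rewrite Lp_normBC; case: (hs k.+1) => _ /le_trans; apply.
  by rewrite lee_fin lef_pV2 ?posrE ?exprn_gt0// ler_eXn2l//; lra.
exists (lim ((fun k => simple_integral mu (s k)) @ \oo)); split => //.
exists s; split => //.
apply: (@cvg0_squeeze _ (fun k => (2 ^- k)%:E)).
  move=> k; rewrite integral_ge0/=; last by move=> t _; rewrite lee_fin rnorm_ge0.
  by rewrite -Lp_norm1; case: (hs k).
apply/cvg_EFin; first exact: nearW.
under eq_fun => j do rewrite /= -exprVn.
by apply: cvg_expr; rewrite ger0_norm ?invr_ge0// invf_lt1//; lra.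
Qed.

Lemma bochner_integralE X (f : T -> X) (v : X) :
  is_bochner_integral mu f v -> bochner_integral mu f = v.
Proof. by move=> fv; rewrite /bochner_integral; apply: xget_subset1 => // a b; exact: bochner_unique. Qed.

End Bochner.

(** * The circle and the monomials on the torus *)

Section Circle.
Context {R : realType}.
Implicit Types z w : circle R.

Lemma rnorm_circle z : rnorm (sval z : R[i]^o) = 1.
Proof. by rewrite /rnorm (eqP (svalP z)). Qed.

Lemma circle_neq0 z : sval z != 0.
Proof. by rewrite -normr_eq0 (eqP (svalP z)) oner_eq0. Qed.

Lemma rnorm_circleX z (n : int) : rnorm ((sval z) ^ n : R[i]^o) = 1.
Proof.
rewrite /rnorm; case: n => n; first by rewrite -exprnP normrX (eqP (svalP z)) expr1n.
by rewrite NegzE -exprnN normrV ?unitfE ?expf_neq0 ?circle_neq0// normrX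
  (eqP (svalP z)) expr1n invr1.
Qed.

Lemma circle_pow_subproof z (n : nat) : `|sval z ^+ n| == 1.
Proof. by rewrite normrX (eqP (svalP z)) expr1n. Qed.

Definition circle_pow z (n : nat) : circle R :=
  exist _ (sval z ^+ n) (circle_pow_subproof z n).

(** Primitive roots of unity exist because R[i] is algebraically closed of
    characteristic zero. *)
Lemma circle_prim_root (n : nat) : (0 < n)%N ->
  exists z : circle R, n.-primitive_root (sval z).
Proof.
move=> n0; pose p : {poly R[i]} := 'X^n - 1.
have [r Dp] := closed_field_poly_normal p.
rewrite (monicP _) ?monicXnsubC // scale1r in Dp.
have rn1 : all n.-unity_root r by apply/allP=> z; rewrite -root_prod_XsubC -Dp.
have sz_r : (n < (size r).+1)%N.
  by rewrite -(size_prod_XsubC r id) -Dp size_XnsubC.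
have ur : uniq r.
  by rewrite -separable_prod_XsubC -Dp separable_Xn_sub_1// pnatr_eq0 -lt0n.
have [z zr zprim] := hasP (has_prim_root n0 rn1 ur sz_r).
have nz : `|z| == 1.
  by rewrite -(@pexpr_eq1 _ _ n)// -normrX (prim_expr_order zprim) normr1.
by exists (exist _ z nz).
Qed.

Lemma prim_root_exprz (n : nat) z (k : int) : n.-primitive_root (sval z) ->
  (sval z ^ k == 1) = (n %| `|k|)%N.
Proof.
move=> zprim; rewrite (prim_order_dvd zprim).
by case: k => m //; rewrite NegzE abszN -exprnN invr_eq1.
Qed.

Lemma ler_complexRe (x : R[i]) : `|complex.Re x| <= rnorm (x : R[i]^o).
Proof.
rewrite /rnorm normc_def/= -sqrtr_sqr ler_sqrt ?lerDl ?sqr_ge0//.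
by rewrite addr_ge0 ?sqr_ge0.
Qed.

Lemma ler_complexIm (x : R[i]) : `|complex.Im x| <= rnorm (x : R[i]^o).
Proof.
rewrite /rnorm normc_def/= -sqrtr_sqr ler_sqrt ?lerDr ?sqr_ge0//.
by rewrite addr_ge0 ?sqr_ge0.
Qed.

Lemma complexReB (x y : R[i]) : complex.Re (x - y) = complex.Re x - complex.Re y.
Proof. by case: x y => [? ?] [? ?]. Qed.

Lemma complexImB (x y : R[i]) : complex.Im (x - y) = complex.Im x - complex.Im y.
Proof. by case: x y => [? ?] [? ?]. Qed.

Lemma open_rnorm (U : set R[i]^o) :
  (forall x, U x -> exists2 e : R, 0 < e & forall y : R[i]^o, rnorm (x - y) < e -> U y) ->
  open U.
Proof.
move=> H; rewrite openE => x /H[e e0 He]; apply/nbhs_ballP; exists e%:C.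
  by rewrite /= ltcR.
by move=> y; rewrite -ball_normE /ball_/= rnormE ltcR; exact: He.
Qed.

Lemma open_rnormP (U : set R[i]^o) (x : R[i]^o) : open U -> U x ->
  exists2 e : R, 0 < e & forall y : R[i]^o, rnorm (x - y) < e -> U y.
Proof.
rewrite openE => /[apply] /nbhs_ballP[e /= e0 He].
have epsE : e = (complex.Re e)%:C by rewrite RRe_real// gtr0_real.
exists (complex.Re e); first by rewrite -ltcR -epsE.
by move=> y xy; apply: He; rewrite -ball_normE /ball_/= rnormE epsE ltcR.
Qed.

(** The sigma-algebra of the circle is generated by the traces of open sets. *)
Lemma measurable_circle_open (U : set R[i]^o) : open U ->
  measurable [set z : circle R | U (sval z)].
Proof.
move=> oU; exists (U : set (borelC R)); first exact: sub_sigma_algebra.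
by rewrite setTI.
Qed.

Lemma measurable_real_halfline d (T : measurableType d) (f : T -> R) :
  (forall a, measurable [set t | a < f t]) -> measurable_fun setT f.
Proof.
move=> mf; apply: (measurability (RGenOInfty.G (R:=R)) (RGenOInfty.measurableE R)).
move=> _ [_ [a ->] <-]; rewrite setTI.
rewrite (_ : _ @^-1` _ = [set t | a < f t])//.
by apply/seteqP; split => t /=; rewrite in_itv/= andbT.
Qed.

Lemma sm_circle : strongly_measurable (fun z : circle R => sval z : R[i]^o).
Proof.
apply: sm_complex; apply: measurable_real_halfline => a.
  apply: (@measurable_circle_open [set x | a < complex.Re x]); apply: open_rnorm => x /= ax.
  exists (complex.Re x - a); first by rewrite subr_gt0.
  move=> y xy; have := le_lt_trans (ler_complexRe (x - y)) xy.
  by rewrite complexReB ltr_norml; lra.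
apply: (@measurable_circle_open [set x | a < complex.Im x]); apply: open_rnorm => x /= ax.
exists (complex.Im x - a); first by rewrite subr_gt0.
move=> y xy; have := le_lt_trans (ler_complexIm (x - y)) xy.
by rewrite complexImB ltr_norml; lra.
Qed.

Lemma measurable_circle d (T : measurableType d) (f : T -> circle R) :
  (forall U : set R[i]^o, open U -> measurable [set t | U (sval (f t))]) ->
  measurable_fun setT f.
Proof.
move=> mf _ _ [B mB <-]; rewrite setTI.
have m : measurable_fun setT (fun t => sval (f t) : borelC R).
  apply: (@measurability _ _ T (borelC R) setT _ (@open R[i]^o) erefl).
  by move=> _ [U oU <-]; rewrite setTI; exact: mf.
by have := m measurableT B mB; rewrite !setTI.
Qed.

Lemma measurable_circle_mul (g : circle R) : measurable_fun setT (circle_mul g).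
Proof.
apply: measurable_circle => U oU.
rewrite (_ : [set t | _] = [set z : circle R | [set x | U (sval g * x)] (sval z)])//.
apply: measurable_circle_open; apply: open_rnorm => x /= Ux.
have [e e0 He] := open_rnormP oU Ux; exists e => // y xy; apply: He.
suff -> : rnorm (sval g * x - sval g * y : R[i]^o) = rnorm (x - y : R[i]^o) by [].
by rewrite -mulrBr (rnormZ (sval g) (x - y : R[i]^o)) rnorm_circle mul1r.
Qed.

End Circle.

Section Monomials.
Context {R : realType}.
Implicit Types (w v : torus R) (alpha beta : Zindex).

Lemma Zindex_bound alpha : exists K, forall i, (K <= i)%N -> alpha i = 0.
Proof.
exists (\max_(i <- finsupp alpha) i).+1 => i Ki; apply: fsfun_dflt.
apply: contraL Ki => ia; rewrite -ltnNge ltnS.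
exact: (@leq_bigmax_seq _ (enum_fset (finsupp alpha)) xpredT id i ia isT).
Qed.

Lemma Zindex_bounds (s : seq Zindex) : exists K, forall alpha, alpha \in s ->
  forall i, (K <= i)%N -> alpha i = 0.
Proof.
elim: s => [|a s [K HK]]; first by exists 0%N.
have [K' HK'] := Zindex_bound a; exists (maxn K K') => b.
rewrite in_cons => /predU1P[->|bs] i; rewrite geq_max => /andP[Ki K'i].
  exact: HK'.
exact: HK.
Qed.

(** Products over the support may be taken over any initial segment that
    contains it, which allows to compare different multi-indices. *)
Lemma prod_finsupp (T : Type) (idx : T) (op : Monoid.com_law idx) alpha K (F : nat -> T) :
  (forall i, alpha i = 0 -> F i = idx) -> (forall i, (K <= i)%N -> alpha i = 0) ->
  \big[op/idx]_(i <- finsupp alpha) F i = \big[op/idx]_(i < K) F i.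
Proof.
move=> F1 aK; rewrite -(big_mkord xpredT) /=.
rewrite [RHS](bigID (fun i => i \in finsupp alpha)) /= [X in op _ X]big1_seq ?Monoid.mulm1; last first.
  by move=> i /andP[ia _]; apply: F1; exact: fsfun_dflt.
rewrite -[RHS]big_filter; apply: perm_big; apply: uniq_perm.
- exact: fset_uniq.
- by rewrite filter_uniq// iota_uniq.
move=> i; rewrite mem_filter mem_index_iota leq0n/=.
case: (boolP (i \in _)) => //= ia; apply/esym; rewrite ltnNge; apply/negP => /aK ai0.
by move: ia; rewrite mem_finsupp ai0 eqxx.
Qed.

Lemma monomialE w alpha K : (forall i, (K <= i)%N -> alpha i = 0) ->
  monomial w alpha = \prod_(i < K) sval (w i) ^ alpha i.
Proof.
move=> aK; rewrite /monomial; apply: prod_finsupp => // i ->.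
by rewrite expr0z.
Qed.

Lemma monomialM w v alpha : monomial (powN_mul (@circle_mul R) w v) alpha =
  monomial w alpha * monomial v alpha.
Proof.
by rewrite /monomial -big_split/=; apply: eq_bigr => i _; rewrite expfzMl.
Qed.

Lemma rnorm_monomial w alpha : rnorm (monomial w alpha : R[i]^o) = 1.
Proof.
apply: complexI; rewrite -rnormE /monomial normr_prod big1// => i _.
by have := rnormE (sval (w i) ^ alpha i : R[i]^o); rewrite rnorm_circleX.
Qed.

Lemma monomial_neq0 w alpha : monomial w alpha != 0.
Proof.
by rewrite /monomial prodf_seq_neq0; apply/allP => i _ /=; rewrite expfz_neq0// circle_neq0.
Qed.

Lemma rnorm_monomialZ (X : normedModType R[i]) w alpha (x : X) :
  rnorm (monomial w alpha *: x) = rnorm x.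
Proof. by rewrite rnormZ rnorm_monomial mul1r. Qed.

Lemma rnorm_monomialVZ (X : normedModType R[i]) w alpha (x : X) :
  rnorm ((monomial w alpha)^-1 *: x) = rnorm x.
Proof.
by rewrite -[in RHS](scale1r x) -(mulfV (monomial_neq0 w alpha)) -scalerA rnorm_monomialZ.
Qed.

Definition zadd alpha beta : Zindex :=
  [fsfun i in (finsupp alpha `|` finsupp beta)%fset => alpha i + beta i].

Lemma zaddE alpha beta i : zadd alpha beta i = alpha i + beta i.
Proof.
rewrite fsfunE in_fsetU; case: (boolP (i \in finsupp alpha)) => //= ia.
case: (boolP (i \in finsupp beta)) => //= ib.
by rewrite (fsfun_dflt ia) (fsfun_dflt ib) addr0.
Qed.

Lemma monomial_zadd w alpha beta :
  monomial w (zadd alpha beta) = monomial w alpha * monomial w beta.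
Proof.
have [K HK] := Zindex_bounds [:: alpha; beta].
have aK : forall i, (K <= i)%N -> alpha i = 0 by apply: HK; rewrite mem_head.
have bK : forall i, (K <= i)%N -> beta i = 0 by apply: HK; rewrite !inE eqxx orbT.
rewrite (monomialE w aK) (monomialE w bK) (@monomialE w _ K); last first.
  by move=> i Ki; rewrite zaddE aK// bK.
by rewrite -big_split/=; apply: eq_bigr => i _; rewrite zaddE expfzDr// circle_neq0.
Qed.

Definition zsingle (i : nat) (n : int) : Zindex := [fsfun j in [fset i]%fset => n].

Lemma zsingleE i n j : zsingle i n j = if j == i then n else 0.
Proof. by rewrite fsfunE in_fset1. Qed.

Lemma monomial_zsingle w i n : monomial w (zsingle i n) = sval (w i) ^ n.
Proof.
rewrite (@monomialE w _ i.+1); last by move=> j ij; rewrite zsingleE gtn_eqF.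
rewrite big_ord_recr/= zsingleE eqxx big1 ?mul1r// => j _.
by rewrite zsingleE ltn_eqF.
Qed.

Definition zzero : Zindex := zsingle 0 0.

Lemma zzeroE i : zzero i = 0. Proof. by rewrite zsingleE if_same. Qed.

Lemma monomial_zzero w : monomial w zzero = 1.
Proof. by rewrite monomial_zsingle expr0z. Qed.

Section Measurability.
Context d (T : measurableType d).

Lemma sm_mul (a b : T -> R[i]^o) : strongly_measurable a -> strongly_measurable b ->
  strongly_measurable (fun t => a t * b t : R[i]^o).
Proof. by move=> ma mb; exact: (sm_scale ma mb). Qed.

Lemma sm_expr (a : T -> R[i]^o) n : strongly_measurable a ->
  strongly_measurable (fun t => a t ^+ n : R[i]^o).
Proof.
move=> ma; elim: n => [|n IH]; first exact: sm_cst.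
by under eq_fun do rewrite exprS; exact: sm_mul.
Qed.

Lemma circle_conj (z : circle R) : (sval z)^-1 = (sval z)^*%C.
Proof.
have z0 := circle_neq0 z; apply: (mulfI z0); rewrite mulfV//.
transitivity (`|sval z| ^+ 2); first by rewrite (eqP (svalP z)) expr1n.
rewrite -add_Re2_Im2; case: (sval z) => a b /=; simpc.
by rewrite (_ : - (a * b) + b * a = 0) -?expr2 // mulrC addNr.
Qed.

Lemma sm_conj (a : T -> R[i]^o) : strongly_measurable a ->
  strongly_measurable (fun t => (a t)^*%C : R[i]^o).
Proof.
move=> ma; apply: (@sm_comp2 _ _ _ _ _ _ (fun (x _ : R[i]^o) => x^*%C : R[i]^o) _ _ _ ma ma).
move=> u _ x _ /cvg_rnorm ux _; apply/cvg_rnorm.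
rewrite (_ : (fun n => _) = fun n => rnorm (u n - x))//; apply/funext => n.
rewrite /rnorm !normc_def; case: (u n) x {ux} => [a1 b1] [a2 b2] /=.
by rewrite -opprD sqrrN.
Qed.

Lemma sm_monomial (W : T -> torus R) alpha :
  (forall i, strongly_measurable (fun t => sval (W t i) : R[i]^o)) ->
  strongly_measurable (fun t => monomial (W t) alpha : R[i]^o).
Proof.
move=> mW; rewrite /monomial; elim: (enum_fset _) => [|i s IH].
  by under eq_fun do rewrite big_nil; exact: sm_cst.
rewrite (_ : (fun t => _) = fun t =>
    sval (W t i) ^ alpha i * \prod_(j <- s) sval (W t j) ^ alpha j); last first.
  by apply/funext => t; rewrite big_cons.
apply: (@sm_mul (fun t => sval (W t i) ^ alpha i)
  (fun t => \prod_(j <- s) sval (W t j) ^ alpha j)); last exact: IH.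
case: (alpha i) => n.
  exact: (@sm_expr (fun t => sval (W t i)) n (mW i)).
rewrite (_ : (fun t => _) = fun t => ((sval (W t i))^*%C) ^+ n.+1); last first.
  by apply/funext => t; rewrite NegzE -exprnN -exprVn circle_conj.
exact: (@sm_expr (fun t => (sval (W t i))^*%C) n.+1 (sm_conj (mW i))).
Qed.

End Measurability.

Lemma sm_torus_coord i : strongly_measurable (fun w : torus R => sval (w i) : R[i]^o).
Proof. exact: (sm_precomp (measurable_coord i) sm_circle). Qed.

Lemma sm_torus_monomial alpha :
  strongly_measurable (fun w : torus R => monomial w alpha : R[i]^o).
Proof. by apply: sm_monomial => i; exact: sm_torus_coord. Qed.

Lemma sm_monomialVZ (X : normedModType R[i]) (f : torus R -> X) alpha :
  strongly_measurable f -> strongly_measurable (fun w => (monomial w alpha)^-1 *: f w).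
Proof.
apply: (@sm_scale _ _ _ _ (fun w : torus R => (monomial w alpha)^-1 : R[i]^o)).
have [K aK] := Zindex_bound alpha.
pose beta : Zindex := [fsfun i in finsupp alpha => - alpha i].
have bE i : beta i = - alpha i.
  by rewrite fsfunE; case: ifPn => // ia; rewrite (fsfun_dflt ia) oppr0.
rewrite (_ : (fun w => _) = fun w : torus R => monomial w beta : R[i]^o).
  exact: sm_torus_monomial.
apply/funext => w; rewrite (monomialE w aK) (@monomialE w _ K); last first.
  by move=> i Ki; rewrite bE aK// oppr0.
by rewrite -prodfV; apply: eq_bigr => i _; rewrite bE invr_expz.
Qed.

Definition shift (g w : torus R) : torus R := powN_mul (@circle_mul R) g w.

Lemma measurable_shift g : measurable_fun setT (shift g).
Proof.
apply: measurable_powN => i.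
apply: (measurableT_comp (measurable_circle_mul (g i))); exact: measurable_coord.
Qed.

Definition rot i (u : circle R) : torus R := fun j => if j == i then u else circle_one R.

Lemma monomial_rot i u alpha : monomial (rot i u) alpha = sval u ^ alpha i.
Proof.
have [K aK] := Zindex_bound alpha.
rewrite (@monomialE _ _ (maxn K i.+1)); last first.
  by move=> j; rewrite geq_max => /andP[/aK].
have iK : (i < maxn K i.+1)%N by rewrite leq_max ltnSn orbT.
rewrite (bigD1 (Ordinal iK))//= /rot eqxx big1 ?mulr1// => j /eqP ji.
rewrite ifF ?exp1rz//; apply/eqP => E; apply: ji; exact/val_inj.
Qed.

End Monomials.

(** * Fourier coefficients *)

Section Fourier.
Context {R : realType} (mT : probability (torus R) R) (hT : is_haar_torus mT).

Lemma shift_preserving (g : torus R) (A : set (torus R)) :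
  measurable A -> mT (shift g @^-1` A) = mT A.
Proof. exact: hT. Qed.

Lemma Lp_norm_shift (X : normedModType R[i]) (p : R) (g : torus R) (f : torus R -> X) :
  1 <= p -> strongly_measurable f -> Lp_norm mT p (f \o shift g) = Lp_norm mT p f.
Proof.
move=> p1 mf; apply: Lp_norm_preserving => //; first exact: measurable_shift.
by move=> A mA; exact: shift_preserving.
Qed.

(** Trigonometric polynomials, given by a list of frequencies and coefficients
    in which a frequency may be repeated. *)
Definition tp (X : lmodType R[i]) (s : seq (Zindex * X)) (w : torus R) : X :=
  \sum_(a <- s) monomial w a.1 *: a.2.

Definition tp_coef (X : zmodType) (s : seq (Zindex * X)) (alpha : Zindex) : X :=
  \sum_(a <- s | a.1 == alpha) a.2.

Section Polynomials.
Context {X : normedModType R[i]}.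
Implicit Types (s : seq (Zindex * X)).

Lemma sm_tp s : strongly_measurable (tp s).
Proof.
apply: sm_sum => a; apply: (@sm_scale _ _ _ _ (fun w => monomial w a.1 : R[i]^o)).
  exact: sm_torus_monomial.
exact: sm_cst.
Qed.

Lemma rnorm_tp s w : rnorm (tp s w) <= \sum_(a <- s) rnorm a.2.
Proof.
apply: le_trans (ler_rnorm_sum _ _) _; apply: ler_sum => a _.
by rewrite rnorm_monomialZ.
Qed.

Lemma in_Lp_tp (p : R) s : 1 <= p -> in_Lp mT p (tp s).
Proof. by move=> p1; exact: (in_Lp_bounded _ p1 (sm_tp s) (rnorm_tp s)). Qed.

Lemma tp_cat s s' w : tp (s ++ s') w = tp s w + tp s' w.
Proof. by rewrite /tp big_cat. Qed.

End Polynomials.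

Lemma tp_coef_uniq (X : zmodType) (F : seq Zindex) (c : Zindex -> X) alpha : uniq F ->
  tp_coef [seq (a, c a) | a <- F] alpha = if alpha \in F then c alpha else 0.
Proof.
move=> uF; rewrite /tp_coef big_map /=; case: ifP => aF.
  rewrite -big_filter (_ : [seq b <- F | b == alpha] = [:: alpha]) ?big_seq1//.
  exact: filter_pred1_uniq.
by rewrite big_seq_cond big1// => b /andP[bF /eqP E]; rewrite E aF in bF.
Qed.

Section Coefficients.
Context {X : completeNormedModType R[i]}.
Implicit Types (f g : torus R -> X) (alpha beta : Zindex) (s : seq (Zindex * X)).

(** The function is constant if the frequencies agree; otherwise a rotation of
    one coordinate multiplies its integral by a number different from 1. *)
Lemma bochner_monomial alpha beta (x : X) :
  is_bochner_integral mT (fun w => (monomial w alpha)^-1 *: (monomial w beta *: x))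
    (if beta == alpha then x else 0).
Proof.
case: eqP => [->|ab].
  rewrite (_ : (fun w : torus R => _) = fun=> x); first exact: bochner_cst.
  by apply/funext => w; rewrite scalerA mulVf ?monomial_neq0// scale1r.
pose f (w : torus R) := (monomial w alpha)^-1 *: (monomial w beta *: x).
change (is_bochner_integral mT f 0).
have [i iab] : exists i, alpha i != beta i.
  apply: contrapT => H; apply: ab; apply/fsfunP => i; apply/eqP.
  by rewrite eq_sym; apply/negPn/negP => ?; apply: H; exists i.
have mf : strongly_measurable f.
  apply: sm_monomialVZ.
  apply: (@sm_scale _ _ _ _ (fun w => monomial w beta : R[i]^o)).
    exact: sm_torus_monomial.
  exact: sm_cst.
have [v fv] : exists v, is_bochner_integral mT f v.
  apply: bochner_exists; apply: (@in_Lp_bounded _ _ _ mT 1 (lexx 1) X f (rnorm x)) => // w.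
  by rewrite rnorm_monomialVZ rnorm_monomialZ.
suff -> : 0 = v by [].
pose k := beta i - alpha i.
(* the order exceeds [`|k|], so that [z ^ k] is not 1 *)
have [z zprim] := @circle_prim_root R `|k|.+1 isT.
have zk : sval z ^ k != 1.
  rewrite (prim_root_exprz _ zprim); apply/negP => /dvdn_leq.
  by rewrite ltnn absz_gt0 /k subr_eq0 eq_sym iab => /(_ isT).
have fE w : f (shift (rot i z) w) = sval z ^ k *: f w.
  rewrite /f /shift !monomialM !monomial_rot !scalerA; congr (_ *: _).
  rewrite /k expfzDr ?circle_neq0// invfM mulrACA !mulrA.
  by congr (_ * _ * _); rewrite invr_expz mulrC.
have /bochner_unique/(_ (bochner_scale (sval z ^ k) fv)) vE :
    is_bochner_integral mT (fun w => sval z ^ k *: f w) v.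
  rewrite (_ : (fun w : torus R => _) = f \o shift (rot i z)); last by apply/funext => w /=; rewrite fE.
  apply: bochner_preserving => //; first exact: measurable_shift.
  by move=> A mA; exact: shift_preserving.
apply/esym/eqP; have : (1 - sval z ^ k) *: v = 0 by rewrite scalerBl scale1r {1}vE subrr.
by move/eqP; rewrite scaler_eq0 subr_eq0 eq_sym (negbTE zk).
Qed.

Lemma bochner_tp s alpha :
  is_bochner_integral mT (fun w => (monomial w alpha)^-1 *: tp s w) (tp_coef s alpha).
Proof.
rewrite (_ : (fun w : torus R => _) = fun w => \sum_(a <- s)
   (monomial w alpha)^-1 *: (monomial w a.1 *: a.2)); last first.
  by apply/funext => w; rewrite /tp scaler_sumr.
rewrite /tp_coef big_mkcond; apply: bochner_sum => a.
exact: bochner_monomial.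
Qed.

Lemma fourier_tp s alpha : fourier_coef mT (tp s) alpha = tp_coef s alpha.
Proof. exact/bochner_integralE/bochner_tp. Qed.

Context (p : R) (p1 : 1 <= p).

Lemma bochner_fourier f alpha : in_Lp mT p f ->
  is_bochner_integral mT (fun w => (monomial w alpha)^-1 *: f w) (fourier_coef mT f alpha).
Proof.
move=> [mf fL].
have [v fv] : exists v, is_bochner_integral mT (fun w => (monomial w alpha)^-1 *: f w) v.
  apply: bochner_exists; split; first exact: sm_monomialVZ.
  rewrite Lp_norm1; under eq_integral => w _ do rewrite rnorm_monomialVZ.
  exact: le_lt_trans (L1_le_Lp mT p1 mf) fL.
by rewrite /fourier_coef (bochner_integralE fv).
Qed.

(** Fourier coefficients depend continuously on the function. *)
Lemma fourier_norm f alpha : in_Lp mT p f ->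
  ((rnorm (fourier_coef mT f alpha))%:E <= Lp_norm mT p f)%E.
Proof.
move=> fL; apply: le_trans (bochner_norm (bochner_fourier alpha fL)) _.
under eq_integral => w _ do rewrite rnorm_monomialVZ.
by apply: L1_le_Lp => //; case: fL.
Qed.

Lemma fourier_sub f g alpha : in_Lp mT p f -> in_Lp mT p g ->
  fourier_coef mT (fun w => f w - g w) alpha =
  fourier_coef mT f alpha - fourier_coef mT g alpha.
Proof.
move=> fL gL; apply: bochner_integralE.
rewrite (_ : (fun w : torus R => _) = fun w => (monomial w alpha)^-1 *: f w - (monomial w alpha)^-1 *: g w).
  by apply: bochner_sub; exact: bochner_fourier.
by apply/funext => w; rewrite scalerBr.
Qed.

End Coefficients.

(** Integrating over the torus is the same as integrating first over the orbits
    of a one-parameter subgroup: this is how integrals over the circle and over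
    the torus are compared. *)
Lemma integral_subgroup (X : normedModType R[i]) (mC : probability (circle R) R) (p : R)
    (phi : circle R -> torus R) (f : torus R -> X) : 1 <= p ->
  strongly_measurable f ->
  strongly_measurable (fun wz : torus R * circle R => f (shift (phi wz.2) wz.1)) ->
  (\int[mT]_w (rnorm (f w) `^ p)%:E =
   \int[mT]_w \int[mC]_z (rnorm (f (shift (phi z) w)) `^ p)%:E)%E.
Proof.
move=> p1 mf mF; pose F (wz : torus R * circle R) := (rnorm (f (shift (phi wz.2) wz.1)) `^ p)%:E.
have mF' : measurable_fun setT F by exact: (sm_powR p mF).
have F0 wz : (0 <= F wz)%E by rewrite lee_fin powR_ge0.
transitivity (\int[mT]_w \int[mC]_z F (w, z))%E => //.
rewrite (@fubini_tonelli _ _ _ _ _ mT mC F mF' F0) /F /=.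
transitivity (\int[mC]_z (\int[mT]_w (rnorm (f w) `^ p)%:E))%E.
  rewrite integral_cst//= [X in (_ = _ * X)%E](@probability_setT _ _ _ mC).
  by rewrite mule1.
apply: eq_integral => z _; apply/esym.
apply: (@ge0_integral_preserving _ _ _ mT (shift (phi z)) (fun w => (rnorm (f w) `^ p)%:E)).
- exact: measurable_shift.
- by move=> A mA; exact: shift_preserving.
- exact: sm_powR.
- by move=> w; rewrite lee_fin powR_ge0.
Qed.

End Fourier.

(** * Density of the trigonometric polynomials *)

Section Bernoulli.
Context {R : realType}.

Lemma bernoulli_lower (u : R) m : 0 <= u <= 1 -> 1 - m%:R * u <= (1 - u) ^+ m.
Proof.
move=> /andP[u0 u1]; elim: m => [|m IH]; first by rewrite mul0r subr0 expr0.
rewrite exprS; apply: (@le_trans _ _ ((1 - u) * (1 - m%:R * u))).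
  have := mulr_ge0 (mulr_ge0 (ler0n R m) u0) u0.
  by rewrite -natr1; move: (m%:R : R) => x; nra.
by rewrite ler_wpM2l// subr_ge0.
Qed.

Lemma bernoulli_upper (u : R) m : 0 <= u <= 1 -> (1 - u) ^+ m * (1 + m%:R * u) <= 1.
Proof.
move=> /andP[u0 u1].
have H : 1 + m%:R * u <= (1 + u) ^+ m.
  elim: m => [|m IH]; first by rewrite mul0r addr0 expr0.
  rewrite exprS; apply: (@le_trans _ _ ((1 + u) * (1 + m%:R * u))).
    have := mulr_ge0 (mulr_ge0 (ler0n R m) u0) u0.
    by rewrite -natr1; move: (m%:R : R) => x; nra.
  by rewrite ler_wpM2l// addr_ge0.
apply: (@le_trans _ _ ((1 - u) ^+ m * (1 + u) ^+ m)).
  by rewrite ler_wpM2l// exprn_ge0// subr_ge0.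
rewrite -exprMn -[leRHS](expr1n _ m) lerXn2r ?nnegrE//; first by nra.
by nra.
Qed.

Lemma ler_mul_div_succ (M x : R) : 0 <= M -> 0 <= x -> M * (x / (M + 1)) <= x.
Proof. by move=> M0 x0; rewrite mulrA ler_pdivrMr; nra. Qed.

Lemma cvg_n_expr (x : R) : 0 <= x < 1 -> (fun n => n%:R * x ^+ n) @ \oo --> (0 : R).
Proof.
move=> /andP[x0 x1]; have [->|xn0] := eqVneq x 0.
  apply/cvgrPdist_lt => e e0; exists 1%N => // n /= n1.
  by rewrite expr0n gtn_eqF// mulr0 subrr normr0.
pose y := Num.sqrt x.
have y0 : 0 < y by rewrite sqrtr_gt0 lt_def xn0.
have y1 : y < 1 by rewrite -sqrtr1 ltr_sqrt.
have xy : x = y * y by rewrite -expr2 sqr_sqrtr.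
have yn n : n%:R * y ^+ n <= (1 - y)^-1.
  have h : 0 <= 1 - y <= 1 by apply/andP; split; lra.
  have := bernoulli_upper n h; rewrite (_ : 1 - (1 - y) = y); last by lra.
  rewrite mulrDr mulr1 => H; rewrite -[leRHS]mul1r ler_pdivlMr; last by lra.
  have := exprn_ge0 n (ltW y0); rewrite mulrAC mulrC mulrC; lra.
apply: (@squeeze0 _ _ (fun n => (1 - y)^-1 * y ^+ n)).
  move=> n; rewrite mulr_ge0 ?exprn_ge0//= xy exprMn mulrA ler_wpM2r ?exprn_ge0 ?(ltW y0)//.
rewrite -(mulr0 (1 - y)^-1); apply: cvgM; first exact: cvg_cst.
by apply: cvg_expr; rewrite ger0_norm// ltW.
Qed.

(** Polynomials which stay between 0 and 1 and converge at every point of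
    [0, 1] to the indicator function of [0, 1/k[. *)
Definition step_poly (k n : nat) (r : R) : R := (1 - r ^+ n) ^+ (n * k ^ n).

Lemma step_poly_itv k n (r : R) : 0 <= r <= 1 -> 0 <= step_poly k n r <= 1.
Proof.
move=> /andP[r0 r1]; rewrite /step_poly.
have h : 0 <= 1 - r ^+ n <= 1.
  by rewrite subr_ge0 exprn_ile1//= gerBl exprn_ge0.
by case/andP: h => h0 h1; rewrite exprn_ge0//= exprn_ile1.
Qed.

Lemma step_poly_cvg k (r : R) : 0 <= r <= 1 ->
  (fun n => step_poly k n r) @ \oo --> ((if k%:R * r < 1 then 1 else 0) : R).
Proof.
move=> hr; case/andP: (hr) => r0 r1.
have rn n : 0 <= r ^+ n <= 1 by rewrite exprn_ge0//= exprn_ile1.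
have E n : (n * k ^ n)%:R * r ^+ n = n%:R * (k%:R * r) ^+ n :> R.
  by rewrite natrM natrX exprMn mulrA.
have [kr|kr] := ltP.
  apply/subr_cvg0; apply/cvgrPdist_lt => e e0.
  have kr0 : 0 <= k%:R * r < 1 by rewrite mulr_ge0//.
  have /cvgrPdist_lt/(_ _ e0) := cvg_n_expr kr0; apply: filterS => n.
  rewrite !sub0r !normrN => H; apply: le_lt_trans H.
  rewrite [leRHS]ger0_norm; last first.
    by rewrite mulr_ge0// exprn_ge0//; case/andP: kr0.
  have := bernoulli_lower (n * k ^ n) (rn n); rewrite E -/(step_poly k n r) => H.
  by have /andP[_ s1] := step_poly_itv k n hr; rewrite ler_norml; apply/andP; split; lra.
apply: (@squeeze0 _ _ (fun n => n.+1%:R^-1)); last exact: cvg_harmonic.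
move=> n; have /andP[-> _] /= := step_poly_itv k n hr.
have := bernoulli_upper (n * k ^ n) (rn n); rewrite E -/(step_poly k n r) => H.
rewrite -[leRHS]mul1r ler_pdivlMr//; apply: le_trans H.
rewrite ler_wpM2l//; first by have /andP[-> _] := step_poly_itv k n hr.
rewrite -natr1 addrC lerD2l ler_peMr// exprn_ege1//.
Qed.

End Bernoulli.

Section Approximable.
Context {R : realType} (mT : probability (torus R) R) (p : R) (p1 : 1 <= p).
Local Notation S := (torus R -> R[i]^o).

(** Boundedness makes products of approximable functions approximable. *)
Definition tapprox (u : S) : Prop :=
  [/\ strongly_measurable u, exists M : R, forall w, rnorm (u w) <= M
    & forall e : R, 0 < e -> exists q : seq (Zindex * R[i]^o),
        (Lp_norm mT p (fun w => u w - tp q w)%R <= e%:E)%E].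

Lemma tapprox_tp (q : seq (Zindex * R[i]^o)) : tapprox (tp q : S).
Proof.
split; first exact: sm_tp.
  by exists (\sum_(a <- q) rnorm a.2) => w; exact: rnorm_tp.
move=> e e0; exists q; rewrite (_ : (fun w : torus R => _) = fun=> 0).
  by rewrite (Lp_norm_cst _ p1) rnorm0 lee_fin ltW.
by apply/funext => w; rewrite subrr.
Qed.

Lemma tapprox_cst (c : R[i]^o) : tapprox (fun=> c).
Proof.
rewrite (_ : (fun=> c) = (tp [:: (zzero, c)] : S)); first exact: tapprox_tp.
by apply/funext => w; rewrite /tp big_seq1 monomial_zzero scale1r.
Qed.

Lemma tapprox_monomial alpha : tapprox (fun w => monomial w alpha).
Proof.
rewrite (_ : (fun w : torus R => _) = (tp [:: (alpha, 1)] : S)); first exact: tapprox_tp.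
by apply/funext => w; rewrite /tp big_seq1 /GRing.scale/= mulr1.
Qed.

Lemma tapprox_add (u v : S) : tapprox u -> tapprox v -> tapprox (fun w => u w + v w).
Proof.
move=> [mu [M uM] ua] [mv [M' vM] va]; split; first exact: (sm_add mu mv).
  by exists (M + M') => w; rewrite (le_trans (ler_rnormD _ _))// lerD.
move=> e e0; have e20 : 0 < e / 2 by rewrite divr_gt0.
have [q uq] := ua _ e20; have [q' vq] := va _ e20.
exists (q ++ q'); rewrite (_ : (fun w : torus R => _) = fun w => (u w - tp q w) + (v w - tp q' w)).
  have m1 := sm_sub mu (sm_tp q); have m2 := sm_sub mv (sm_tp q').
  apply: le_trans (Lp_normD mT p1 m1 m2) _.
  by rewrite [e]splitr EFinD; exact: leeD.
by apply/funext => w; rewrite tp_cat opprD addrACA.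
Qed.

Lemma Lp_norm_mul (u v : S) (M : R) : strongly_measurable u -> strongly_measurable v ->
  0 <= M -> (forall w, rnorm (u w) <= M) ->
  (Lp_norm mT p (fun w => u w * v w : R[i]^o)%R <= M%:E * Lp_norm mT p v)%E.
Proof.
move=> mu mv M0 uM.
have -> : M%:E = (rnorm (M%:C : R[i]^o))%:E by rewrite /rnorm ger0_norm ?ler0c.
rewrite -Lp_normZ//; apply: (Lp_norm_mono mT p1 (sm_mul mu mv) (sm_scaler (M%:C) mv)).
move=> w; rewrite rnormZ [rnorm (u w * v w : R[i]^o)](rnormZ (u w) (v w)).
by rewrite ler_wpM2r ?rnorm_ge0// (le_trans (uM w))// /rnorm ger0_norm ?ler0c.
Qed.

Lemma tp_mul (q q' : seq (Zindex * R[i]^o)) : exists q'' : seq (Zindex * R[i]^o),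
  forall w : torus R, (tp q w : R[i]) * tp q' w = tp q'' w.
Proof.
exists [seq (zadd a.1 b.1, a.2 * b.2 : R[i]^o) | a <- q, b <- q'] => w.
rewrite /tp big_allpairs_dep /= mulr_suml; apply: eq_bigr => a _.
rewrite mulr_sumr; apply: eq_bigr => b _.
by rewrite monomial_zadd /GRing.scale/= mulrACA.
Qed.

(** Approximate one factor first, then the other one with a precision that
    depends on the size of the polynomial already chosen. *)
Lemma tapprox_mul (u v : S) : tapprox u -> tapprox v -> tapprox (fun w => u w * v w : R[i]^o).
Proof.
move=> [mu [M uM] ua] [mv [M' vM] va]; split; first exact: (sm_mul mu mv).
  exists (M * M') => w; rewrite [leLHS](rnormZ (u w) (v w)) ler_pM ?rnorm_ge0//.
move=> e e0; have e20 : 0 < e / 2 by rewrite divr_gt0.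
have M0 : 0 <= M by apply: le_trans (uM point); exact: rnorm_ge0.
have M10 : 0 < M + 1 by rewrite ltr_wpDl.
have [q' vq] := va (e / 2 / (M + 1)) (divr_gt0 e20 M10).
pose B := \sum_(a <- q') rnorm a.2.
have B0 : 0 <= B by apply: sumr_ge0 => a _; exact: rnorm_ge0.
have B10 : 0 < B + 1 by rewrite ltr_wpDl.
have [q uq] := ua (e / 2 / (B + 1)) (divr_gt0 e20 B10).
have [q'' qq] := tp_mul q q'.
have mq : strongly_measurable (tp q : S) by exact: sm_tp.
have mq' : strongly_measurable (tp q' : S) by exact: sm_tp.
exists q''; rewrite (_ : (fun w : torus R => _) = fun w =>
   (u w * (v w - tp q' w) : R[i]^o) + (tp q' w * (u w - tp q w) : R[i]^o)); last first.
  apply/funext => w; rewrite -qq; move: (u w) (v w) (tp q w) (tp q' w) => a b c d.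
  by rewrite !mulrBr (mulrC d a) (mulrC d c) addrA subrK.
have m1 := sm_sub mv mq'; have m2 := sm_sub mu mq.
apply: le_trans (Lp_normD mT p1 (sm_mul mu m1) (sm_mul mq' m2)) _.
rewrite [e]splitr EFinD; apply: leeD.
  apply: le_trans (Lp_norm_mul mu m1 M0 uM) _.
  apply: le_trans (lee_wpmul2l _ vq) _; first by rewrite lee_fin.
  by rewrite -EFinM lee_fin ler_mul_div_succ// ltW.
apply: le_trans (Lp_norm_mul mq' m2 B0 (rnorm_tp q')) _.
apply: le_trans (lee_wpmul2l _ uq) _; first by rewrite lee_fin.
by rewrite -EFinM lee_fin ler_mul_div_succ// ltW.
Qed.

Lemma tapprox_expr (u : S) n : tapprox u -> tapprox (fun w => u w ^+ n : R[i]^o).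
Proof.
move=> ua; elim: n => [|n IH]; first exact: tapprox_cst.
rewrite (_ : (fun w : torus R => _) = fun w => (u w * u w ^+ n : R[i]^o)).
  exact: (tapprox_mul ua IH).
by apply/funext => w; rewrite exprS.
Qed.

Lemma tapprox_sub (u v : S) : tapprox u -> tapprox v -> tapprox (fun w => u w - v w).
Proof.
move=> ua va; rewrite (_ : (fun w : torus R => _) = fun w => u w + (-1 * v w : R[i]^o)).
  exact: (tapprox_add ua (tapprox_mul (tapprox_cst (-1)) va)).
by apply/funext => w; rewrite mulN1r.
Qed.

(** Bounded pointwise convergence implies convergence in mean. *)
Lemma tapprox_lim (u : nat -> S) (v : S) (M : R) :
  (forall k, tapprox (u k)) -> (forall k w, rnorm (u k w) <= M) ->
  strongly_measurable v -> (forall w, rnorm (v w) <= M) ->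
  (forall w, u ^~ w @ \oo --> v w) -> tapprox v.
Proof.
move=> ua uM mv vM uv; split; [exact: mv|by exists M|].
move=> e e0; have e20 : 0 < e / 2 by rewrite divr_gt0.
have mu_ k : strongly_measurable (u k) by case: (ua k).
have M0 : 0 <= M by apply: le_trans (vM point); exact: rnorm_ge0.
have [] := @Lp_norm_dominated _ _ _ mT p p1 _ _ (fun k w => u k w - v w)
  (fun=> (M + M)%:C : R[i]^o) _ _ _ _ _ e20.
- by move=> k; exact: (sm_sub (mu_ k) mv).
- by apply: (@in_Lp_bounded _ _ _ mT p p1 _ _ (M + M)) => [|w]; [exact: sm_cst|
    rewrite /rnorm ger0_norm ?ler0c ?addr_ge0].
- move=> k w; rewrite [leRHS]/rnorm ger0_norm ?ler0c ?addr_ge0//=.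
  by rewrite (le_trans (ler_rnormB _ _))// lerD.
- by move=> w; apply/cvg_rnorm.
move=> k _ /(_ k (leqnn k)) H; have [_ _ /(_ _ e20)[q uq]] := ua k.
exists q; have mq : strongly_measurable (tp q : S) by exact: sm_tp.
apply: le_trans (Lp_norm_tri mT p1 mv (mu_ k) mq) _.
by rewrite [e]splitr EFinD; apply: leeD => //; rewrite Lp_normBC.
Qed.

(** The complex-valued indicator function. *)
Definition ind (A : set (torus R)) : S := fun w => if `[< A w >] then 1 else 0.

Lemma rnorm_ind A w : rnorm (ind A w) <= 1.
Proof. by rewrite /ind; case: ifP => _; rewrite /rnorm ?normr1 ?normr0. Qed.

Lemma sm_ind A : measurable A -> strongly_measurable (ind A).
Proof.
by move=> mA; apply: sm_simple; exact: (simple_comp (fun b : bool => if b then 1 else 0)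
  (simple_indic mA)).
Qed.

(** A real function with values in [[-1, 1]] which is approximable has
    approximable level sets, by [step_poly_cvg]. *)
Lemma tapprox_halfline (rho : torus R -> R) (a : R) :
  tapprox (fun w => (rho w)%:C) -> (forall w, -1 <= rho w <= 1) ->
  measurable [set w | rho w < a] /\ tapprox (ind [set w | rho w < a]).
Proof.
move=> rt r1; have [mr _ _] := rt.
have mrho : measurable [set w | rho w < a].
  have m1 : measurable_fun setT (fun w => rnorm ((rho w)%:C + 1 : R[i]^o)).
    exact: (sm_rnorm (sm_add mr (@sm_cst _ (torus R) R (R[i]^o) 1))).
  have mu1 : measurable_fun setT (fun w => 1 + rho w).
    rewrite (_ : (fun w : torus R => _) = fun w => rnorm ((rho w)%:C + 1 : R[i]^o))//.
    apply/funext => w; have /andP[h1 h2] := r1 w.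
    by rewrite /rnorm -(rmorph1 (real_complex R)) -rmorphD ger0_norm ?ler0c//= 1?addrC//; lra.
  rewrite (_ : [set w | rho w < a] = setT `&` (fun w => 1 + rho w) @^-1` `]-oo, 1 + a[%classic).
    by apply: mu1 => //; exact: measurable_itv.
  rewrite setTI; apply/seteqP; split => w /=; rewrite in_itv/=; lra.
split; first exact: mrho.
have [a1|a1] := leP a (-1).
  rewrite (_ : ind _ = fun=> 0); first exact: tapprox_cst.
  apply/funext => w; rewrite /ind; case: asboolP => //= ra.
  by have /andP[h1 h2] := r1 w; move: (lt_le_trans ra a1); rewrite ltNge h1.
have a10 : 0 < a + 1 by lra.
(* [r] takes its values in [0, 1], and crosses [1 / k] where [rho] crosses [a] *)
pose k := (Num.truncn (2 / (a + 1))).+1.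
have kb : 2 / (a + 1) <= k%:R by rewrite ltW// truncnS_gt.
have k0 : 0 < k%:R :> R by [].
pose c : R := (k%:R * (a + 1))^-1.
have c0 : 0 < c by rewrite invr_gt0 mulr_gt0.
have c2 : c * 2 <= 1.
  by rewrite mulrC ler_pdivrMr ?mulr_gt0// mul1r -ler_pdivrMr.
pose r w := c * (1 + rho w).
have r01 w : 0 <= r w <= 1.
  have /andP[h1 h2] := r1 w; rewrite mulr_ge0 ?(ltW c0)//=; last by lra.
  by apply: le_trans c2; rewrite ler_wpM2l ?(ltW c0)//; lra.
have rt' : tapprox (fun w => (r w)%:C).
  rewrite (_ : (fun w : torus R => _) = fun w => (c%:C * (1 + (rho w)%:C) : R[i]^o)).
    exact: (tapprox_mul (tapprox_cst (c%:C)) (tapprox_add (tapprox_cst 1) rt)).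
  by apply/funext => w; rewrite /r rmorphM rmorphD rmorph1.
have st n : tapprox (fun w => (step_poly k n (r w))%:C).
  rewrite (_ : (fun w : torus R => _) = fun w => ((1 - (r w)%:C ^+ n) ^+ (n * k ^ n) : R[i]^o)).
    exact: (tapprox_expr (n * k ^ n) (tapprox_sub (tapprox_cst 1) (tapprox_expr n rt'))).
  by apply/funext => w; rewrite /step_poly rmorphXn rmorphB rmorph1 rmorphXn.
apply: (tapprox_lim st (M := 1)).
- move=> n w; have /andP[h1 h2] := step_poly_itv k n (r01 w).
  by rewrite /rnorm ger0_norm// ler0c.
- exact: sm_ind.
- exact: rnorm_ind.
move=> w; apply/cvg_rnorm.
have : (fun n => `|step_poly k n (r w) - (if k%:R * r w < 1 then 1 else 0)|) @ \oo --> (0 : R).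
  by apply/norm_cvg0P/subr_cvg0; exact: (@step_poly_cvg R k (r w) (r01 w)).
rewrite (_ : (fun n => rnorm ((step_poly k n (r w))%:C - ind [set w | rho w < a] w : R[i]^o)) =
  fun n => `|step_poly k n (r w) - (if k%:R * r w < 1 then 1 else 0)|) //.
apply/funext => n; rewrite /ind.
have -> : `[< [set w | rho w < a] w >] = (k%:R * r w < 1).
  rewrite /r /c invfM mulrA mulrA mulfV ?gt_eqF// mul1r mulrC ltr_pdivrMr// mul1r.
  by apply/asboolP/idP => /=; lra.
have H (x y : R) : rnorm (x%:C - y%:C : R[i]^o) = `|x - y|.
  by rewrite /rnorm -rmorphB normc_def/= expr0n addr0 sqrtr_sqr.
by rewrite -H; case: ifP.
Qed.

(** These sets form a sigma-algebra that contains the generators of the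
    sigma-algebra of the torus, hence every measurable set is one of them. *)
Definition tset (A : set (torus R)) : Prop := measurable A /\ tapprox (ind A).

Lemma tset0 : tset set0.
Proof.
split; first exact: measurable0.
rewrite (_ : ind set0 = fun=> 0); first exact: tapprox_cst.
by apply/funext => w; rewrite /ind asboolF.
Qed.

Lemma tsetC A : tset A -> tset (~` A).
Proof.
move=> [mA tA]; split; first exact: measurableC.
rewrite (_ : ind (~` A) = fun w => 1 - ind A w).
  exact: (tapprox_sub (tapprox_cst 1) tA).
apply/funext => w; rewrite /ind; have [Aw|Aw] := pselect (A w).
  by rewrite (asboolT Aw) asboolF ?subrr// => /(_ Aw).
by rewrite (asboolF Aw) asboolT ?subr0.
Qed.

Lemma tsetI A B : tset A -> tset B -> tset (A `&` B).
Proof.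
move=> [mA tA] [mB tB]; split; first exact: measurableI.
rewrite (_ : ind (A `&` B) = fun w => (ind A w * ind B w : R[i]^o)); first exact: (tapprox_mul tA tB).
apply/funext => w; rewrite /ind asbool_and.
by case: `[< A w >]; case: `[< B w >]; rewrite ?mulr1 ?mulr0.
Qed.

Lemma tsetU A B : tset A -> tset B -> tset (A `|` B).
Proof.
move=> tA tB; rewrite -(setCK (A `|` B)) setCU.
by apply: tsetC; apply: tsetI; exact: tsetC.
Qed.

Lemma tset_bigcup (F : nat -> set (torus R)) : (forall n, tset (F n)) -> tset (\bigcup_n F n).
Proof.
move=> tF; have mF : measurable (\bigcup_n F n).
  by apply: bigcupT_measurable => n; case: (tF n).
split; first exact: mF.
pose G n := \big[setU/set0]_(i < n) F i.
have tG n : tset (G n).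
  elim: n => [|n IH]; first by rewrite /G big_ord0; exact: tset0.
  by rewrite /G big_ord_recr/=; apply: tsetU.
apply: (@tapprox_lim (fun n => ind (G n)) _ 1).
- by move=> n; case: (tG n).
- by move=> n w; exact: rnorm_ind.
- exact: sm_ind.
- exact: rnorm_ind.
move=> w; apply/cvg_rnorm; apply/cvgrPdist_lt => e e0.
have [[n _ Fn]|nF] := pselect ((\bigcup_n F n) w).
  exists n.+1 => // m /= nm; rewrite /ind asboolT; last first.
    by rewrite /G -bigcup_mkord; exists n.
  by rewrite asboolT; [rewrite subrr rnorm0 subrr normr0|exists n].
exists 0%N => // m _ /=; rewrite /ind asboolF; last first.
  by rewrite /G -bigcup_mkord => -[i _ Fi]; apply: nF; exists i.
by rewrite asboolF// subrr rnorm0 subrr normr0.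
Qed.

Lemma tset_sigma_algebra : sigma_algebra setT tset.
Proof.
split; first exact: tset0.
  by move=> A tA; rewrite setTD; exact: tsetC.
exact: tset_bigcup.
Qed.

Lemma tapprox_Re i : tapprox (fun w => (complex.Re (sval (w i)))%:C).
Proof.
rewrite (_ : (fun w : torus R => _) = fun w =>
   ((2^-1 : R[i]) * (monomial w (zsingle i 1) + monomial w (zsingle i (-1))) : R[i]^o)).
  exact: (tapprox_mul (tapprox_cst _) (tapprox_add (tapprox_monomial _) (tapprox_monomial _))).
apply/funext => w; rewrite !monomial_zsingle expr1z exprN1 circle_conj addcJ.
by rewrite mulrA mulVf ?mul1r// pnatr_eq0.
Qed.

Lemma tapprox_Im i : tapprox (fun w => (complex.Im (sval (w i)))%:C).
Proof.
rewrite (_ : (fun w : torus R => _) = fun w =>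
   (((2 * 'i)^-1 : R[i]) * (monomial w (zsingle i 1) - monomial w (zsingle i (-1))) : R[i]^o)).
  exact: (tapprox_mul (tapprox_cst _) (tapprox_sub (tapprox_monomial _) (tapprox_monomial _))).
apply/funext => w; rewrite !monomial_zsingle expr1z exprN1 circle_conj subcJ.
rewrite (mulrAC 2) mulKf// mulf_neq0 ?pnatr_eq0//.
by rewrite eq_complex/= oner_eq0 andbF.
Qed.

Lemma complex_itv (x : R[i]) : rnorm (x : R[i]^o) = 1 ->
  (-1 <= complex.Re x <= 1) && (-1 <= complex.Im x <= 1).
Proof. by move=> x1; rewrite -!ler_norml -{1 2}x1 ler_complexRe ler_complexIm. Qed.

Lemma tset_Re_lt i a : tset [set w | complex.Re (sval (w i)) < a].
Proof.
apply: (tapprox_halfline a (tapprox_Re i)) => w.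
by have /andP[] := complex_itv (rnorm_circle (w i)).
Qed.

Lemma tset_Im_lt i a : tset [set w | complex.Im (sval (w i)) < a].
Proof.
apply: (tapprox_halfline a (tapprox_Im i)) => w.
by have /andP[] := complex_itv (rnorm_circle (w i)).
Qed.

Let tapprox_opp (rho : torus R -> R) :
  tapprox (fun w => (rho w)%:C) -> tapprox (fun w => (- rho w)%:C).
Proof.
move=> rt; rewrite (_ : (fun w : torus R => _) = fun w => 0 - (rho w)%:C).
  exact: (tapprox_sub (tapprox_cst 0) rt).
by apply/funext => w; rewrite sub0r rmorphN.
Qed.

Lemma tset_Re_gt i a : tset [set w | a < complex.Re (sval (w i))].
Proof.
rewrite (_ : [set w | _] = [set w | - complex.Re (sval (w i)) < - a]); last first.
  by apply/seteqP; split => w /=; rewrite ltrN2.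
apply: (tapprox_halfline (- a) (tapprox_opp (tapprox_Re i))) => w.
by have /andP[/andP[h1 h2] _] := complex_itv (rnorm_circle (w i)); apply/andP; split; lra.
Qed.

Lemma tset_Im_gt i a : tset [set w | a < complex.Im (sval (w i))].
Proof.
rewrite (_ : [set w | _] = [set w | - complex.Im (sval (w i)) < - a]); last first.
  by apply/seteqP; split => w /=; rewrite ltrN2.
apply: (tapprox_halfline (- a) (tapprox_opp (tapprox_Im i))) => w.
by have /andP[_ /andP[h1 h2]] := complex_itv (rnorm_circle (w i)); apply/andP; split; lra.
Qed.

(** An open set of complex numbers is a countable union of rectangles with
    rational sides. *)
Definition box (q : rat * rat * rat * rat) : set R[i]^o :=
  [set x | [/\ ratr q.1.1.1 < complex.Re x, complex.Re x < ratr q.1.1.2,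
     ratr q.1.2 < complex.Im x & complex.Im x < ratr q.2]].

Lemma open_boxes (U : set R[i]^o) (x : R[i]^o) : open U -> U x ->
  exists q, box q x /\ box q `<=` U.
Proof.
move=> oU Ux; have [e e0 He] := open_rnormP oU Ux.
have e20 : 0 < e / 2 by rewrite divr_gt0.
have lo (y : R) : y - e / 2 < y by lra.
have hi (y : R) : y < y + e / 2 by lra.
have [a] := rat_in_itvoo (lo (complex.Re x)); rewrite in_itv/= => /andP[a1 a2].
have [b] := rat_in_itvoo (hi (complex.Re x)); rewrite in_itv/= => /andP[b1 b2].
have [c] := rat_in_itvoo (lo (complex.Im x)); rewrite in_itv/= => /andP[c1 c2].
have [f] := rat_in_itvoo (hi (complex.Im x)); rewrite in_itv/= => /andP[f1 f2].
exists (a, b, c, f); split => // y [/= y1 y2 y3 y4]; apply: He.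
have -> : x - y = (complex.Re (x - y))%:C + 'i * (complex.Im (x - y))%:C by rewrite -complexE.
apply: le_lt_trans (ler_rnormD _ _) _.
have -> : rnorm ((complex.Re (x - y))%:C : R[i]^o) = `|complex.Re (x - y)|.
  by rewrite /rnorm normc_def/= expr0n addr0 sqrtr_sqr.
have -> : rnorm ('i * (complex.Im (x - y))%:C : R[i]^o) = `|complex.Im (x - y)|.
  by rewrite /rnorm normc_def/= !(mul0r, mul1r, mulr0, sub0r, add0r, addr0, oppr0, expr0n)/= ?add0r sqrtr_sqr.
rewrite complexReB complexImB [ltRHS]splitr.
by apply: ltrD; rewrite ltr_norml; apply/andP; split; lra.
Qed.

Lemma tset_box i q : tset [set w | box q (sval (w i))].
Proof.
rewrite (_ : [set w | _] = ([set w | ratr q.1.1.1 < complex.Re (sval (w i))] `&`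
  [set w | complex.Re (sval (w i)) < ratr q.1.1.2]) `&`
  ([set w | ratr q.1.2 < complex.Im (sval (w i))] `&`
  [set w | complex.Im (sval (w i)) < ratr q.2])).
  apply: tsetI; apply: tsetI; [exact: tset_Re_gt|exact: tset_Re_lt|
    exact: tset_Im_gt|exact: tset_Im_lt].
by apply/seteqP; split => w /=; [move=> [? ? ? ?]|move=> [[? ?] [? ?]]].
Qed.

Lemma tset_open i (U : set R[i]^o) : open U -> tset [set w | U (sval (w i))].
Proof.
move=> oU.
pose B n : set (torus R) := if @choice.unpickle (rat * rat * rat * rat)%type n is Some q then
  (if `[< box q `<=` U >] then [set w | box q (sval (w i))] else set0) else set0.
rewrite (_ : [set w | _] = \bigcup_n B n).
  apply: tset_bigcup => n; rewrite /B; case: choice.unpickle => [q|]; last exact: tset0.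
  by case: ifP => _; [exact: tset_box|exact: tset0].
apply/seteqP; split => [w /= Uw|w [n _]].
  have [q [qw qU]] := open_boxes oU Uw.
  have [n nq] : exists n, @choice.unpickle (rat * rat * rat * rat)%type n = Some q.
    by exists (choice.pickle q); exact: choice.pickleK.
  by exists n; [|rewrite /B nq asboolT].
rewrite /B; case: choice.unpickle => // q; case: asboolP => // qU /= qw; exact: qU.
Qed.

Lemma tset_cylinder i (C : set (circle R)) : measurable C -> tset [set w | C (w i)].
Proof.
move=> [B mB <-]; rewrite setTI.
suff : (@measurable _ (borelC R)) `<=` [set B | tset [set w : torus R | B (sval (w i))]].
  by move=> /(_ B mB).
apply: smallest_sub; last by move=> U oU; exact: tset_open.
split => /=.
- rewrite (_ : [set w | _] = set0) //; exact: tset0.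
- by move=> A tA; rewrite (_ : [set w | _] = ~` [set w | A (sval (w i))]);
    [exact: tsetC|apply/seteqP; split => w /=; [case|move=> nA; split]].
move=> F tF; rewrite (_ : [set w | _] = \bigcup_n [set w | F n (sval (w i))]) //.
exact: tset_bigcup.
Qed.

Lemma tset_measurable (A : set (torus R)) : measurable A -> tset A.
Proof.
suff : (@measurable _ (torus R)) `<=` tset by apply.
apply: smallest_sub; first exact: tset_sigma_algebra.
by move=> _ [i [B [mB ->]]]; exact: tset_cylinder.
Qed.

Section Vector.
Context {X : normedModType R[i]}.

Lemma ind_density (A : set (torus R)) (x : X) (e : R) : measurable A -> 0 < e ->
  exists s : seq (Zindex * X),
    (Lp_norm mT p (fun w => ind A w *: x - tp s w)%R <= e%:E)%E.
Proof.
move=> mA e0; have [_ [mi _ tA]] := tset_measurable mA.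
have x10 : 0 < rnorm x + 1 by rewrite ltr_wpDl ?rnorm_ge0.
have [q qA] := tA (e / (rnorm x + 1)) (divr_gt0 e0 x10).
exists [seq (a.1, a.2 *: x) | a <- q].
have mq := sm_sub mi (sm_tp q).
have -> : Lp_norm mT p (fun w => ind A w *: x - tp [seq (a.1, a.2 *: x) | a <- q] w) =
    Lp_norm mT p (fun w => ((rnorm x)%:C : R[i]) *: (ind A w - tp q w)).
  apply: eq_Lp_norm => w.
  rewrite (_ : ind A w *: x - _ = (ind A w - tp q w) *: x); last first.
    rewrite scalerBl; congr (_ - _); rewrite /tp big_map scaler_suml.
    by apply: eq_bigr => a _; rewrite scalerA.
  rewrite rnormZ [RHS](rnormZ (rnorm x)%:C) mulrC; congr (_ * _).
  by rewrite [RHS]/rnorm ger0_norm// ler0c rnorm_ge0.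
rewrite (Lp_normZ _ p1 _ mq).
rewrite (_ : rnorm ((rnorm x)%:C : R[i]^o) = rnorm x); last first.
  by rewrite [LHS]/rnorm ger0_norm// ler0c rnorm_ge0.
apply: le_trans (lee_wpmul2l _ qA) _; first by rewrite lee_fin rnorm_ge0.
by rewrite -EFinM lee_fin ler_mul_div_succ ?rnorm_ge0// ltW.
Qed.

(** Simple functions are dense, and they are combinations of indicator
    functions of measurable sets. *)
Lemma tp_density (f : torus R -> X) (e : R) : in_Lp mT p f -> 0 < e ->
  exists s : seq (Zindex * X), (Lp_norm mT p (fun w => f w - tp s w)%R <= e%:E)%E.
Proof.
move=> fL e0; have e20 : 0 < e / 2 by rewrite divr_gt0.
have [s [hs fs]] := simple_density p1 fL e20.
have [frs mrs] := hs.
have mI x : strongly_measurable (fun w => ind (s @^-1` [set x]) w *: x).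
  exact: (sm_scale (sm_ind (mrs x)) (@sm_cst _ (torus R) R X x)).
have sE w : s w = \sum_(x <- fset_set (range s)) ind (s @^-1` [set x]) w *: x.
  have sw : s w \in fset_set (range s) by rewrite in_fset_set// inE; exists w.
  rewrite (big_fsetD1 (s w))//= /ind asboolT// scale1r big_seq big1 ?addr0// => x.
  rewrite in_fsetD1 => /andP[/eqP xs _]; rewrite asboolF ?scale0r// => /= E.
  by apply: xs.
have H (r : seq X) (d : R) : 0 < d -> exists q : seq (Zindex * X),
    (Lp_norm mT p (fun w => \sum_(x <- r) ind (s @^-1` [set x]) w *: x - tp q w)%R <= d%:E)%E.
  elim: r d => [|x r IH] d d0.
    exists [::]; rewrite (_ : (fun w : torus R => _) = fun=> 0).
      by rewrite (Lp_norm_cst _ p1) rnorm0 lee_fin ltW.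
    by apply/funext => w; rewrite /tp !big_nil subrr.
  have d20 : 0 < d / 2 by rewrite divr_gt0.
  have [q1 h1] := ind_density x (mrs x) d20; have [q2 h2] := IH _ d20.
  exists (q1 ++ q2); rewrite (_ : (fun w : torus R => _) = fun w =>
     (ind (s @^-1` [set x]) w *: x - tp q1 w) +
     (\sum_(x <- r) ind (s @^-1` [set x]) w *: x - tp q2 w)); last first.
    by apply/funext => w; rewrite big_cons tp_cat opprD addrACA.
  apply: le_trans (Lp_normD mT p1 (sm_sub (mI x) (sm_tp q1))
    (sm_sub (sm_sum r mI) (sm_tp q2))) _.
  by rewrite [d]splitr EFinD; exact: leeD.
have [q hq] := H (fset_set (range s)) _ e20.
exists q; have mf : strongly_measurable f by case: fL.
have := Lp_norm_tri mT p1 mf (sm_simple hs) (sm_tp q); move=> /le_trans; apply.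
rewrite [e]splitr EFinD; apply: leeD => //.
by rewrite (_ : s = fun w => \sum_(x <- fset_set (range s)) ind (s @^-1` [set x]) w *: x)//;
  apply/funext.
Qed.

End Vector.

End Approximable.

(** * Fejer means *)

Section Fejer.
Context {R : realType}.

(** The Fourier coefficients of the Fejer kernel of order [k], in the form in
    which the identity [K = |1 + z + ... + z^(k-1)|^2 / k] produces them. *)
Definition fejer (k : nat) (n : int) : R :=
  (\sum_(m < k) \sum_(m' < k) (m%:Z - m'%:Z + n == 0)%:R) / k%:R.

Lemma fejer_row_le1 k (x : int) : \sum_(m' < k) ((x - m'%:Z == 0)%:R : R) <= 1.
Proof.
have [[j hj]|H] := pselect (exists j : 'I_k, x - j%:Z == 0).
  rewrite (bigD1 j)//= hj big1 ?addr0// => i ij.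
  case: eqP => // xi; move: ij hj; rewrite -val_eqE/= => ij /eqP xj.
  by case/eqP: ij; apply/eqP; rewrite -(eqr_nat int) !natz; apply/eqP; lia.
rewrite big1// => i _; case: eqP => // /eqP xi; exfalso; apply: H; by exists i.
Qed.

Lemma fejer_itv k n : (0 < k)%N -> 0 <= fejer k n <= 1.
Proof.
move=> k0; have k0' : 0 < k%:R :> R by rewrite ltr0n.
rewrite /fejer divr_ge0//=; last by rewrite !sumr_ge0// => i _; rewrite sumr_ge0.
rewrite ler_pdivrMr// mul1r.
apply: (@le_trans _ _ (\sum_(m < k) (1 : R))); last by rewrite sumr_const card_ord.
apply: ler_sum => m _; apply: le_trans (fejer_row_le1 k (m%:Z + n)).
by rewrite le_eqVlt; apply/orP; left; apply/eqP; apply: eq_bigr => m' _; rewrite addrAC.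
Qed.

Lemma fejer_eq0 k n : (k <= `|n|)%N -> fejer k n = 0.
Proof.
move=> kn; rewrite /fejer big1 ?mul0r// => m _; rewrite big1// => m' _.
case: eqP => // E; have := ltn_ord m; have := ltn_ord m'; lia.
Qed.

Lemma fejer_0 k : (0 < k)%N -> fejer k 0 = 1.
Proof.
move=> k0; rewrite /fejer (eq_bigr (fun=> 1)); last first.
  move=> m _; rewrite (bigD1 m)//= addr0 subrr eqxx big1 ?addr0// => i im.
  case: eqP => // E; case/eqP: im; apply: val_inj => /=; lia.
by rewrite sumr_const card_ord divff// pnatr_eq0 -lt0n.
Qed.

(** At least [k - |n|] values of [m] admit an [m'] with [m - m' = - n]. *)
Lemma fejer_ge k n : (0 < k)%N -> 1 - `|n|%:R / k%:R <= fejer k n.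
Proof.
move=> k0; have k0' : 0 < k%:R :> R by rewrite ltr0n.
rewrite /fejer ler_pdivlMr// mulrBl mul1r divfK ?gt_eqF//.
rewrite lerBlDr.
have row (m : nat) : ((0 <= m%:Z + n) && (m%:Z + n < k%:Z))%:R <=
    \sum_(m' < k) (m%:Z - m'%:Z + n == 0)%:R :> R.
  case: andP => [[h1 h2]|_]; last by rewrite sumr_ge0.
  have jk : (absz (m%:Z + n)%R < k)%N by lia.
  rewrite (bigD1 (Ordinal jk))//= (_ : _ == 0 = true); last by apply/eqP; lia.
  by rewrite lerDl sumr_ge0.
apply: (@le_trans _ _ (\sum_(m < k) (((0 <= m%:Z + n) && (m%:Z + n < k%:Z))%:R : R) + `|n|%:R)); last first.
  by rewrite lerD2r; apply: ler_sum => m _; exact: row.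
rewrite -natr_sum -natrD ler_nat -(big_mkord xpredT (fun m => ((0 <= m%:Z + n) && (m%:Z + n < k%:Z)) : nat)).
case: n {row} => n.
  have [nk|nk] := leqP k n; first by rewrite (leq_trans nk)// leq_addl.
  rewrite (big_cat_nat (n := k - n)) ?leq_subr//=.
  rewrite (eq_big_nat _ _ (F2 := fun=> 1%N)); last by move=> i /andP[_ ik]; lia.
  rewrite sum_nat_const_nat; lia.
have [nk|nk] := leqP k n.+1; first by rewrite (leq_trans nk)//= leq_addl.
rewrite (big_cat_nat (n := n.+1)) ?(ltnW nk)//=.
rewrite [X in (_ <= _ + X + _)%N](eq_big_nat _ _ (F2 := fun=> 1%N)); last by move=> i /andP[ni ik]; lia.
rewrite sum_nat_const_nat; lia.
Qed.

Lemma fejer_cvg n : (fun k => fejer k.+1 n) @ \oo --> (1 : R).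
Proof.
have H : (fun k : nat => `|n|%:R * k.+1%:R^-1) @ \oo --> (0 : R).
  rewrite -(mulr0 `|n|%:R); apply: cvgM; [exact: cvg_cst|exact: cvg_harmonic].
apply/subr_cvg0/cvgrPdist_lt => e e0.
move/cvgrPdist_lt : H => /(_ _ e0); apply: filterS => k.
rewrite !sub0r !normrN => H; apply: le_lt_trans H.
rewrite [leRHS]ger0_norm// ler_norml.
have /andP[_ f1] := fejer_itv n (ltn0Sn k); have := fejer_ge n (ltn0Sn k).
have : 0 <= `|n|%:R / k.+1%:R :> R by rewrite divr_ge0.
by move: f1; move: (_ / _) (fejer _ _) => a b *; apply/andP; split; lra.
Qed.

Lemma fejer_prod_cvg (a : nat -> int) L :
  (fun k => \prod_(i < L) fejer k.+1 (a i)) @ \oo --> (1 : R).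
Proof.
elim: L => [|L IH].
  rewrite (_ : (fun k => _) = fun=> 1); first exact: cvg_cst.
  by apply/funext => k; rewrite big_ord0.
rewrite (_ : (fun k => _) = fun k => (\prod_(i < L) fejer k.+1 (a i)) * fejer k.+1 (a L)).
  by rewrite -[X in _ --> X](mulr1 (1 : R)); exact: cvgM IH (fejer_cvg (a L)).
by apply/funext => k; rewrite big_ord_recr.
Qed.

Lemma cvg_weighted_sum (I : eqType) (s : seq I) (f : I -> nat -> R) (c : I -> R) :
  (forall i, i \in s -> f i @ \oo --> (1 : R)) ->
  (fun k => \sum_(i <- s) `|1 - f i k| * c i) @ \oo --> (0 : R).
Proof.
elim: s => [|i s IH] f1.
  rewrite (_ : (fun k => _) = fun=> 0); first exact: cvg_cst.
  by apply/funext => k; rewrite big_nil.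
rewrite (_ : (fun k => _) = fun k =>
    `|1 - f i k| * c i + \sum_(j <- s) `|1 - f j k| * c j); last first.
  by apply/funext => k; rewrite big_cons.
have h1 : (fun k => \sum_(j <- s) `|1 - f j k| * c j) @ \oo --> (0 : R).
  by apply: IH => j js; apply: f1; rewrite inE js orbT.
have h2 : (fun k => 1 - f i k) @ \oo --> (1 - 1 : R).
  by apply: cvgB; [exact: cvg_cst|apply: f1; rewrite mem_head].
have h3 : (fun k => `|1 - f i k| * c i) @ \oo --> `|1 - 1| * c i.
  by apply: cvgM; [exact: cvg_norm h2|exact: cvg_cst].
rewrite [X in _ --> X](_ : 0 = `|1 - 1| * c i + 0); last by rewrite subrr normr0 mul0r addr0.
exact: cvgD h3 h1.
Qed.

Lemma rnorm_sqr_conj (x : R[i]) : (rnorm (x : R[i]^o) ^+ 2)%:C = x * x^*%C.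
Proof.
rewrite rmorphXn /= -rnormE -add_Re2_Im2.
by case: x => a b /=; simpc; rewrite (_ : - (a * b) + b * a = 0) -?expr2// mulrC addNr.
Qed.

Section Kernel.
Context (k M : nat) (k0 : (0 < k)%N) (M0 : (0 < M)%N).
Context (om : circle R) (omP : M.-primitive_root (sval om)).

(** The values of the Fejer kernel at the roots of unity, divided by [M]. *)
Definition fejer_weight (r : nat) : R :=
  rnorm (\sum_(m < k) sval om ^+ (r * m) : R[i]^o) ^+ 2 / (k%:R * M%:R).

Lemma fejer_weight_ge0 r : 0 <= fejer_weight r.
Proof. by rewrite divr_ge0// sqr_ge0. Qed.

Lemma sum_roots (n : int) :
  \sum_(r < M) (sval om ^ n) ^+ r = if (M %| `|n|)%N then M%:R else 0.
Proof.
rewrite -(prim_root_exprz n omP); case: eqP => [->|/eqP x1].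
  by rewrite (eq_bigr (fun=> 1)) ?sumr_const ?card_ord// => r _; rewrite expr1n.
have : (sval om ^ n - 1) * \sum_(r < M) (sval om ^ n) ^+ r = 0.
  rewrite -subrX1; have -> : (sval om ^ n) ^+ M = 1; last by rewrite subrr.
  by rewrite exprnP exprz_exp mulrC -exprz_exp -exprnP (prim_expr_order omP) exp1rz.
by move/eqP; rewrite mulf_eq0 subr_eq0 (negbTE x1) => /eqP.
Qed.

(** Orthogonality of the characters of the roots of unity of order [M]: as [M] is
    large, no two frequencies in play are congruent modulo [M]. *)
Lemma fejer_weightE (n : int) : (k + `|n| <= M)%N ->
  \sum_(r < M) (fejer_weight r)%:C * (sval om ^ n) ^+ r = (fejer k n)%:C.
Proof.
move=> knM; have om0 := circle_neq0 om.
have W (r : nat) : (fejer_weight r)%:C = (k%:R * M%:R)^-1 *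
    \sum_(m < k) \sum_(m' < k) (sval om ^ (m%:Z - m'%:Z)) ^+ r.
  rewrite /fejer_weight mulrC rmorphM /= rnorm_sqr_conj rmorphV ?unitfE; last first.
    by rewrite mulf_neq0// pnatr_eq0 -lt0n.
  rewrite rmorphM !rmorph_nat; congr (_ * _).
  rewrite rmorph_sum mulr_suml; apply: eq_bigr => m _.
  rewrite mulr_sumr; apply: eq_bigr => m' _.
  rewrite rmorphXn /= -circle_conj expfzDr// exprMn; congr (_ * _).
    by rewrite -exprnP mulnC exprM.
  by rewrite -exprnN -exprVn mulnC exprM.
rewrite (eq_bigr (fun r : 'I_M => (k%:R * M%:R)^-1 * \sum_(m < k) \sum_(m' < k)
    (sval om ^ (m%:Z - m'%:Z + n)) ^+ r)); last first.
  move=> r _; rewrite W -mulrA; congr (_ * _); rewrite mulr_suml; apply: eq_bigr => m _.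
  rewrite mulr_suml; apply: eq_bigr => m' _.
  by rewrite [in RHS]expfzDr// exprMn.
rewrite -mulr_sumr exchange_big /=.
rewrite (eq_bigr (fun m : 'I_k => M%:R * \sum_(m' < k) (m%:Z - m'%:Z + n == 0)%:R)); last first.
  move=> m _; rewrite exchange_big mulr_sumr; apply: eq_bigr => m' _.
  rewrite sum_roots; have mk := ltn_ord m; have mk' := ltn_ord m'.
  case: eqP => [->|d0]; first by rewrite dvdn0 mulr1.
  by rewrite mulr0 gtnNdvd//; [lia|lia].
rewrite -mulr_sumr mulrA invfM mulfVK ?pnatr_eq0 -?lt0n//.
rewrite /fejer mulrC rmorphM /= rmorphV ?unitfE ?pnatr_eq0 -?lt0n// rmorph_nat; congr (_ * _).
rewrite rmorph_sum; apply: eq_bigr => m _; rewrite rmorph_sum; apply: eq_bigr => m' _.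
by rewrite rmorph_nat.
Qed.

End Kernel.
End Fejer.

Section FejerMeans.
Context {R : realType} (mT : probability (torus R) R) (hT : is_haar_torus mT).
Context (p : R) (p1 : 1 <= p).

Definition multiply (X : lmodType R[i]) (m : Zindex -> R) (s : seq (Zindex * X)) :
    seq (Zindex * X) :=
  [seq (a.1, (m a.1)%:C *: a.2) | a : Zindex * X <- s].

(** Averaging over the roots of unity in one coordinate, with the nonnegative
    weights of the Fejer kernel: a convex combination of translates. *)
Lemma fejer_step (X : normedModType R[i]) (s : seq (Zindex * X)) i k : (0 < k)%N ->
  (Lp_norm mT p (tp (multiply (fun a => fejer k (a i)) s)) <=
   Lp_norm mT p (tp s))%E.
Proof.
move=> k0.
(* large enough for [fejer_weightE] at every frequency of [s] *)
pose M := (k + \max_(a <- s) `|a.1 i|)%N.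
have M0 : (0 < M)%N by rewrite addn_gt0 k0.
have [om omP] := @circle_prim_root R M M0.
pose g (r : nat) : torus R := rot i (circle_pow om r).
have msr r : strongly_measurable (tp s \o shift (g r)).
  exact: (sm_precomp (measurable_shift (g r)) (sm_tp s)).
have E : tp (multiply (fun a => fejer k (a i)) s) =
    fun w => \sum_(r < M) (fejer_weight k M om r)%:C *: (tp s \o shift (g r)) w.
  apply/funext => w; rewrite /tp /multiply big_map /=.
  under [RHS]eq_bigr => r _ do rewrite scaler_sumr.
  rewrite exchange_big big_seq [RHS]big_seq; apply: eq_bigr => a aS /=.
  rewrite -(@fejer_weightE R k M k0 M0 om omP (a.1 i)); last first.
    by rewrite leq_add2l; exact: (@leq_bigmax_seq _ s xpredT (fun a => `|a.1 i|%N) a aS isT).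
  rewrite scaler_suml scaler_sumr; apply: eq_bigr => r _.
  rewrite /shift monomialM /g monomial_rot /= !scalerA; congr (_ *: _).
  rewrite mulrC -mulrA; congr (_ * (_ * _)).
  by rewrite exprnP exprz_exp mulrC -exprz_exp exprnP.
rewrite E; apply: le_trans (Lp_norm_sum mT p1 _ _) _.
  by move=> r; exact: (sm_scaler _ (msr r)).
rewrite (eq_bigr (fun r : 'I_M => (fejer_weight k M om r)%:E * Lp_norm mT p (tp s))%E); last first.
  move=> r _; rewrite (Lp_normZ _ p1 _ (msr r)) (Lp_norm_shift hT _ p1 (sm_tp s)).
  by rewrite /rnorm ger0_norm ?ler0c ?fejer_weight_ge0.
rewrite -ge0_sume_distrl; last by move=> r _; rewrite lee_fin fejer_weight_ge0.
rewrite sumEFin (_ : \sum_(r < M) _ = 1) ?mul1e//.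
apply: complexI; rewrite rmorph_sum/=.
have := @fejer_weightE R k M k0 M0 om omP 0.
rewrite absz0 addn0 fejer_0// expr0z => <-; last exact: leq_addr.
by apply: eq_bigr => r _; rewrite expr1n mulr1.
Qed.

(** Fejer multipliers of order [kappa i] in the coordinate [i]; order 1 retains
    only the mean over the coordinate. *)
Definition fmul (kappa : nat -> nat) (alpha : Zindex) : R :=
  \prod_(i <- finsupp alpha) fejer (kappa i) (alpha i).

Lemma fmulE kappa (alpha : Zindex) K : (forall i, (0 < kappa i)%N) ->
  (forall i, (K <= i)%N -> alpha i = 0) ->
  fmul kappa alpha = \prod_(i < K) fejer (kappa i) (alpha i).
Proof. by move=> k0 aK; apply: prod_finsupp => // i ->; rewrite fejer_0. Qed.

Lemma fmul_itv kappa alpha : (forall i, (0 < kappa i)%N) -> 0 <= fmul kappa alpha <= 1.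
Proof.
move=> k0; rewrite /fmul; elim/big_ind : _ => //.
- by rewrite ler01 lexx.
- by move=> x y /andP[x0 x1] /andP[y0 y1]; rewrite mulr_ge0//= mulr_ile1.
- by move=> i _; exact: fejer_itv.
Qed.

(** One coordinate at a time; only those on which the polynomial depends count. *)
Lemma fejer_contraction (X : normedModType R[i]) (s : seq (Zindex * X)) kappa :
  (forall i, (0 < kappa i)%N) ->
  (Lp_norm mT p (tp (multiply (fmul kappa) s)) <=
   Lp_norm mT p (tp s))%E.
Proof.
move=> k0; have [K HK] := Zindex_bounds [seq a.1 | a <- s].
pose m L (a : Zindex) : R := \prod_(i < L) fejer (kappa i) (a i).
have H L : (Lp_norm mT p (tp (multiply (m L) s)) <=
   Lp_norm mT p (tp s))%E.
  elim: L => [|L IH].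
    rewrite (_ : multiply _ s = s)// -[RHS]map_id; apply: eq_map => -[a x] /=.
    by rewrite /m big_ord0 scale1r.
  apply: le_trans IH; rewrite (_ : multiply (m L.+1) s =
      multiply (fun a => fejer (kappa L) (a L)) (multiply (m L) s)).
    exact: fejer_step.
  rewrite /multiply -map_comp; apply: eq_map => a /=.
  by rewrite /m big_ord_recr/= scalerA mulrC rmorphM.
rewrite (_ : multiply _ s = multiply (m K) s);
  first exact: H.
apply/eq_in_map => a aS; rewrite (@fmulE _ _ K)// => i; apply: HK.
exact: map_f.
Qed.

Context {X : completeNormedModType R[i]}.

Definition fmean (F : seq Zindex) (m : Zindex -> R) (g : torus R -> X) : torus R -> X :=
  tp [seq (a, (m a)%:C *: fourier_coef mT g a) | a <- F].

Lemma fmeanE F m g w :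
  fmean F m g w = \sum_(a <- F) monomial w a *: ((m a)%:C *: fourier_coef mT g a).
Proof. by rewrite /fmean /tp big_map. Qed.

Lemma tp_regroup (s : seq (Zindex * X)) (F : seq Zindex) (m : Zindex -> R) w :
  uniq F -> (forall a, a \notin F -> m a = 0) ->
  tp (multiply m s) w = fmean F m (tp s) w.
Proof.
move=> uF mF; rewrite fmeanE /tp /multiply big_map /=.
under [RHS]eq_bigr => a _ do rewrite (fourier_tp hT) /tp_coef big_mkcond !scaler_sumr.
rewrite exchange_big /=; apply: eq_bigr => b _.
have [bF|bF] := boolP (b.1 \in F).
  rewrite (bigD1_seq b.1)//= eqxx big1 ?addr0// => a ab.
  by rewrite eq_sym (negbTE ab) !scaler0.
rewrite mF// scale0r scaler0 big_seq big1// => a aF.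
by case: eqP aF => [<-|_ _]; [rewrite (negbTE bF)|rewrite !scaler0].
Qed.

(** Bounded multipliers extend from the trigonometric polynomials to the whole
    space, since finitely many coefficients depend continuously on [g]. *)
Lemma fmean_bound (g : torus R -> X) kappa F : in_Lp mT p g ->
  (forall i, (0 < kappa i)%N) -> uniq F -> (forall a, a \notin F -> fmul kappa a = 0) ->
  (Lp_norm mT p (fmean F (fmul kappa) g) <= Lp_norm mT p g)%E.
Proof.
move=> gL k0 uF mF; have [mg fg] := gL.
apply/lee_addgt0Pr => e e0.
pose N : R := (size F)%:R.
have N0 : 0 <= N by [].
have N10 : 0 < N + 1 by rewrite ltr_wpDl.
pose d := e / (N + 1); have d0 : 0 < d by rewrite divr_gt0.
have [s gs] := tp_density p1 gL d0.
have sL : in_Lp mT p (tp s) by exact: in_Lp_tp.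
have mF' h : strongly_measurable (fmean F (fmul kappa) h) by exact: sm_tp.
have h1 : (Lp_norm mT p (fun w => fmean F (fmul kappa) g w - fmean F (fmul kappa) (tp s) w)%R
    <= (N * d)%:E)%E.
  apply: (Lp_norm_bounded mT p1 (sm_sub (mF' g) (mF' (tp s)))).
    by rewrite mulr_ge0// ltW.
  move=> w; rewrite !fmeanE -sumrB; apply: le_trans (ler_rnorm_sum _ _) _.
  apply: (@le_trans _ _ (\sum_(a <- F) d)); last first.
    by rewrite big_const_seq count_predT iter_addr_0 /N mulr_natl.
  apply: ler_sum => a _; rewrite -scalerBr rnorm_monomialZ -scalerBr rnormZ.
  rewrite -(fourier_sub p1 a gL sL).
  have := fourier_norm p1 a (in_Lp_sub p1 gL sL).
  move=> /le_trans/(_ gs); rewrite lee_fin => h; apply: le_trans h.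
  have /andP[f0 f1] := fmul_itv a k0.
  by rewrite ler_piMl ?rnorm_ge0// /rnorm ger0_norm ?ler0c.
have h2 : (Lp_norm mT p (fmean F (fmul kappa) (tp s)) <= Lp_norm mT p (tp s))%E.
  apply: le_trans (fejer_contraction s k0).
  rewrite le_eqVlt; apply/orP; left; apply/eqP; congr (Lp_norm _ _ _).
  by apply/funext => w; rewrite (tp_regroup s w uF mF).
apply: le_trans (Lp_norm_tri0 mT p1 (mF' g) (mF' (tp s))) _.
apply: (@le_trans _ _ ((N * d)%:E + (d%:E + Lp_norm mT p g))%E).
  apply: leeD => //; apply: le_trans h2 _.
  apply: le_trans (Lp_norm_tri0 mT p1 (sm_tp s) mg) _.
  by apply: leeD => //; rewrite Lp_normBC.
rewrite addeA -EFinD addeC; apply: leeD => //.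
by rewrite lee_fin /d; rewrite -[X in _ + X]mul1r -mulrDl mulrC divfK// gt_eqF.
Qed.

Lemma finite_box K k : exists F : seq Zindex, uniq F /\
  forall a : Zindex, (forall i, (K <= i)%N -> a i = 0) -> (forall i, (`|a i| < k)%N) -> a \in F.
Proof.
elim: K => [|K [F [uF HF]]].
  exists [:: zzero]; split => // a a0 _; rewrite inE; apply/eqP/fsfunP => i.
  by rewrite a0// zzeroE.
pose I : seq int := [seq n%:Z | n <- iota 0 k] ++ [seq - n%:Z | n <- iota 0 k].
exists (undup [seq zadd b (zsingle K n) | b <- F, n <- I]); split.
  exact: undup_uniq.
move=> a aK ak; rewrite mem_undup.
pose b : Zindex := [fsfun i in finsupp a => if i == K then 0 else a i].
have bE i : b i = if i == K then 0 else a i.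
  rewrite fsfunE; case: ifPn => // ia; rewrite (fsfun_dflt ia); by case: eqP.
have -> : a = zadd b (zsingle K (a K)).
  apply/fsfunP => i; rewrite zaddE bE zsingleE.
  by case: eqP => [->|_]; rewrite ?add0r ?addr0.
apply: allpairs_f.
  apply: HF => i; rewrite bE; case: (eqVneq i K) => // iK.
    by move=> Ki; apply: aK; rewrite ltn_neqAle eq_sym iK.
  by move: (ak K); case: (k).
rewrite /I mem_cat; have := ak K; case: (a K) => n nk; apply/orP.
  by left; apply/mapP; exists n => //; rewrite mem_iota.
by right; apply/mapP; exists n.+1; [rewrite mem_iota|rewrite NegzE].
Qed.

Lemma fmul_support kappa a i : (forall j, (0 < kappa j)%N) -> fmul kappa a != 0 ->
  (`|a i| < kappa i)%N.
Proof.
move=> k0 fa; rewrite ltnNge; apply/negP => h; move: fa; rewrite /fmul.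
have [ia|ia] := boolP (i \in finsupp a).
  by rewrite (big_fsetD1 i)//= fejer_eq0// mul0r eqxx.
by move: h (k0 i); rewrite (fsfun_dflt ia) absz0 leqn0 => /eqP ->.
Qed.

(** A multiplier of order 1 in all but finitely many coordinates retains finitely
    many frequencies. *)
Lemma fmul_finite (P : pred nat) K k : (forall i, P i -> (i < K)%N) ->
  exists F : seq Zindex, uniq F /\
    forall a, a \notin F -> fmul (fun i => if P i then k.+1 else 1%N) a = 0.
Proof.
move=> PK; have [F [uF HF]] := finite_box K k.+1; exists F; split => // a aF.
apply/eqP; apply: contraNT aF => fa.
have H i : (`|a i| < if P i then k.+1 else 1)%N.
  by apply: fmul_support fa => j; case: ifP.
apply: HF => i.
  have := H i; case: ifP => [/PK iK _|_]; first by rewrite leqNgt iK.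
  by rewrite ltnS leqn0 absz_eq0 => /eqP.
by have := H i; case: ifP => // _; rewrite ltnS leqn0 => /eqP ->.
Qed.

(** The Fejer means converge on trigonometric polynomials, which are dense, and
    they are uniformly bounded. *)
Lemma fejer_approx (g : torus R -> X) (e : R) : in_Lp mT p g -> 0 < e ->
  exists (F : seq Zindex) (m : Zindex -> R), uniq F /\
    (Lp_norm mT p (fun w => g w - fmean F m g w)%R <= e%:E)%E.
Proof.
move=> gL e0; have [mg _] := gL; have e30 : 0 < e / 3 by rewrite divr_gt0.
have [s gs] := tp_density p1 gL e30.
have sL : in_Lp mT p (tp s) by exact: in_Lp_tp.
have [K HK] := Zindex_bounds [seq a.1 | a <- s].
pose kap k i := if (i < K)%N then k.+1 else 1%N.
have kap0 k i : (0 < kap k i)%N by rewrite /kap; case: ifP.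
have lim1 a : a \in s -> (fun k => fmul (kap k) a.1) @ \oo --> (1 : R).
  move=> aS; have aK : forall i, (K <= i)%N -> a.1 i = 0 by apply: HK; exact: map_f.
  rewrite (_ : (fun k => _) = fun k => \prod_(i < K) fejer k.+1 (a.1 i)); last first.
    apply/funext => k; rewrite (fmulE (kap0 k) aK); apply: eq_bigr => i _.
    by rewrite /kap ltn_ord.
  exact: fejer_prod_cvg.
have [k hk] : exists k, \sum_(a <- s) `|1 - fmul (kap k) a.1| * rnorm a.2 <= e / 3.
  have H : (fun k => \sum_(a <- s) `|1 - fmul (kap k) a.1| * rnorm a.2) @ \oo --> (0 : R).
    exact: cvg_weighted_sum.
  move/cvgrPdist_lt : H => /(_ _ e30) [k _ /(_ k (leqnn k))].
  by rewrite sub0r normrN => /ltW /(le_trans (ler_norm _)) ?; exists k.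
have [F [uF mF]] := @fmul_finite (fun i => i < K)%N K k (fun _ => id).
exists F, (fmul (kap k)); split => //.
have mm h : strongly_measurable (fmean F (fmul (kap k)) h) by exact: sm_tp.
apply: le_trans (Lp_norm_tri mT p1 mg (sm_tp s) (mm g)) _.
rewrite (_ : e = e / 3 + (e / 3 + e / 3)); last by lra.
rewrite EFinD; apply: leeD => //.
apply: le_trans (Lp_norm_tri mT p1 (sm_tp s) (mm (tp s)) (mm g)) _.
rewrite EFinD; apply: leeD.
  apply: (Lp_norm_bounded mT p1 (sm_sub (sm_tp s) (mm (tp s))) (ltW e30)) => w.
  rewrite -(tp_regroup s w uF mF) /tp /multiply big_map -sumrB.
  apply: le_trans (ler_rnorm_sum _ _) _; apply: le_trans hk; apply: ler_sum => a _ /=.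
  rewrite -scalerBr rnorm_monomialZ -{1}(scale1r a.2) -scalerBl rnormZ.
  rewrite -(rmorph1 (real_complex R)) -rmorphB.
  by rewrite [X in X * _]/rnorm normc_def/= expr0n addr0 sqrtr_sqr.
have hL : in_Lp mT p (fun w => tp s w - g w) by exact: in_Lp_sub.
rewrite (_ : (fun w : torus R => _) = fmean F (fmul (kap k)) (fun w => tp s w - g w)).
  by apply: le_trans (fmean_bound hL (kap0 k) uF mF) _; rewrite Lp_normBC.
apply/funext => w; rewrite !fmeanE -sumrB; apply: eq_bigr => a _.
by rewrite -!scalerBr (fourier_sub p1 a sL gL).
Qed.

(** All Fejer means vanish. *)
Lemma fourier_inj (h : torus R -> X) : in_Lp mT p h ->
  (forall a, fourier_coef mT h a = 0) -> Lp_norm mT p h = 0%E.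
Proof.
move=> hL h0; apply/eqP; rewrite eq_le Lp_norm_ge0 andbT.
apply/lee_addgt0Pr => e e0; rewrite add0e.
have [F [m [_ hF]]] := fejer_approx hL e0; apply: le_trans hF.
rewrite (_ : (fun w : torus R => _) = h)//; apply/funext => w.
by rewrite fmeanE big1 ?subr0// => a _; rewrite h0 !scaler0.
Qed.

(** Fejer multipliers of order 1 in the coordinates other than [i] integrate out
    these coordinates; in the coordinate [i] only finitely many frequencies
    remain, and the multipliers tend to 1 on them. *)
Lemma restrict_coord (g : torus R -> X) (i N : nat) : in_Lp mT p g ->
  (forall n : int, ~~ (0 <= n <= N%:Z) -> fourier_coef mT g (zsingle i n) = 0) ->
  (Lp_norm mT p (fun w => \sum_(0 <= n < N.+1)
     (sval (w i) ^+ n) *: fourier_coef mT g (zsingle i n%:Z))%R <= Lp_norm mT p g)%E.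
Proof.
move=> gL g0.
set P := (X in (Lp_norm _ _ X <= _)%E).
have PE : P = tp [seq (zsingle i n%:Z, fourier_coef mT g (zsingle i n%:Z)) | n <- index_iota 0 N.+1].
  by apply/funext => w; rewrite /P /tp big_map; apply: eq_bigr => n _; rewrite monomial_zsingle.
have mP : strongly_measurable P by rewrite PE; exact: sm_tp.
apply/lee_addgt0Pr => e e0.
pose kap k j := if j == i then k.+1 else 1%N.
have kap0 k j : (0 < kap k j)%N by rewrite /kap; case: ifP.
have fk k n : fmul (kap k) (zsingle i n) = fejer k.+1 n.
  rewrite (@fmulE _ _ i.+1)//; last by move=> j ij; rewrite zsingleE gtn_eqF.
  rewrite big_ord_recr/= zsingleE /kap eqxx big1 ?mul1r// => j _.
  by rewrite zsingleE ltn_eqF// fejer_0.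
have [k hk] : exists k, \sum_(0 <= n < N.+1)
    `|1 - fejer k.+1 n%:Z| * rnorm (fourier_coef mT g (zsingle i n%:Z)) <= e.
  have H : (fun k => \sum_(0 <= n < N.+1) `|1 - fejer k.+1 n%:Z| *
      rnorm (fourier_coef mT g (zsingle i n%:Z))) @ \oo --> (0 : R).
    by apply: cvg_weighted_sum => n _; exact: fejer_cvg.
  move/cvgrPdist_lt : H => /(_ _ e0) [k _ /(_ k (leqnn k))].
  by rewrite sub0r normrN => /ltW /(le_trans (ler_norm _)) ?; exists k.
have [F [uF mF]] := @fmul_finite (pred1 i) i.+1 k (fun j ji => ltac:(by rewrite (eqP ji))).
have H := fmean_bound gL (kap0 k) uF mF.
have mH : strongly_measurable (fmean F (fmul (kap k)) g) by exact: sm_tp.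
(* the coordinates other than [i] being integrated out, the Fejer mean is a
   polynomial in the coordinate [i] *)
pose F' := [seq zsingle i n%:Z | n <- index_iota 0 N.+1].
have uF' : uniq F'.
  rewrite map_inj_uniq ?iota_uniq// => n1 n2 /(congr1 (fun a : Zindex => a i)).
  by rewrite !zsingleE eqxx => -[].
have HE : Lp_norm mT p (fun w => fmean F' (fmul (kap k)) g w - fmean F (fmul (kap k)) g w) = 0%E.
  apply: fourier_inj => [|a]; first by apply: in_Lp_sub => //; exact: in_Lp_tp.
  rewrite (fourier_sub p1 a (in_Lp_tp _ _ p1) (in_Lp_tp _ _ p1)) !(fourier_tp hT).
  rewrite !tp_coef_uniq//.
  have -> : (if a \in F then (fmul (kap k) a)%:C *: fourier_coef mT g a else 0) =
      (fmul (kap k) a)%:C *: fourier_coef mT g a.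
    by case: ifPn => // /mF ->; rewrite scale0r.
  case: ifPn => [|aF']; rewrite ?subrr// sub0r.
  have [->|fa] := eqVneq (fmul (kap k) a) 0; first by rewrite scale0r oppr0.
  have aE : a = zsingle i (a i).
    apply/fsfunP => j; rewrite zsingleE; case: eqP => [->//|/eqP ji].
    have := fmul_support j (kap0 k) fa.
    by rewrite /kap (negbTE ji) ltnS leqn0 absz_eq0 => /eqP.
  have -> : fourier_coef mT g a = 0; last by rewrite scaler0 oppr0.
  rewrite aE; apply: g0; apply: contra aF' => an; rewrite aE.
  case: (a i) an => // n nN; apply/mapP; exists n => //.
  by rewrite mem_index_iota ltnS.
have mF' : strongly_measurable (fmean F' (fmul (kap k)) g) by exact: sm_tp.
apply: le_trans (Lp_norm_tri0 mT p1 mP mF') _; rewrite addeC; apply: leeD.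
  apply: le_trans (Lp_norm_tri0 mT p1 mF' mH) _; by rewrite HE add0e.
apply: (Lp_norm_bounded mT p1 (sm_sub mP mF') (ltW e0)) => w.
have -> : fmean F' (fmul (kap k)) g w = \sum_(0 <= n < N.+1)
   (sval (w i) ^+ n) *: ((fejer k.+1 n%:Z : R)%:C *: fourier_coef mT g (zsingle i n%:Z)).
  by rewrite fmeanE big_map; apply: eq_bigr => n _; rewrite monomial_zsingle fk.
rewrite /P -sumrB; apply: le_trans (ler_rnorm_sum _ _) _; apply: le_trans hk.
apply: ler_sum => n _; set x := fourier_coef _ _ _.
rewrite -scalerBr -{1}(scale1r x) -scalerBl rnormZ.
rewrite exprnP rnorm_circleX mul1r rnormZ -(rmorph1 (real_complex R)) -rmorphB.
by rewrite [X in X * _]/rnorm normc_def/= expr0n addr0 sqrtr_sqr.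
Qed.

End FejerMeans.

(** * Multi-indices and natural numbers *)

Lemma next_primeP m : prime (next_prime m) /\ (m < next_prime m)%N.
Proof. by rewrite /next_prime; case: ex_minnP => q /andP[mq pq] _. Qed.

Lemma next_prime_min m q : prime q -> (m < q)%N -> (next_prime m <= q)%N.
Proof. by rewrite /next_prime => pq mq; case: ex_minnP => q' _; apply; rewrite mq. Qed.

Lemma prime_nth i : prime (nth_prime i).
Proof. by have [] := next_primeP (iter i next_prime 0%N). Qed.

Lemma nth_prime_ltS i : (nth_prime i < nth_prime i.+1)%N.
Proof. by have [] := next_primeP (nth_prime i). Qed.

Lemma nth_prime_lt i j : (i < j)%N -> (nth_prime i < nth_prime j)%N.
Proof.
elim: j => // j IH; rewrite ltnS leq_eqVlt => /predU1P[->|/IH ij].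
  exact: nth_prime_ltS.
exact: ltn_trans ij (nth_prime_ltS j).
Qed.

Lemma nth_prime_inj : injective nth_prime.
Proof.
move=> i j ij; case: (ltngtP i j) => // /nth_prime_lt; by rewrite ij ltnn.
Qed.

Lemma nth_prime_gt i : (i < nth_prime i)%N.
Proof.
elim: i => [|i IH]; first exact: prime_gt0 (prime_nth 0).
exact: leq_ltn_trans IH (nth_prime_ltS i).
Qed.

Lemma nth_prime_surj q : prime q -> exists i, nth_prime i = q.
Proof.
move=> pq.
have H i : (forall j, (j < i)%N -> nth_prime j != q) -> (iter i next_prime 0 < q)%N.
  elim: i => [|i IH] h; first exact: prime_gt0.
  have lt := IH (fun j ji => h j (ltnW ji)).
  rewrite ltn_neqAle; apply/andP; split; first exact: h i (ltnSn i).
  by rewrite iterS; exact: next_prime_min.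
apply: contrapT => nex.
have : (nth_prime q < q)%N.
  by apply: (H q.+1) => j _; apply/negP => /eqP E; apply: nex; exists j.
by rewrite ltnNge ltnW// nth_prime_gt.
Qed.

Lemma index_natE (alpha : Zindex) K : (forall i, (K <= i)%N -> alpha i = 0) ->
  index_nat alpha = (\prod_(i < K) nth_prime i ^ `|alpha i|)%N.
Proof. by move=> aK; apply: (@prod_finsupp _ _ muln) => // i ->. Qed.

Lemma index_nat_gt0 alpha : (0 < index_nat alpha)%N.
Proof.
rewrite /index_nat; elim/big_ind : _ => // [m n m0 n0|i _]; first by rewrite muln_gt0 m0.
by rewrite expn_gt0 prime_gt0// prime_nth.
Qed.

Lemma logn_index_nat (alpha : Zindex) i : logn (nth_prime i) (index_nat alpha) = `|alpha i|%N.
Proof.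
have [K aK] := Zindex_bound alpha.
have aL : forall j, (maxn K i.+1 <= j)%N -> alpha j = 0.
  by move=> j; rewrite geq_max => /andP[/aK].
rewrite (index_natE aL).
have : (i < maxn K i.+1)%N by rewrite leq_max ltnSn orbT.
move: (maxn K i.+1) => L iL.
suff H M : (0 < \prod_(j < M) nth_prime j ^ `|alpha j|)%N /\
    logn (nth_prime i) (\prod_(j < M) nth_prime j ^ `|alpha j|) =
    if (i < M)%N then `|alpha i|%N else 0%N by rewrite (H L).2 iL.
elim: M => [|M [pos IH]]; first by rewrite big_ord0 logn1.
have pM : (0 < nth_prime M ^ `|alpha M|)%N by rewrite expn_gt0 prime_gt0// prime_nth.
rewrite big_ord_recr/= muln_gt0 pos pM; split => //.
rewrite lognM// IH lognX logn_prime ?prime_nth// (inj_eq nth_prime_inj).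
by rewrite ltnS; case: (ltngtP i M) => [iM|iM|->]; rewrite ?muln0 ?muln1 ?addn0.
Qed.

(** The multi-index of a positive integer: all primes dividing [n] are among the
    first [n] ones. *)
Definition multi_index (n : nat) : Zindex :=
  [fsfun i in [fset i | i in iota 0 n]%fset => (logn (nth_prime i) n)%:Z].

Lemma multi_indexE n i : multi_index n i = (logn (nth_prime i) n)%:Z.
Proof.
rewrite fsfunE; case: ifPn => //; rewrite in_fset/= mem_iota leq0n/= add0n -leqNgt => ni.
congr (Posz _); apply/esym/eqP; rewrite -leqn0 leqNgt logn_gt0 mem_primes.
apply/negP => /and3P[_ n0 /dvdn_leq]; rewrite n0 => /(_ isT).
by rewrite leqNgt (leq_ltn_trans ni)// nth_prime_gt.
Qed.

Lemma multi_index_nonneg n : nonneg_index (multi_index n).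
Proof. by move=> i; rewrite multi_indexE. Qed.

Lemma multi_indexK n : (0 < n)%N -> index_nat (multi_index n) = n.
Proof.
move=> n0; apply: eqn_from_log => //; first exact: index_nat_gt0.
move=> q; have [pq|npq] := boolP (prime q).
  have [i <-] := nth_prime_surj pq.
  by rewrite logn_index_nat multi_indexE.
by rewrite lognE (negbTE npq) /= lognE (negbTE npq).
Qed.

Lemma index_natK alpha : nonneg_index alpha -> multi_index (index_nat alpha) = alpha.
Proof.
move=> a0; apply/fsfunP => i; rewrite multi_indexE logn_index_nat.
by have := a0 i; case: (alpha i).
Qed.

Lemma index_nat_zsingle i (n : nat) : index_nat (zsingle i n%:Z) = (nth_prime i ^ n)%N.
Proof.
rewrite (@index_natE _ i.+1); last by move=> j ij; rewrite zsingleE gtn_eqF.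
rewrite big_ord_recr/= zsingleE eqxx big1 ?mul1n// => j _.
by rewrite zsingleE ltn_eqF.
Qed.

Lemma zsingle_nonneg i (n : nat) : nonneg_index (zsingle i n%:Z).
Proof. by move=> j; rewrite zsingleE; case: ifP. Qed.

(** * Norms of Dirichlet polynomials *)

Section Lifts.
Context {R : realType} (mT : probability (torus R) R) (hT : is_haar_torus mT).
Context (p : R) (p1 : 1 <= p) {X : completeNormedModType R[i]}.

Lemma lift_dist (D : dirichlet X) (f g : torus R -> X) :
  is_lift mT p D f -> is_lift mT p D g -> Lp_norm mT p (fun w => f w - g w) = 0%E.
Proof.
move=> [[fL fN] fD] [[gL gN] gD].
apply: (fourier_inj hT p1); first exact: in_Lp_sub.
move=> a; rewrite (fourier_sub p1 a fL gL).
have [a0|a0] := pselect (nonneg_index a); first by rewrite fD// gD// subrr.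
by rewrite fN// gN// subrr.
Qed.

Lemma lift_norm (D : dirichlet X) (f g : torus R -> X) :
  is_lift mT p D f -> is_lift mT p D g -> (Lp_norm mT p f <= Lp_norm mT p g)%E.
Proof.
move=> fD gD; have [[[mf _] _] _] := fD; have [[[mg _] _] _] := gD.
by have := Lp_norm_tri0 mT p1 mf mg; rewrite (lift_dist fD gD) add0e.
Qed.

(** The norm may be computed on any lift, since lifts are unique up to a null
    function. *)
Lemma Hp_normE (D : dirichlet X) (f : torus R -> X) :
  is_lift mT p D f -> Hp_norm mT p D = Lp_norm mT p f.
Proof.
move=> fD; rewrite /Hp_norm.
have gD : is_lift mT p D (xget (fun=> 0) [set f | is_lift mT p D f]).
  by apply: (@xgetPex _ (fun=> 0) [set f | is_lift mT p D f]); exists f.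
by apply/eqP; rewrite eq_le; apply/andP; split;
  [exact: lift_norm gD fD|exact: lift_norm fD gD].
Qed.

Lemma is_lift_tp (D : dirichlet X) (s : seq (Zindex * X)) :
  (forall a, nonneg_index a -> tp_coef s a = D (index_nat a)) ->
  (forall a, ~ nonneg_index a -> tp_coef s a = 0) -> is_lift mT p D (tp s).
Proof.
move=> sD sN; split; last by move=> a /sD <-; rewrite (fourier_tp hT).
split; first exact: in_Lp_tp.
by move=> a /sN <-; rewrite (fourier_tp hT).
Qed.

(** The Bohr lift of the Dirichlet polynomial with coefficients [x]. *)
Definition bohr (N : nat) (x : nat -> X) (w : torus R) : X :=
  \sum_(1 <= n < N.+1) monomial w (multi_index n) *: x n.

Lemma bohrE N x w :
  bohr N x w = tp [seq (multi_index n, x n) | n <- index_iota 1 N.+1] w.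
Proof. by rewrite /tp big_map. Qed.

Lemma sm_bohr N x : strongly_measurable (bohr N x).
Proof. by rewrite (funext (bohrE N x)); exact: sm_tp. Qed.

Lemma is_lift_bohr (D : dirichlet X) N x :
  (forall n, (0 < n)%N -> D n = if (n <= N)%N then x n else 0) ->
  is_lift mT p D (bohr N x).
Proof.
move=> DE; rewrite (funext (bohrE N x)).
have -> : [seq (multi_index n, x n) | n <- index_iota 1 N.+1] =
    [seq (a, x (index_nat a)) | a <- [seq multi_index n | n <- index_iota 1 N.+1]].
  rewrite -map_comp; apply/eq_in_map => n; rewrite mem_index_iota => /andP[n0 _] /=.
  by rewrite multi_indexK.
have u : uniq [seq multi_index n | n <- index_iota 1 N.+1].
  rewrite map_inj_in_uniq ?iota_uniq// => m n; rewrite !mem_index_iota.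
  by move=> /andP[m0 _] /andP[n0 _] mn; rewrite -(multi_indexK m0) mn multi_indexK.
apply: is_lift_tp => a a0; rewrite tp_coef_uniq//; last first.
  by rewrite ifF//; apply/mapP => -[n _ E]; apply: a0; rewrite E; exact: multi_index_nonneg.
rewrite DE ?index_nat_gt0//; congr (if _ then _ else _); apply/mapP/idP => [[n nN ->]|aN].
  by move: nN; rewrite mem_index_iota => /andP[n0]; rewrite multi_indexK// ltnS.
exists (index_nat a); last by rewrite index_natK.
by rewrite mem_index_iota index_nat_gt0 ltnS.
Qed.

Lemma dterm_sumE (N : nat) (x : nat -> X) m : (0 < m)%N ->
  (\sum_(1 <= n < N.+1) dterm n (x n) : nat -> X) m = if (m <= N)%N then x m else 0.
Proof.
move=> m0; rewrite (_ : (\sum_(1 <= n < N.+1) dterm n (x n)) m = \sum_(1 <= n < N.+1) dterm n (x n) m).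
  rewrite /dterm -big_mkcond/=; case: ifP => mN.
    rewrite -big_filter (_ : [seq n <- index_iota 1 N.+1 | m == n] = [:: m]) ?big_seq1//.
    rewrite (eq_filter (a2 := pred1 m)); last by move=> n; rewrite /= eq_sym.
    by apply: filter_pred1_uniq; rewrite ?iota_uniq// mem_index_iota m0 ltnS.
  rewrite big_seq_cond big1// => n /andP[nI /eqP E].
  by move: nI; rewrite -E mem_index_iota m0/= ltnS mN.
by elim/big_ind2 : _ => // f a g b <- <-.
Qed.

Lemma Hp_norm_bohr (D : dirichlet X) N x :
  (forall n, (0 < n)%N -> D n = if (n <= N)%N then x n else 0) ->
  Hp_norm mT p D = Lp_norm mT p (bohr N x).
Proof. by move=> DE; apply: Hp_normE; exact: is_lift_bohr. Qed.

End Lifts.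

Section Rademacher.
Context {R : realType}.

Lemma sgnE (e : signs) n : sgn R e n = (rsgn e n)%:C.
Proof. by rewrite /sgn /rsgn rmorphXn rmorphN rmorph1. Qed.

Lemma rnorm_real (X : normedModType R[i]) (t : R) (x : X) : rnorm (t%:C *: x) = `|t| * rnorm x.
Proof. by rewrite rnormZ [X in X * _]/rnorm normc_def/= expr0n addr0 sqrtr_sqr. Qed.

Lemma rademacher_rnorm (X : normedModType R[i]) n (x : nat -> X) :
  rademacher_seminorm n (fun c : nat -> R => rnorm (\sum_(1 <= i < n.+1) (c i)%:C *: x i)).
Proof.
split.
- by move=> c; exact: rnorm_ge0.
- move=> c d; apply: le_trans (ler_rnormD _ _); rewrite -big_split/=.
  rewrite le_eqVlt; apply/orP; left; apply/eqP; congr rnorm.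
  by apply: eq_bigr => i _; rewrite rmorphD scalerDl.
- move=> t c; rewrite -rnorm_real scaler_sumr; congr rnorm.
  by apply: eq_bigr => i _; rewrite rmorphM scalerA.
- by move=> c d cd; congr rnorm; apply: eq_big_nat => i ii; rewrite cd.
Qed.

Lemma rademacher_Lp d (T : measurableType d) (mu : probability T R) (p : R)
    (X : normedModType R[i]) n (F : nat -> T -> X) : 1 <= p ->
  (forall i, in_Lp mu p (F i)) ->
  rademacher_seminorm n (fun c : nat -> R =>
    fine (Lp_norm mu p (fun t => \sum_(1 <= i < n.+1) (c i)%:C *: F i t)%R)).
Proof.
move=> p1 FL.
have mF i : strongly_measurable (F i) by case: (FL i).
have mS c : strongly_measurable (fun t => \sum_(1 <= i < n.+1) (c i : R)%:C *: F i t).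
  by apply: sm_sum => i; exact: sm_scaler.
have fS c : Lp_norm mu p (fun t => \sum_(1 <= i < n.+1) (c i : R)%:C *: F i t) \is a fin_num.
  rewrite ge0_fin_numE ?Lp_norm_ge0//.
  apply: le_lt_trans (Lp_norm_sum mu p1 _ _) _ => [i|]; first exact: sm_scaler.
  apply: lte_sum_pinfty => i _; rewrite Lp_normZ//.
  by apply: lte_mul_pinfty; rewrite ?lee_fin ?rnorm_ge0//; case: (FL i).
split.
- by move=> c; rewrite fine_ge0// Lp_norm_ge0.
- move=> c d'; rewrite -lee_fin EFinD !fineK//.
  rewrite (_ : (fun t : T => _) = fun t => \sum_(1 <= i < n.+1) (c i)%:C *: F i t +
    \sum_(1 <= i < n.+1) (d' i)%:C *: F i t); first exact: Lp_normD.
  apply/funext => t; rewrite -big_split/=; apply: eq_bigr => i _.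
  by rewrite rmorphD scalerDl.
- move=> t c; rewrite (_ : (fun u : T => _) = fun u =>
    (t%:C : R[i]) *: \sum_(1 <= i < n.+1) (c i)%:C *: F i u).
    by rewrite Lp_normZ// fineM// [X in fine X * _]/= [X in X * _]/rnorm normc_def/= expr0n addr0 sqrtr_sqr.
  by apply/funext => u; rewrite scaler_sumr; apply: eq_bigr => i _; rewrite rmorphM scalerA.
- move=> c d' cd; congr (fine (Lp_norm _ _ _)); apply/funext => t.
  by apply: eq_big_nat => i ii; rewrite cd.
Qed.

End Rademacher.

(** * From the circle to Dirichlet series *)

(** Averages and integrals of nonnegative functions commute. *)
Lemma ave_integral d (T : measurableType d) (R : realType) (mu : probability T R)
    (n : nat) (G : (nat -> bool) -> T -> R) (I : (nat -> bool) -> R) :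
  (forall e t, 0 <= G e t) -> (forall e, measurable_fun setT (G e)) ->
  (forall e, \int[mu]_t (G e t)%:E = (I e)%:E)%E ->
  measurable_fun setT (fun t => ave n (fun e => G e t)) /\
  (\int[mu]_t (ave n (fun e => G e t))%:E = (ave n I)%:E)%E.
Proof.
elim: n G I => [|n IH] G I G0 mG GI /=; first by split.
have [m0 i0] := IH (fun e => G (upd n.+1 false e)) (fun e => I (upd n.+1 false e))
  (fun e => G0 _) (fun e => mG _) (fun e => GI _).
have [m1 i1] := IH (fun e => G (upd n.+1 true e)) (fun e => I (upd n.+1 true e))
  (fun e => G0 _) (fun e => mG _) (fun e => GI _).
have m01 : measurable_fun setT (fun t => ave n (fun e => G (upd n.+1 false e) t) +
   ave n (fun e => G (upd n.+1 true e) t)) by exact: measurable_funD.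
split.
  exact: (measurable_funM m01 (measurable_cst _)).
rewrite (_ : (fun t : T => _) = fun t => ((2^-1 : R)%:E *
   ((ave n (fun e => G (upd n.+1 false e) t))%:E + (ave n (fun e => G (upd n.+1 true e) t))%:E))%E).
  rewrite ge0_integralZl_EFin//; last 2 first.
  - by move=> t _; rewrite -EFinD lee_fin addr_ge0// ave_ge0.
  - by apply: emeasurable_funD; exact/measurable_EFinP.
  rewrite ge0_integralD//; last 4 first.
  - by move=> t _; rewrite lee_fin ave_ge0.
  - exact/measurable_EFinP.
  - by move=> t _; rewrite lee_fin ave_ge0.
  - exact/measurable_EFinP.
  by rewrite i0 i1 -EFinD -EFinM mulrC.
by apply/funext => t; rewrite -EFinD -EFinM mulrC.
Qed.

Lemma base_expansion_lt (L K : nat) (a : nat -> nat) :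
  (forall i, (a i < L)%N) -> (\sum_(i < K) L ^ i * a i < L ^ K)%N.
Proof.
move=> aL; elim: K => [|K IH]; first by rewrite big_ord0.
rewrite big_ord_recr/= expnS.
have := aL K; move: IH; set S := (\sum_(i < K) _)%N; set Q := (L ^ K)%N => SQ aLK.
have : (Q * a K + Q <= L * Q)%N by rewrite -mulnSr mulnC leq_mul2r aLK orbT.
lia.
Qed.

Lemma base_expansion_inj (L K : nat) (a b : nat -> nat) :
  (forall i, (a i < L)%N) -> (forall i, (b i < L)%N) ->
  (\sum_(i < K) L ^ i * a i = \sum_(i < K) L ^ i * b i)%N ->
  forall i, (i < K)%N -> a i = b i.
Proof.
move=> aL bL; elim: K => [|K IH] //; rewrite !big_ord_recr/= => E.
have La := base_expansion_lt K aL; have Lb := base_expansion_lt K bL.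
have L0 : (0 < L ^ K)%N by exact: leq_ltn_trans La.
have aE c S : (S < L ^ K)%N -> ((S + L ^ K * c) %/ L ^ K)%N = c.
  by move=> SL; rewrite addnC mulnC divnMDl// divn_small// addn0.
have ab : a K = b K by rewrite -(aE (a K) _ La) E aE.
move=> i; rewrite ltnS leq_eqVlt => /predU1P[->//|iK]; apply: IH => //.
by move/eqP: E; rewrite ab eqn_add2r => /eqP.
Qed.

(** Distinct positive integers are sent to distinct integers by a linear form on
    their multi-indices, since the exponents are the digits of the image in a
    sufficiently large base.  The shift by 1 makes the values positive, as are the
    exponents of the polynomials on the circle. *)
Definition kronecker (N n : nat) : nat :=
  (\sum_(i < N) N.+1 ^ i * logn (nth_prime i) n).+1.

Lemma logn_ltn q n : prime q -> (0 < n)%N -> (logn q n < n)%N.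
Proof.
move=> pq n0; apply: (@leq_trans (q ^ logn q n)); first exact: ltn_expl (prime_gt1 pq).
by apply: dvdn_leq => //; exact: pfactor_dvdnn.
Qed.

Lemma kronecker_le N n : (0 < n <= N)%N -> (0 < kronecker N n <= N.+1 ^ N)%N.
Proof.
move=> /andP[n0 nN]; rewrite /kronecker /=.
apply: (@base_expansion_lt N.+1 N (fun i => logn (nth_prime i) n)) => i.
by rewrite (leq_trans (logn_ltn (prime_nth i) n0)) // leqW.
Qed.

Lemma kronecker_inj N : {in [pred i | (0 < i <= N)%N] &, injective (kronecker N)}.
Proof.
move=> m n; rewrite !inE => /andP[m0 mN] /andP[n0 nN] [].
move=> /(@base_expansion_inj N.+1 N (fun i => logn (nth_prime i) m) (fun i => logn (nth_prime i) n)) H.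
rewrite -(multi_indexK m0) -(multi_indexK n0); congr index_nat; apply/fsfunP => i.
rewrite !multi_indexE; have [iN|Ni] := ltnP i N.
  congr (Posz _); apply: H iN => j.
    by rewrite (leq_trans (logn_ltn (prime_nth j) m0))// leqW.
  by rewrite (leq_trans (logn_ltn (prime_nth j) n0))// leqW.
have z k : (0 < k <= N)%N -> logn (nth_prime i) k = 0%N.
  move=> /andP[k0 kN]; apply/eqP; rewrite -leqn0 leqNgt logn_gt0 mem_primes.
  apply/negP => /and3P[_ _ /dvdn_leq]; rewrite k0 => /(_ isT).
  by rewrite leqNgt (leq_ltn_trans kN)// (leq_ltn_trans Ni)// nth_prime_gt.
by rewrite !z ?m0 ?n0.
Qed.

Section Reindex.
Context {R : realType} {X : lmodType R[i]}.

Lemma sum_reindex (N N' : nat) (mu : nat -> nat) (c : nat -> R[i]) (v : nat -> X) :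
  (forall n, (0 < n <= N)%N -> (0 < mu n <= N')%N) ->
  \sum_(1 <= m < N'.+1) c m *: (\sum_(1 <= n < N.+1 | mu n == m) v n) =
  \sum_(1 <= n < N.+1) c (mu n) *: v n.
Proof.
move=> muN; under eq_bigr => m _ do rewrite scaler_sumr big_mkcond.
rewrite exchange_big /=; apply: eq_big_nat => n nN.
have mn : mu n \in index_iota 1 N'.+1 by rewrite mem_index_iota ltnS muN.
rewrite (bigD1_seq (mu n)) ?iota_uniq//= eqxx big1 ?addr0// => m.
by rewrite eq_sym => /negbTE ->.
Qed.

End Reindex.

Section CircleToTorus.
Context {R : realType} (mC : probability (circle R) R) (mT : probability (torus R) R).
Context (mS : probability signs R).
Context (hC : is_haar_circle mC) (hT : is_haar_torus mT) (hS : is_haar_signs mS).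
Context (p : R) (p1 : 1 <= p) {X : completeNormedModType R[i]}.

Definition circle_bound (C : R) := forall (N : nat) (x : nat -> X),
  (\int[mS]_e (rnorm (\sum_(1 <= n < N.+1) sgn R e n *: x n)%R)%:E <=
   C%:E * (\int[mC]_z ((rnorm (\sum_(1 <= n < N.+1) sval z ^+ n *: x n)%R)%:E `^ p))
     `^ p^-1)%E.

(** The one-parameter subgroup of the torus along which the monomial of index [n]
    becomes the power [kronecker N n - 1]. *)
Definition circle_curve (N : nat) (z : circle R) : torus R :=
  fun i => circle_pow z (N.+1 ^ i).

Lemma monomial_curve N z n : (0 < n <= N)%N ->
  sval z * monomial (circle_curve N z) (multi_index n) = sval z ^+ kronecker N n.
Proof.
move=> /andP[n0 nN]; rewrite (@monomialE _ _ _ N); last first.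
  move=> i Ni; rewrite multi_indexE; congr (Posz _).
  apply/eqP; rewrite -leqn0 leqNgt logn_gt0 mem_primes; apply/negP => /and3P[_ _ /dvdn_leq].
  rewrite n0 => /(_ isT); by rewrite leqNgt (leq_ltn_trans nN)// (leq_ltn_trans Ni)// nth_prime_gt.
rewrite /kronecker exprS; congr (_ * _).
rewrite -(big_mkord xpredT (fun i => N.+1 ^ i * logn (nth_prime i) n)%N) -prodrXr big_mkord.
by apply: eq_bigr => i _; rewrite multi_indexE /= exprM.
Qed.

Lemma sm_curve N x : strongly_measurable (fun wz : torus R * circle R =>
  bohr N x (shift (circle_curve N wz.2) wz.1) : X).
Proof.
rewrite (_ : (fun wz : torus R * circle R => _) = fun wz => \sum_(1 <= n < N.+1)
  monomial (shift (circle_curve N wz.2) wz.1) (multi_index n) *: x n)//.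
apply: sm_sum => n.
apply: (@sm_scale _ _ _ X (fun wz : torus R * circle R =>
  monomial (shift (circle_curve N wz.2) wz.1) (multi_index n) : R[i]^o)); last exact: sm_cst.
apply: sm_monomial => i.
have m1 : strongly_measurable (fun wz : torus R * circle R => sval wz.2 : R[i]^o).
  exact: (sm_precomp measurable_snd sm_circle).
have m2 : strongly_measurable (fun wz : torus R * circle R => sval (wz.1 i) : R[i]^o).
  exact: (sm_precomp measurable_fst (sm_torus_coord i)).
exact: (sm_mul (sm_expr (N.+1 ^ i) m1) m2).
Qed.

(** The bound on the circle is applied to the polynomial with coefficients
    [monomial w (multi_index n) *: x n] at the powers [kronecker N n]; random signs
    do not see the positions of the coefficients. *)
Lemma circle_bound_pointwise (C : R) N (x : nat -> X) (w : torus R) :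
  0 <= C -> circle_bound C ->
  ((ave N (fun e => rnorm (\sum_(1 <= n < N.+1)
      (rsgn e n)%:C *: (monomial w (multi_index n) *: x n))) `^ p)%:E <=
   (C `^ p)%:E * \int[mC]_z (rnorm (bohr N x (shift (circle_curve N z) w)) `^ p)%:E)%E.
Proof.
move=> C0 hC'.
pose F n := monomial w (multi_index n) *: x n.
pose y m := \sum_(1 <= n < N.+1 | kronecker N n == m) F n.
have := hC' (N.+1 ^ N)%N y.
have kN n : (0 < n <= N)%N -> (0 < kronecker N n <= N.+1 ^ N)%N by exact: kronecker_le.
under eq_integral => e _ do rewrite (sum_reindex (fun m => sgn R e m) F kN).
under [X in (_ <= _ * X `^ _)%E -> _]eq_integral => z _ do
  rewrite (sum_reindex (fun m => sval z ^+ m) F kN).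
pose G (e : nat -> bool) := rnorm (\sum_(1 <= n < N.+1) (rsgn e n)%:C *: F n).
have -> : (\int[mS]_e (rnorm (\sum_(1 <= n < N.+1) sgn R e (kronecker N n) *: F n)%R)%:E =
    (ave N G)%:E)%E.
  rewrite -(integral_depends hS (@kronecker_inj N)).
  - apply: eq_integral => e _; congr (rnorm _)%:E; apply: eq_bigr => n _.
    by rewrite sgnE.
  - exact: (rademacher_depends1 (rademacher_rnorm N F)).
  - by move=> e; exact: rnorm_ge0.
have zE z : rnorm (\sum_(1 <= n < N.+1) sval z ^+ kronecker N n *: F n) =
    rnorm (bohr N x (shift (circle_curve N z) w)).
  rewrite -[RHS]mul1r -(rnorm_circle z) -rnormZ; congr rnorm.
  rewrite /bohr scaler_sumr; apply: eq_big_nat => n nN.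
  by rewrite /F -(monomial_curve z nN) /shift monomialM !scalerA mulrA.
under [X in (_ <= _ * X `^ _)%E -> _]eq_integral => z _ do rewrite zE poweR_EFin.
set I := (\int[mC]_z _)%E.
have I0 : (0 <= I)%E by apply: integral_ge0 => z _; rewrite lee_fin powR_ge0.
have A0 : 0 <= ave N G by apply: ave_ge0 => e; exact: rnorm_ge0.
have pp : 0 < p by exact: lt_le_trans p1.
move=> H; have {H} H := lee_poweR (ltW pp) (_ : 0 <= (ave N G)%:E)%E H.
apply: le_trans (H _) _; first by rewrite lee_fin.
rewrite poweRM ?lee_fin ?poweR_ge0// poweR_EFin -poweRrM mulVf ?gt_eqF// poweRe1//.
Qed.

Lemma bohr_real N (c : nat -> R) (x : nat -> X) w :
  \sum_(1 <= n < N.+1) (c n)%:C *: (monomial w (multi_index n) *: x n) =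
  bohr N (fun n => (c n)%:C *: x n) w.
Proof. by apply: eq_bigr => n _; rewrite !scalerA mulrC. Qed.

Lemma in_Lp_bohr_term (x : X) n :
  in_Lp mT p (fun w : torus R => monomial w (multi_index n) *: x).
Proof.
rewrite (_ : (fun w : torus R => _) = tp [:: (multi_index n, x)]); first exact: in_Lp_tp.
by apply/funext => w; rewrite /tp big_seq1.
Qed.

Lemma in_Lp_bohr N (x : nat -> X) : in_Lp mT p (bohr N x).
Proof. by rewrite (funext (bohrE N x)); exact: in_Lp_tp. Qed.

Definition bohr_seminorm N (x : nat -> X) (c : nat -> R) : R :=
  fine (Lp_norm mT p (bohr N (fun n => (c n)%:C *: x n))).

Lemma rademacher_bohr N (x : nat -> X) : rademacher_seminorm N (bohr_seminorm N x).
Proof.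
have := @rademacher_Lp R _ _ mT p X N (fun n w => monomial w (multi_index n) *: x n) p1
  (fun n => in_Lp_bohr_term (x n) n).
rewrite (_ : (fun c : nat -> R => _) = bohr_seminorm N x)//.
apply/funext => c; rewrite /bohr_seminorm; congr (fine (Lp_norm _ _ _)).
by apply/funext => w; rewrite bohr_real.
Qed.

Lemma Hp_norm_randomize N (x : nat -> X) (e : signs) (D : dirichlet X) :
  (forall n, (0 < n)%N -> D n = if (n <= N)%N then x n else 0) ->
  Hp_norm mT p (randomize e D) = (bohr_seminorm N x (rsgn e))%:E.
Proof.
move=> DE; rewrite (@Hp_norm_bohr _ _ hT _ p1 _ _ N (fun n => (rsgn e n)%:C *: x n)).
  by rewrite fineK// ge0_fin_numE ?Lp_norm_ge0//; case: (in_Lp_bohr N (fun n => (rsgn e n)%:C *: x n)).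
by move=> n n0; rewrite /randomize DE// sgnE; case: ifP => // _; rewrite scaler0.
Qed.

Lemma Hp_rad_norm_bohr N (x : nat -> X) (D : dirichlet X) :
  (forall n, (0 < n)%N -> D n = if (n <= N)%N then x n else 0) ->
  Hp_rad_norm mT mS p D = (ave N (fun e => bohr_seminorm N x (rsgn e)))%:E.
Proof.
move=> DE; rewrite /Hp_rad_norm.
under eq_integral => e _ do rewrite (Hp_norm_randomize e DE).
have hN := rademacher_bohr N x.
apply: (@integral_depends _ _ hS N (fun e => bohr_seminorm N x (rsgn e)) id).
- by move=> i j _ _.
- exact: (rademacher_depends1 hN).
- by move=> e; case: hN.
Qed.

(** After raising to the power [p] the expectation and the integral over the torus
    commute, and Kahane's inequality returns to the first moment at each point of
    the torus.  There the bound on the circle applies, and the invariance of Haar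
    measure removes the additional variable. *)
Lemma circle_bound_rad (C : R) : 0 <= C -> circle_bound C ->
  exists C' : R, 1 <= C' /\ forall (N : nat) (x : nat -> X),
    ((ave N (fun e => bohr_seminorm N x (rsgn e)))%:E <= C'%:E * Lp_norm mT p (bohr N x))%E.
Proof.
move=> C0 hC'; have pp : 0 < p by exact: lt_le_trans p1.
have [K K0 hK] := kahane (ltW pp).
set M := K * C `^ p; have M0 : 0 <= M by rewrite mulr_ge0// powR_ge0.
exists (Num.max 1 (M `^ p^-1)); split; first by rewrite le_max lexx.
move=> N x; set S := fun e => bohr_seminorm N x (rsgn e).
have fin (y : nat -> X) : Lp_norm mT p (bohr N y) = (fine (Lp_norm mT p (bohr N y)))%:E.
  by rewrite fineK// ge0_fin_numE ?Lp_norm_ge0//; case: (in_Lp_bohr N y).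
have S0 e : 0 <= S e by rewrite fine_ge0// Lp_norm_ge0.
rewrite (fin x) -EFinM lee_fin; set L := fine _.
have L0 : 0 <= L by rewrite fine_ge0// Lp_norm_ge0.
pose G (e : nat -> bool) (w : torus R) := rnorm (bohr N (fun n => (rsgn e n)%:C *: x n) w) `^ p.
have [mG iG] : measurable_fun setT (fun w => ave N (fun e => G e w)) /\
    (\int[mT]_w (ave N (fun e => G e w))%:E = (ave N (fun e => S e `^ p))%:E)%E.
  apply: ave_integral.
  - by move=> e w; exact: powR_ge0.
  - move=> e; apply/measurable_EFinP; exact: (sm_powR p (sm_bohr N (fun n => (rsgn e n)%:C *: x n))).
  - by move=> e; rewrite -(Lp_norm_powR mT p1) fin poweR_EFin.
pose J (w : torus R) := (\int[mC]_z (rnorm (bohr N x (shift (circle_curve N z) w)) `^ p)%:E)%E.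
have mF := sm_powR p (sm_curve N x).
have mJ : measurable_fun setT J.
  have F0 (wz : torus R * circle R) : (0 <= (rnorm (bohr N x (shift (circle_curve N wz.2) wz.1)) `^ p)%:E)%E.
    by rewrite lee_fin powR_ge0.
  exact: (@measurable_fun_fubini_tonelli_F _ _ _ _ R mC _ mF F0).
have J0 w : (0 <= J w)%E by apply: integral_ge0 => z _; rewrite lee_fin powR_ge0.
have GJ w : ((ave N (fun e => G e w))%:E <= M%:E * J w)%E.
  apply: (@le_trans _ _ (K * ave N (fun e => rnorm (\sum_(1 <= n < N.+1)
      (rsgn e n)%:C *: (monomial w (multi_index n) *: x n))) `^ p)%:E).
    rewrite lee_fin; have := hK _ _ (rademacher_rnorm N (fun n => monomial w (multi_index n) *: x n)).
    by rewrite /G; under eq_ave => e do rewrite bohr_real.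
  rewrite EFinM /M EFinM -muleA; rewrite lee_wpmul2l ?lee_fin//.
  exact: circle_bound_pointwise.
have SL : ave N S `^ p <= M * L `^ p.
  rewrite -lee_fin EFinM.
  apply: (@le_trans _ _ (ave N (fun e => S e `^ p))%:E); first by rewrite lee_fin ave_powR.
  rewrite -iG; apply: (@le_trans _ _ (\int[mT]_w (M%:E * J w))%E).
    apply: (@ge0_le_integral _ _ _ mT setT measurableT _ (fun w => (M%:E * J w)%E)).
    - by move=> w _; rewrite lee_fin; apply: ave_ge0 => e; rewrite /G powR_ge0.
    - by apply/measurable_EFinP; exact: mG.
    - exact: (measurable_funeM M%:E mJ).
    - by move=> w _; exact: GJ.
  rewrite ge0_integralZl_EFin//.
  rewrite -(integral_subgroup hT mC p1 (sm_bohr N x) (sm_curve N x)) -(Lp_norm_powR mT p1).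
  by rewrite fin poweR_EFin.
have A0 : 0 <= ave N S by exact: ave_ge0.
have {SL} := ge0_ler_powR (_ : 0 <= p^-1) _ _ SL.
rewrite invr_ge0 ltW// !nnegrE !powR_ge0 mulr_ge0 ?powR_ge0// => /(_ isT isT isT).
rewrite powRM ?powR_ge0// -!powRrM !mulfV ?gt_eqF// !powRr1// => /le_trans; apply.
by rewrite ler_wpM2r// le_max lexx orbT.
Qed.

End CircleToTorus.

(** * Random sums of polynomials in one coordinate *)

Section Unbounded.
Context {R : realType} (mS : probability signs R) (hS : is_haar_signs mS).

(** By the reverse Hoelder inequality for random sums, the normalized seminorms
    carry a fixed part of their mean on values that are at most [256]; almost
    sure boundedness would make these truncations tend to [0] almost surely. *)
Lemma rademacher_ae_unbounded (N : nat -> nat) (B : nat -> (nat -> R) -> R)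
    (iota : nat -> nat -> nat) :
  (forall k, rademacher_seminorm (N k) (B k)) ->
  (forall k, {in [pred i | (0 < i <= N k)%N] &, injective (iota k)}) ->
  (forall k, 2 ^+ k <= ave (N k) (fun e => B k (rsgn e))) ->
  ~ {ae mS, forall e, exists M : R, forall k, B k (fun n => rsgn e (iota k n)) <= M}.
Proof.
move=> hB inj hA bd.
pose A k := ave (N k) (fun e => B k (rsgn e)).
have A0 k : 0 < A k by apply: lt_le_trans (hA k); rewrite exprn_gt0.
pose V k (e : nat -> bool) := Num.min (B k (rsgn e) / A k) 256.
have B0 k c : 0 <= B k c by case: (hB k).
have V0 k e : 0 <= V k e by rewrite le_min ler0n andbT; apply: divr_ge0; [exact: B0|exact: ltW].
have dV k : depends (N k) (V k).
  by move=> e e' ee'; rewrite /V (rademacher_depends1 (hB k) ee').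
(* [t <= min t 256 + t ^ 2 / 256], where the second moment is at most [128] *)
have aV k : 2^-1 <= ave (N k) (V k).
  have a1 : ave (N k) (fun e => B k (rsgn e) / A k) = 1.
    under eq_ave => e do rewrite mulrC.
    by rewrite aveZ mulVf ?gt_eqF.
  have a2 : ave (N k) (fun e => (B k (rsgn e) / A k) ^+ 2) <= 128.
    under eq_ave => e do rewrite expr_div_n mulrC.
    rewrite aveZ mulrC ler_pdivrMr ?exprn_gt0//.
    exact: (rademacher_L2_L1 (hB k)).
  have : ave (N k) (fun e => B k (rsgn e) / A k) <=
      ave (N k) (fun e => V k e + 256^-1 * (B k (rsgn e) / A k) ^+ 2).
    apply: ler_ave => e; rewrite /V; move: (B k (rsgn e) / A k) => t.
    rewrite /Num.min; case: ltP => t256.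
      by rewrite lerDl; apply: mulr_ge0; [rewrite invr_ge0 ler0n|exact: sqr_ge0].
    nra.
  by rewrite a1 aveD aveZ; lra.
pose f (k : nat) (e : signs) := (V k (e \o iota k))%:E.
have mf k : measurable_fun setT (f k).
  by apply/measurable_EFinP; exact: measurable_depends.
have fE k : (\int[mS]_e f k e = (ave (N k) (V k))%:E)%E.
  by apply: integral_depends => //; exact: inj.
have ff : {ae mS, forall e, setT e -> f ^~ e @ \oo --> 0%E}.
  apply: (@filterS _ _ (ae_filter_ringOfSetsType mS) _ _ _ bd) => e [M hM] _; apply/fine_cvgP; split; first exact: nearW.
  apply: (@squeeze_cvgr _ _ _ _ (fun=> 0) (fun k => M * 2^-1 ^+ k)).
  - apply: nearW => k /=; rewrite V0/= /V ge_min; apply/orP; left.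
    rewrite ler_pdivrMr//; apply: (le_trans (hM k)).
    have M0 : 0 <= M by apply: le_trans (hM 0%N).
    rewrite exprVn -mulrA ler_peMr// mulrC ler_pdivlMr ?exprn_gt0// mul1r.
    exact: hA.
  - exact: cvg_cst.
  - rewrite -[X in _ --> X](mulr0 M); apply: cvgM; first exact: cvg_cst.
    by apply: cvg_expr; rewrite ger0_norm// invf_lt1// ltr1n.
have ig : mS.-integrable setT (cst 256%:E).
  by apply/integrableP; split; [exact: measurable_cst|
    rewrite integral_cst//= [X in (_ * X)%E](@probability_setT _ _ _ mS) mule1 ltry].
have [] := @dominated_convergence _ _ _ mS setT measurableT f (cst 0%E) (cst 256%:E) mf
  (measurable_cst _) ff ig.
  apply: nearW => e k _; rewrite /f /= ger0_norm ?V0// lee_fin /V.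
  by rewrite ge_min lexx orbT.
move=> _ _; rewrite integral0 => /fine_cvgP[_] /cvgrPdist_lt/(_ 2^-1).
rewrite invr_gt0 ltr0n => /(_ isT) [K _ /(_ K (leqnn K))] /=.
rewrite fE/= sub0r normrN ger0_norm ?ltNge ?aV//.
by apply: ave_ge0 => e; exact: V0.
Qed.

End Unbounded.

Section Blocks.
Context {R : realType} (mC : probability (circle R) R) (mT : probability (torus R) R).
Context (mS : probability signs R).
Context (hC : is_haar_circle mC) (hT : is_haar_torus mT) (hS : is_haar_signs mS).
Context (p : R) (p1 : 1 <= p) {X : completeNormedModType R[i]}.

Definition block (k N : nat) (y : nat -> X) (w : torus R) : X :=
  \sum_(1 <= n < N.+1) sval (w k) ^+ n *: y n.

Definition block_terms (k N : nat) (y : nat -> X) : seq (Zindex * X) :=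
  [seq (zsingle k n%:Z, y n) | n <- index_iota 1 N.+1].

Lemma blockE k N y w : block k N y w = tp (block_terms k N y) w.
Proof. by rewrite /tp big_map; apply: eq_bigr => n _; rewrite monomial_zsingle. Qed.

Lemma in_Lp_block k N y : in_Lp mT p (block k N y).
Proof. by rewrite (funext (blockE k N y)); exact: in_Lp_tp. Qed.

Lemma sm_block k N y : strongly_measurable (block k N y).
Proof. by case: (in_Lp_block k N y). Qed.

Lemma sm_circle_poly N (y : nat -> X) :
  strongly_measurable (fun z : circle R => \sum_(1 <= n < N.+1) sval z ^+ n *: y n : X).
Proof.
apply: sm_sum => n.
apply: (@sm_scale _ _ _ X (fun z : circle R => sval z ^+ n : R[i]^o)); last exact: sm_cst.
exact: (sm_expr n sm_circle).
Qed.

(** Rotations of one coordinate preserve the measure of the torus, and the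
    coordinate is distributed according to Haar measure on the circle. *)
Lemma block_norm k N y : Lp_norm mT p (block k N y) =
  Lp_norm mC p (fun z => \sum_(1 <= n < N.+1) sval z ^+ n *: y n).
Proof.
pose h (z : circle R) := \sum_(1 <= n < N.+1) sval z ^+ n *: y n.
have bE z w : block k N y (shift (rot k z) w) = h (circle_mul (w k) z).
  by apply: eq_bigr => n _; rewrite /shift /powN_mul /rot eqxx /= mulrC.
have sS : strongly_measurable (fun wz : torus R * circle R => block k N y (shift (rot k wz.2) wz.1)).
  rewrite (_ : (fun wz : torus R * circle R => _) = fun wz => \sum_(1 <= n < N.+1)
    (sval (wz.1 k) * sval wz.2) ^+ n *: y n); last by apply/funext => wz; rewrite bE.
  have m1 : strongly_measurable (fun wz : torus R * circle R => sval wz.2 : R[i]^o).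
    exact: (sm_precomp measurable_snd sm_circle).
  have m2 : strongly_measurable (fun wz : torus R * circle R => sval (wz.1 k) : R[i]^o).
    exact: (sm_precomp measurable_fst (sm_torus_coord k)).
  apply: sm_sum => n.
  apply: (@sm_scale _ _ _ X (fun wz : torus R * circle R => (sval (wz.1 k) * sval wz.2) ^+ n : R[i]^o));
    last exact: sm_cst.
  exact: (sm_expr n (sm_mul m2 m1)).
rewrite !Lp_normE.
have -> : (\int[mT]_w (rnorm (block k N y w) `^ p)%:E = \int[mC]_z (rnorm (h z) `^ p)%:E)%E.
  rewrite (integral_subgroup hT mC p1 (sm_block k N y) sS).
  have inner w : (\int[mC]_z (rnorm (block k N y (shift (rot k z) w)) `^ p)%:E =
      \int[mC]_z (rnorm (h z) `^ p)%:E)%E.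
    have E1 z : (rnorm (block k N y (shift (rot k z) w)) `^ p)%:E = (rnorm (h (circle_mul (w k) z)) `^ p)%:E.
      by rewrite bE.
    transitivity (\int[mC]_z (rnorm (h (circle_mul (w k) z)) `^ p)%:E)%E.
      apply: eq_integral => z _.
      exact: E1.
    apply: (@ge0_integral_preserving _ _ _ mC (circle_mul (w k)) (fun z => (rnorm (h z) `^ p)%:E)).
    - exact: measurable_circle_mul.
    - by move=> A mA; exact: hC.
    - exact: (sm_powR p (sm_circle_poly N y)).
    - by move=> z; rewrite lee_fin powR_ge0.
  under eq_integral => w _ do rewrite inner.
  by rewrite integral_cst//= [X in (_ * X = _)%E](@probability_setT _ _ _ mT) mule1.
by [].
Qed.

(** Multiplication of the terms by unimodular complex numbers changes the mean of
    a random sum at most by the factor [2]: contraction applies to the real and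
    to the imaginary parts. *)
Lemma ave_unimodular N (lambda : nat -> R[i]) (y : nat -> X) :
  (forall n, `|lambda n| = 1) ->
  ave N (fun e => rnorm (\sum_(1 <= n < N.+1) (rsgn e n)%:C *: y n)) <=
  2 * ave N (fun e => rnorm (\sum_(1 <= n < N.+1) (rsgn e n)%:C *: (lambda n *: y n))).
Proof.
move=> l1; pose v n := lambda n *: y n.
pose c n := (lambda n)^-1.
have c1 n : `|c n| = 1 by rewrite normfV l1 invr1.
have yE n : y n = c n *: v n.
  rewrite /v /c scalerA mulVf ?scale1r//.
  by rewrite -normr_gt0 l1.
have cE n : c n = (complex.Re (c n))%:C + 'i%C * (complex.Im (c n))%:C.
  exact: complexE.
have hN := rademacher_rnorm N v.
have re1 n : `|complex.Re (c n)| <= 1.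
  by rewrite (le_trans (ler_complexRe _))// /rnorm c1.
have im1 n : `|complex.Im (c n)| <= 1.
  by rewrite (le_trans (ler_complexIm _))// /rnorm c1.
have Hr := contraction hN re1; have Hi := contraction hN im1.
rewrite mulr2n mulrDl mul1r; apply: le_trans (lerD Hr Hi); rewrite -aveD.
apply: ler_ave => e.
have -> : \sum_(1 <= n < N.+1) (rsgn e n)%:C *: y n =
    \sum_(1 <= n < N.+1) (complex.Re (c n) * rsgn e n)%:C *: v n +
    'i%C *: \sum_(1 <= n < N.+1) (complex.Im (c n) * rsgn e n)%:C *: v n.
  rewrite scaler_sumr -big_split; apply: eq_bigr => n _ /=.
  rewrite yE scalerA {1}cE !rmorphM scalerA -scalerDl; congr (_ *: _); ring.
apply: le_trans (ler_rnormD _ _) _; rewrite lerD2l rnormZ.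
rewrite [X in X * _](_ : _ = 1) ?mul1r//.
by rewrite /rnorm normc_def/= expr0n add0r expr1n sqrtr1.
Qed.

Definition block_seminorm (k N : nat) (y : nat -> X) (c : nat -> R) : R :=
  fine (Lp_norm mT p (block k N (fun n => (c n)%:C *: y n))).

Lemma block_real k N (c : nat -> R) (y : nat -> X) w :
  \sum_(1 <= n < N.+1) (c n)%:C *: (sval (w k) ^+ n *: y n) =
  block k N (fun n => (c n)%:C *: y n) w.
Proof. by apply: eq_bigr => n _; rewrite !scalerA mulrC. Qed.

Lemma rademacher_block k N (y : nat -> X) : rademacher_seminorm N (block_seminorm k N y).
Proof.
have FL n : in_Lp mT p (fun w : torus R => sval (w k) ^+ n *: y n).
  rewrite (_ : (fun w : torus R => _) = tp [:: (zsingle k n, y n)]); first exact: in_Lp_tp.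
  by apply/funext => w; rewrite /tp big_seq1 monomial_zsingle.
have := @rademacher_Lp R _ _ mT p X N (fun n w => sval (w k) ^+ n *: y n) p1 FL.
rewrite (_ : (fun c : nat -> R => _) = block_seminorm k N y)//.
apply/funext => c; rewrite /block_seminorm; congr (fine (Lp_norm _ _ _)).
by apply/funext => w; rewrite block_real.
Qed.

(** Random signs see the coefficients of a polynomial, but not the characters. *)
Lemma ave_block k N (y : nat -> X) :
  ave N (fun e => rnorm (\sum_(1 <= n < N.+1) (rsgn e n)%:C *: y n)) <=
  2 * ave N (fun e => block_seminorm k N y (rsgn e)).
Proof.
set E := ave N _.
pose G (e : nat -> bool) (w : torus R) := rnorm (block k N (fun n => (rsgn e n)%:C *: y n) w).
have fin (e : nat -> bool) : Lp_norm mT p (block k N (fun n => (rsgn e n)%:C *: y n)) =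
    (block_seminorm k N y (rsgn e))%:E.
  by rewrite /block_seminorm fineK// ge0_fin_numE ?Lp_norm_ge0//;
     case: (in_Lp_block k N (fun n => (rsgn e n)%:C *: y n)).
have G0 e w : 0 <= G e w by exact: rnorm_ge0.
have mG e : measurable_fun setT (G e).
  exact: (sm_rnorm (sm_block k N (fun n => (rsgn e n)%:C *: y n))).
pose I e := fine (\int[mT]_w (G e w)%:E)%E.
have IL e : (\int[mT]_w (G e w)%:E <= (block_seminorm k N y (rsgn e))%:E)%E.
  by rewrite -fin; exact: (L1_le_Lp mT p1 (sm_block k N (fun n => (rsgn e n)%:C *: y n))).
have I0 e : (0 <= \int[mT]_w (G e w)%:E)%E by apply: integral_ge0 => w _; rewrite lee_fin.
have IE e : (\int[mT]_w (G e w)%:E = (I e)%:E)%E.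
  by rewrite /I fineK// ge0_fin_numE// (le_lt_trans (IL e))// ltry.
have [mA iA] := ave_integral N G0 mG IE.
apply: (@le_trans _ _ (2 * ave N I)); last first.
  by rewrite ler_wpM2l//; apply: ler_ave => e; rewrite -lee_fin -IE IL.
have w2 w : E <= 2 * ave N (fun e => G e w).
  apply: (le_trans (@ave_unimodular N (fun n => sval (w k) ^+ n) y _)) => [n|].
    by rewrite normrX (eqP (svalP (w k))) expr1n.
  by rewrite ler_wpM2l//; apply: ler_ave => e; rewrite /G -block_real.
rewrite -lee_fin EFinM -iA -ge0_integralZl_EFin//; last 2 first.
- by move=> w _; rewrite lee_fin; apply: ave_ge0.
- by apply/measurable_EFinP.
have -> : E%:E = (\int[mT]_w (cst E%:E w))%E.
  by rewrite integral_cst//= [X in (_ = _ * X)%E](@probability_setT _ _ _ mT) mule1.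
apply: (@ge0_le_integral _ _ _ mT setT measurableT (cst E%:E)
  (fun w => (2%:E * (ave N (fun e => G e w))%:E)%E)).
- by move=> w _; rewrite lee_fin; apply: ave_ge0 => e; exact: rnorm_ge0.
- exact: measurable_cst.
- by apply: (measurable_funeM (2%:E)%E); apply/measurable_EFinP.
- by move=> w _; rewrite -EFinM lee_fin.
Qed.

Lemma integral_sgn N (x : nat -> X) :
  (\int[mS]_e (rnorm (\sum_(1 <= n < N.+1) sgn R e n *: x n)%R)%:E =
   (ave N (fun e => rnorm (\sum_(1 <= n < N.+1) (rsgn e n)%:C *: x n)))%:E)%E.
Proof.
transitivity (\int[mS]_e (rnorm (\sum_(1 <= n < N.+1) (rsgn e n)%:C *: x n))%:E)%E.
  apply: eq_integral => e _; congr (rnorm _)%:E; apply: eq_bigr => n _.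
  by rewrite sgnE.
apply: (@integral_depends _ _ hS N (fun e => rnorm (\sum_(1 <= n < N.+1) (rsgn e n)%:C *: x n)) id).
- by move=> i j _ _.
- exact: (rademacher_depends1 (rademacher_rnorm N x)).
- by move=> e; exact: rnorm_ge0.
Qed.

(** A polynomial that violates the bound with a large constant, normalized. *)
Lemma hump_exists (k : nat) :
  ~ (exists C : R, 1 <= C /\ circle_bound mC mS p (X:=X) C) ->
  exists Nx : nat * (nat -> X),
    2 ^+ k <= ave Nx.1 (fun e => block_seminorm k Nx.1 Nx.2 (rsgn e)) /\
    (Lp_norm mT p (block k Nx.1 Nx.2) <= (2 ^- k)%:E)%E.
Proof.
move=> nb; (* one power of [2] for each of the two requirements, and a factor [2] for the
   loss in [ave_block] *)
pose C : R := 2 ^+ k.+1 * 2 ^+ k.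
have k0 j : 0 < 2 ^+ j :> R by rewrite exprn_gt0.
have C1 : 1 <= C by rewrite /C -exprD exprn_ege1// ler1n.
have {nb} : ~ circle_bound mC mS p (X:=X) C by move=> H; apply: nb; exists C.
rewrite /circle_bound => /existsNP[N /existsNP[x /negP]]; rewrite -ltNge integral_sgn.
set E := ave N _.
under eq_integral => z _ do rewrite poweR_EFin.
rewrite -Lp_normE -(block_norm k); set L := Lp_norm _ _ _ => CL.
have Lfin : L = (fine L)%:E.
  by rewrite fineK// ge0_fin_numE ?Lp_norm_ge0//; case: (in_Lp_block k N x).
move: CL; rewrite Lfin -EFinM lte_fin => CL.
have l0 : 0 <= fine L by rewrite fine_ge0// Lp_norm_ge0.
have E0 : 0 < E by apply: le_lt_trans CL; rewrite mulr_ge0// (le_trans ler01).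
pose t := 2 ^+ k.+1 / E; have t0 : 0 < t by rewrite divr_gt0.
exists (N, fun n => t%:C *: x n) => /=; split.
  have := ave_block k N (fun n => t%:C *: x n).
  have -> : ave N (fun e => rnorm (\sum_(1 <= n < N.+1) (rsgn e n)%:C *: (t%:C *: x n))) = t * E.
    rewrite -aveZ; apply: eq_ave => e; rewrite -[X in X * _]gtr0_norm// -rnorm_real scaler_sumr.
    by congr rnorm; apply: eq_bigr => n _; rewrite !scalerA mulrC.
  by rewrite /t mulfVK ?gt_eqF// exprS; lra.
rewrite (_ : block _ _ _ = fun w => t%:C *: block k N x w); last first.
  by apply/funext => w; rewrite /block scaler_sumr; apply: eq_bigr => n _; rewrite !scalerA mulrC.
rewrite Lp_normZ//; last exact: sm_block.
rewrite -/L Lfin -EFinM lee_fin.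
rewrite [X in X * _](_ : _ = t); last first.
  by rewrite /rnorm normc_def/= expr0n addr0 sqrtr_sqr gtr0_norm.
rewrite -[leRHS]div1r ler_pdivlMr// /t -!mulrA mulrCA ler_pdivrMl// mulr1.
by apply: ltW; move: CL; rewrite /C mulrAC mulrA.
Qed.

End Blocks.

(** * Blocks on the powers of different primes *)

Section Hump.
Context {R : realType} (mC : probability (circle R) R) (mT : probability (torus R) R).
Context (mS : probability signs R).
Context (hC : is_haar_circle mC) (hT : is_haar_torus mT) (hS : is_haar_signs mS).
Context (p : R) (p1 : 1 <= p) {X : completeNormedModType R[i]}.

Lemma prime_pow_inj (k l m n : nat) : (0 < m)%N ->
  (nth_prime k ^ m == nth_prime l ^ n)%N = ((k == l) && (m == n)).
Proof.
move=> m0; apply/eqP/andP => [E|[/eqP-> /eqP->//]].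
have kl : k = l.
  apply: nth_prime_inj; apply/eqP; rewrite -dvdn_prime2 ?prime_nth//.
  have [E0|n0] := posnP n.
    move: E; rewrite E0 expn0 => /eqP; rewrite -(expn0 (nth_prime k)) eqn_exp2l ?prime_gt1 ?prime_nth//.
    by move=> /eqP mE; move: m0; rewrite mE.
  by have := Euclid_dvdX (nth_prime l) n (prime_nth k); rewrite n0 andbT => <-; rewrite -E dvdn_exp.
split; first by rewrite kl.
by move/eqP: E; rewrite kl eqn_exp2l// prime_gt1// prime_nth.
Qed.

Lemma prime_pow_gt k n : (0 < n)%N -> (k < nth_prime k ^ n)%N.
Proof.
by move=> n0; apply: (leq_trans (nth_prime_gt k)); rewrite -{1}(expn1 (nth_prime k)) leq_pexp2l// prime_gt0// prime_nth.
Qed.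

(** The coefficient at [m] of the Dirichlet series that corresponds to a block. *)
Definition block_coef (k N : nat) (y : nat -> X) (m : nat) : X :=
  \sum_(1 <= n < N.+1 | (nth_prime k ^ n == m)%N) y n.

Lemma block_coef_pow k l N y n : (0 < n)%N ->
  block_coef k N y (nth_prime l ^ n)%N = if (k == l) && (n <= N)%N then y n else 0.
Proof.
move=> n0; rewrite /block_coef big_seq_cond.
rewrite (eq_bigl (fun j => (j \in index_iota 1 N.+1) && ((k == l) && (j == n)))); last first.
  move=> j; rewrite mem_index_iota; case: (ltnP 0 j) => //= j0.
  by rewrite prime_pow_inj.
rewrite -big_seq_cond; case: eqP => [_|_] /=; last by rewrite big_pred0_eq.
case: leqP => nN.
  rewrite -big_filter (_ : [seq j <- index_iota 1 N.+1 | j == n] = [:: n]) ?big_seq1//.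
  by apply: filter_pred1_uniq; rewrite ?iota_uniq// mem_index_iota n0 ltnS.
rewrite big_seq_cond big1// => j /andP[jI /eqP E].
by move: jI; rewrite E mem_index_iota n0/= ltnS leqNgt nN.
Qed.

Lemma block_coef_small k N y m : (m <= k)%N -> block_coef k N y m = 0.
Proof.
move=> mk; rewrite /block_coef big_seq_cond big1// => n /andP[].
rewrite mem_index_iota => /andP[n0 _] /eqP E.
by have := prime_pow_gt k n0; rewrite E ltnNge mk.
Qed.

Lemma zsingle_eq k n a : nonneg_index a ->
  (zsingle k (Posz n) == a) = (nth_prime k ^ n == index_nat a)%N.
Proof.
move=> a0; apply/eqP/eqP => [<-|E]; first by rewrite index_nat_zsingle.
by rewrite -(index_natK a0) -E -index_nat_zsingle index_natK//; exact: zsingle_nonneg.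
Qed.

Lemma tp_coef_block k N y a : nonneg_index a ->
  tp_coef (block_terms k N y) a = block_coef k N y (index_nat a).
Proof.
move=> a0; rewrite /tp_coef big_map /block_coef.
by apply: eq_bigl => n; rewrite /= zsingle_eq.
Qed.

Lemma tp_coef_blockN k N (y : nat -> X) a : ~ nonneg_index a -> tp_coef (block_terms k N y) a = 0.
Proof.
move=> a0; rewrite /tp_coef big_map big1// => n /eqP E; exfalso; apply: a0.
by rewrite -E; exact: zsingle_nonneg.
Qed.

Lemma Hp_norm_block k N y (D : dirichlet X) :
  (forall m, (0 < m)%N -> D m = block_coef k N y m) ->
  Hp_norm mT p D = Lp_norm mT p (block k N y).
Proof.
move=> DE; apply: (Hp_normE hT p1); rewrite (funext (blockE k N y)).
apply: (is_lift_tp hT p1) => a a0; last exact: tp_coef_blockN.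
by rewrite tp_coef_block// DE// index_nat_gt0.
Qed.

Context (N : nat -> nat) (x : nat -> nat -> X).

Definition hump_series : dirichlet X := fun m => \sum_(k < m) block_coef k (N k) (x k) m.

Lemma hump_seriesE K m : (m <= K)%N ->
  hump_series m = \sum_(k < K) block_coef k (N k) (x k) m.
Proof.
move=> mK; rewrite /hump_series -!(big_mkord xpredT (fun k => block_coef k (N k) (x k) m)).
rewrite [RHS](big_cat_nat _ mK)//= [X in _ = _ + X]big_nat_cond [X in _ = _ + X]big1 ?addr0// => k /andP[/andP[mk _] _].
exact: block_coef_small.
Qed.

Lemma hump_series_pow k n : (0 < n)%N ->
  hump_series (nth_prime k ^ n)%N = if (n <= N k)%N then x k n else 0.
Proof.
move=> n0; have kq := prime_pow_gt k n0.
rewrite /hump_series (bigD1 (Ordinal kq))//= block_coef_pow// eqxx/= big1 ?addr0// => l lk.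
rewrite block_coef_pow// ifF//; apply/negP => /andP[/eqP E _].
by move/eqP: lk; apply; apply/val_inj.
Qed.

Lemma hump_series1 : hump_series 1%N = 0.
Proof.
rewrite /hump_series big1// => k _; rewrite /block_coef big_seq_cond big1// => n /andP[].
rewrite mem_index_iota => /andP[n0 _] /eqP E; exfalso.
have := ltn_expl n (prime_gt1 (prime_nth k)).
by rewrite E ltnNge n0.
Qed.

Fixpoint hump_terms (K : nat) : seq (Zindex * X) :=
  if K is J.+1 then hump_terms J ++ block_terms J (N J) (x J) else [::].

Lemma hump_terms_coef K a : nonneg_index a ->
  tp_coef (hump_terms K) a = \sum_(k < K) block_coef k (N k) (x k) (index_nat a).
Proof.
move=> a0; elim: K => [|K IH] /=; first by rewrite /tp_coef big_nil big_ord0.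
by rewrite big_ord_recr/= -IH -tp_coef_block// /tp_coef big_cat.
Qed.

Lemma hump_terms_coefN K a : ~ nonneg_index a -> tp_coef (hump_terms K) a = 0.
Proof.
move=> a0; elim: K => [|K IH] /=; first by rewrite /tp_coef big_nil.
by rewrite /tp_coef big_cat /= -!/(tp_coef _ a) IH tp_coef_blockN// addr0.
Qed.

End Hump.

Section Limits.
Context {R : realType} (mT : probability (torus R) R) (p : R) (p1 : 1 <= p).
Context {X : completeNormedModType R[i]}.

(** Fourier coefficients are continuous, so that a limit in mean has the limits of
    the coefficients. *)
Lemma fourier_limit (f : torus R -> X) (u : nat -> torus R -> X) a (c : X) :
  in_Lp mT p f -> (forall j, in_Lp mT p (u j)) ->
  (forall e : R, 0 < e -> \forall j \near \oo, (Lp_norm mT p (fun w => f w - u j w)%R <= e%:E)%E) ->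
  (forall e : R, 0 < e -> \forall j \near \oo, rnorm (fourier_coef mT (u j) a - c) <= e) ->
  fourier_coef mT f a = c.
Proof.
move=> fL uL fu uc; apply/eqP; rewrite -subr_eq0; apply/eqP; apply: rnorm_eq0.
apply/eqP; rewrite eq_le rnorm_ge0 andbT.
apply/ler_addgt0Pr => e e0; rewrite add0r.
have e2 : 0 < e / 2 by rewrite divr_gt0.
have [K _ hK] := fu _ e2; have [L _ hL] := uc _ e2.
have j1 := hK (maxn K L) (leq_maxl _ _); have j2 := hL (maxn K L) (leq_maxr _ _).
move: (maxn K L) j1 j2 => j j1 j2.
have /le_trans/(_ j1) := fourier_norm p1 a (in_Lp_sub p1 fL (uL j)).
rewrite lee_fin (fourier_sub p1 a fL (uL j)) => j3.
have := ler_rnormD (fourier_coef mT f a - fourier_coef mT (u j) a) (fourier_coef mT (u j) a - c).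
by rewrite subrKA => /le_trans; apply; rewrite [leRHS](splitr e); exact: lerD.
Qed.

End Limits.

Section Necessity.
Context {R : realType} (mC : probability (circle R) R) (mT : probability (torus R) R).
Context (mS : probability signs R).
Context (hC : is_haar_circle mC) (hT : is_haar_torus mT) (hS : is_haar_signs mS).
Context (p : R) (p1 : 1 <= p) {X : completeNormedModType R[i]}.

Lemma prime_pow_iota_inj k n :
  {in [pred i | (0 < i <= n)%N] &, injective (expn (nth_prime k))}.
Proof.
by move=> i j /andP[i0 _] _ /eqP; rewrite prime_pow_inj// => /andP[_ /eqP].
Qed.

Lemma dterm_scaleE (N : nat) (c : nat -> R[i]) (x : nat -> X) m : (0 < m)%N ->
  (\sum_(1 <= n < N.+1) c n *: (dterm n (x n) : nat -> X)) m =
  if (m <= N)%N then c m *: x m else 0.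
Proof.
move=> m0; rewrite -(dterm_sumE N (fun n => c n *: x n) m0).
congr ((_ : nat -> X) m); apply: eq_bigr => n _; apply/funext => j.
by rewrite /dterm /GRing.scale/=; case: ifP => // _; rewrite scaler0.
Qed.

(** One coefficient sequence carries all blocks, and the scalars of an
    unconditionality inequality can select a single block. *)
Lemma RUC_circle_bound :
  (forall x : nat -> X, RUC mS (Hp_norm mT p) (fun n => dterm n (x n))) ->
  exists C : R, 1 <= C /\ circle_bound mC mS p (X:=X) C.
Proof.
move=> ruc; apply: contrapT => nb.
have [Nx hNx] := choice (fun k => hump_exists hC hT hS p1 k nb).
pose N k := (Nx k).1; pose x k := (Nx k).2; pose D := hump_series N x.
have [C hCk] := ruc D.
have [k kC] : exists k : nat, `|C| < 2 ^+ k.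
  exists (Num.truncn `|C|).+1; apply: lt_le_trans (truncnS_gt _) _.
  by rewrite -natrX ler_nat ltnW// ltn_expl.
pose a j : R[i] := (has (fun n => nth_prime k ^ n == j)%N (index_iota 1 (N k).+1))%:R.
have coef c j : (0 < j)%N ->
    (if (j <= nth_prime k ^ N k)%N then (c j * a j) *: D j else 0) =
    block_coef k (N k) (fun n => c (nth_prime k ^ n)%N *: x k n) j.
  move=> j0; rewrite /a; case: (boolP (has _ _)) => [/hasP[n]|/hasPn nj].
    rewrite mem_index_iota ltnS => /andP[n0 nN] /eqP <-.
    rewrite leq_pexp2l ?prime_gt0 ?prime_nth// mulr1 /D hump_series_pow// nN.
    by rewrite block_coef_pow// eqxx nN.
  rewrite mulr0 scale0r if_same /block_coef big_seq_cond big1// => n /andP[nI nj'].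
  by have := nj n nI; rewrite nj'.
have := hCk (nth_prime k ^ N k)%N a.
pose B (c : nat -> R) := block_seminorm mT p k (N k) (x k) c.
have -> : (\int[mS]_e Hp_norm mT p (\sum_(1 <= n < (nth_prime k ^ N k)%N.+1)
    (sgn R e n * a n) *: (dterm n (D n) : nat -> X))%R)%E =
    (\int[mS]_e (B (fun n => rsgn e (nth_prime k ^ n)%N))%:E)%E.
  apply: eq_integral => e _.
  rewrite (@Hp_norm_block _ _ hT _ p1 _ k (N k) (fun n => sgn R e (nth_prime k ^ n)%N *: x k n)).
    rewrite /B /block_seminorm fineK; last first.
      by rewrite ge0_fin_numE ?Lp_norm_ge0//; apply: (in_Lp_block mT p1 _ _ _).2.
    by congr (Lp_norm _ _ _); apply/funext => w; apply: eq_bigr => n _; rewrite sgnE.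
  by move=> m m0; rewrite (@dterm_scaleE _ (fun n => sgn R e n * a n))// coef.
have -> : Hp_norm mT p (\sum_(1 <= n < (nth_prime k ^ N k)%N.+1) a n *: (dterm n (D n) : nat -> X)) =
    Lp_norm mT p (block k (N k) (x k)).
  rewrite (@Hp_norm_block _ _ hT _ p1 _ k (N k) (fun n => 1 *: x k n)).
    by congr (Lp_norm _ _ _); apply/funext => w; apply: eq_bigr => n _; rewrite scale1r.
  by move=> m m0; rewrite dterm_scaleE// -(coef (fun=> 1))// mul1r.
have -> : (\int[mS]_e (B (fun n => rsgn e (nth_prime k ^ n)%N))%:E =
    (ave (N k) (fun e => B (rsgn e)))%:E)%E.
  have hB : rademacher_seminorm (N k) B by exact: rademacher_block.
  apply: (@integral_depends _ _ hS (N k) (fun e => B (rsgn e)) (expn (nth_prime k))).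
  - exact: prime_pow_iota_inj.
  - exact: (rademacher_depends1 hB).
  - by move=> e; case: hB.
have [h1 h2] := hNx k; move=> H.
have : ((2 ^+ k)%:E <= `|C|%:E * (2 ^- k)%:E)%E.
  apply: (@le_trans _ _ (ave (N k) (fun e => B (rsgn e)))%:E); first by rewrite lee_fin.
  apply: (le_trans H); apply: (@le_trans _ _ (`|C|%:E * Lp_norm mT p (block k (N k) (x k)))%E).
    by apply: lee_wpmul2r; rewrite ?Lp_norm_ge0// lee_fin ler_norm.
  by apply: lee_wpmul2l; rewrite ?lee_fin.
rewrite -EFinM lee_fin leNgt => /negP; apply.
apply: le_lt_trans kC; rewrite ler_piMr//.
by rewrite invf_le1 ?exprn_gt0 ?exprn_ege1 ?ler1n ?ltr0n.
Qed.

(** The blocks are summable in the Hardy space, but almost surely their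
    randomizations are not bounded. *)
Lemma inclusion_circle_bound :
  (forall D : dirichlet X, in_Hp mT p D -> in_Hp_rad mT mS p D) ->
  exists C : R, 1 <= C /\ circle_bound mC mS p (X:=X) C.
Proof.
move=> incl; apply: contrapT => nb.
have [Nx hNx] := choice (fun k => hump_exists hC hT hS p1 k nb).
pose N k := (Nx k).1; pose x k := (Nx k).2; pose D := hump_series N x.
have inD : in_Hp mT p D.
  pose u K := tp (hump_terms N x K) : torus R -> X.
  have uL K : in_Lp mT p (u K) by exact: in_Lp_tp.
  have du K : (Lp_norm mT p (fun w => u K.+1 w - u K w)%R <= (1 * 2 ^- K)%:E)%E.
    rewrite mul1r (_ : (fun w : torus R => _) = block K (N K) (x K)); first exact: (hNx K).2.
    by apply/funext => w; rewrite /u /= tp_cat addrC addKr blockE.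
  have [f [fL fu]] := Lp_completeness p1 ler01 uL du.
  exists f; split; first split => // a a0.
    apply: (fourier_limit p1 fL uL fu) => e e0; apply: nearW => j.
    by rewrite (fourier_tp hT) hump_terms_coefN// subrr rnorm0 ltW.
  move=> a a0; apply: (fourier_limit p1 fL uL fu) => e e0.
  exists (index_nat a) => // j /= aj.
  by rewrite (fourier_tp hT) hump_terms_coef// -hump_seriesE// subrr rnorm0 ltW.
apply: (@rademacher_ae_unbounded _ _ hS N (fun k => block_seminorm mT p k (N k) (x k))
  (fun k => expn (nth_prime k))) (fun k => (hNx k).1) _.
- by move=> k; exact: rademacher_block.
- by move=> k; exact: prime_pow_iota_inj.
apply: (@filterS _ _ (ae_filter_ringOfSetsType mS) _ _ _ (incl D inD)) => e [g [[gL gN] gD]].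
exists (fine (Lp_norm mT p g)) => k.
have coef (n : nat) : fourier_coef mT g (zsingle k n%:Z) =
    if (0 < n <= N k)%N then sgn R e (nth_prime k ^ n)%N *: x k n else 0.
  rewrite gD; last exact: zsingle_nonneg.
  rewrite index_nat_zsingle /randomize.
  have [->|n0] := posnP n; first by rewrite expn0 /D hump_series1 scaler0.
  by rewrite /D hump_series_pow//; case: ifP => // _; rewrite scaler0.
have van (n : int) : ~~ (0 <= n <= (N k)%:Z) -> fourier_coef mT g (zsingle k n) = 0.
  case: n => [n|n] nN.
    by rewrite coef ifF//; apply/negP => /andP[_ nk]; move: nN; rewrite lez_nat nk.
  by apply: gN => /(_ k); rewrite zsingleE eqxx.
have := restrict_coord hT p1 gL van.
rewrite (_ : (fun w : torus R => _) =
    block k (N k) (fun n => (rsgn e (nth_prime k ^ n)%N)%:C *: x k n)); last first.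
  apply/funext => w; rewrite big_nat_recl// coef scaler0 add0r /block big_add1 /=.
  apply: eq_big_nat => n nN; rewrite coef ltn0Sn/= -sgnE.
  by move: nN => /= ->.
rewrite /block_seminorm => H; rewrite fine_le// ge0_fin_numE ?Lp_norm_ge0//.
  by case: (in_Lp_block mT p1 k (N k) (fun n => (rsgn e (nth_prime k ^ n)%N)%:C *: x k n)).
by case: gL.
Qed.

End Necessity.

(** * Unconditionality from the bound for Dirichlet polynomials *)

Section Sufficiency.
Context {R : realType} (mT : probability (torus R) R) (mS : probability signs R).
Context (hT : is_haar_torus mT) (hS : is_haar_signs mS).
Context (p : R) (p1 : 1 <= p) {X : completeNormedModType R[i]}.

Definition rad_bound (C : R) := forall (N : nat) (x : nat -> X),
  ((ave N (fun e => bohr_seminorm mT p N x (rsgn e)))%:E <= C%:E * Lp_norm mT p (bohr N x))%E.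

Lemma rad_boundP (C : R) : rad_bound C <-> forall (N : nat) (x : nat -> X),
  (Hp_rad_norm mT mS p (\sum_(1 <= n < N.+1) dterm n (x n))%R <=
   C%:E * Hp_norm mT p (\sum_(1 <= n < N.+1) dterm n (x n))%R)%E.
Proof.
by split=> H N x; have := H N x; rewrite (Hp_rad_norm_bohr hT hS p1 (dterm_sumE N x))
  (Hp_norm_bohr hT p1 (dterm_sumE N x)).
Qed.

Lemma rad_bound_RUC (C : R) (x : nat -> X) : rad_bound C ->
  RUC mS (Hp_norm mT p) (fun n => dterm n (x n)).
Proof.
move=> hb; exists C => m a.
have -> : Hp_norm mT p (\sum_(1 <= n < m.+1) a n *: (dterm n (x n) : nat -> X)) =
    Lp_norm mT p (bohr m (fun n => a n *: x n)).
  by apply: (Hp_norm_bohr hT p1) => n n0; rewrite dterm_scaleE.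
apply: le_trans (hb m (fun n => a n *: x n)).
have hN := rademacher_bohr mT p1 m (fun n => a n *: x n).
rewrite -(@integral_depends _ _ hS m (fun e => bohr_seminorm mT p m (fun n => a n *: x n) (rsgn e)) id);
  last 3 first.
- by move=> i j _ _.
- exact: (rademacher_depends1 hN).
- by move=> e; case: hN.
rewrite le_eqVlt; apply/orP; left; apply/eqP; apply: eq_integral => e _.
rewrite (@Hp_norm_bohr _ _ hT _ p1 _ _ m (fun n => (sgn R e n * a n) *: x n)); last first.
  by move=> n n0; rewrite (@dterm_scaleE _ _ _ (fun n => sgn R e n * a n)).
rewrite /bohr_seminorm fineK; last first.
  rewrite ge0_fin_numE ?Lp_norm_ge0//.
  by case: (in_Lp_bohr mT p1 m (fun n => (rsgn e n)%:C *: (a n *: x n))).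
congr (Lp_norm _ _ (bohr _ _)); apply/funext => n.
by rewrite scalerA -sgnE.
Qed.

Lemma bohr_widen N M (x : nat -> X) w : (N <= M)%N ->
  (forall n, (N < n)%N -> x n = 0) -> bohr N x w = bohr M x w.
Proof.
move=> NM x0; rewrite /bohr [RHS](@big_cat_nat _ _ _ N.+1)//=.
rewrite [X in _ = _ + X]big_nat_cond [X in _ = _ + X]big1 ?addr0// => n /andP[/andP[Nn _] _].
by rewrite x0// scaler0.
Qed.

(** Fejer means of a lift are Dirichlet polynomials. *)
Lemma bohr_approx (D : dirichlet X) (f : torus R -> X) (e : R) :
  is_lift mT p D f -> 0 < e ->
  exists (Ny : nat * (nat -> X)),
    (forall n, (Ny.1 < n)%N -> Ny.2 n = 0) /\
    (Lp_norm mT p (fun w => f w - bohr Ny.1 Ny.2 w)%R <= e%:E)%E.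
Proof.
move=> [[fL fN] fD] e0; have [F [m [uF fF]]] := fejer_approx hT p1 fL e0.
pose y n := if multi_index n \in F then (m (multi_index n))%:C *: D n else 0.
have [N hN] : exists N, forall n, (N < n)%N -> multi_index n \notin F.
  exists (\max_(a <- F) index_nat a)%N => n Nn; apply/negP => nF.
  have n0 : (0 < n)%N by exact: leq_ltn_trans Nn.
  by have := @leq_bigmax_seq _ F xpredT index_nat _ nF isT; rewrite multi_indexK// leqNgt Nn.
have y0 n : (N < n)%N -> y n = 0 by move=> /hN/negbTE nF; rewrite /y nF.
exists (N, y); split => //=.
have lF : is_lift mT p y (fmean mT F m f).
  apply: (is_lift_tp hT p1) => a a0; rewrite (tp_coef_uniq (fun a => _) a uF).
    by rewrite /y index_natK// fD.
  by rewrite fN// scaler0 if_same.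
have lB : is_lift mT p y (bohr N y).
  by apply: (is_lift_bohr hT p1) => n n0; case: leqP => // /y0.
have mF : strongly_measurable (fmean mT F m f) by case: lF => -[[]].
have mB : strongly_measurable (bohr N y) by exact: sm_bohr.
have [mf _] := fL.
apply: le_trans (Lp_norm_tri mT p1 mf mF mB) _.
by rewrite (lift_dist hT p1 lF lB) adde0.
Qed.

(** The increments of a fast approximation by polynomials remain summable after
    almost every choice of signs, so the randomized polynomials converge. *)
Lemma rad_bound_inclusion (C : R) (D : dirichlet X) : 0 <= C -> rad_bound C ->
  in_Hp mT p D -> in_Hp_rad mT mS p D.
Proof.
move=> C0 hb [f fD]; have [[fL _] _] := fD.
(* the expected norms of the randomized increments are then summable even after
   multiplication by [2 ^+ j] *)
have e0 j : 0 < (2 ^- j) ^+ 2 :> R by rewrite exprn_gt0// invr_gt0 exprn_gt0.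
have [Ny hNy] := choice (fun j => bohr_approx fD (e0 j)).
pose N j := (Ny j).1; pose y j := (Ny j).2.
have y0 j n : (N j < n)%N -> y j n = 0 by apply: (hNy j).1.
have fy j : (Lp_norm mT p (fun w => f w - bohr (N j) (y j) w)%R <= ((2 ^- j) ^+ 2)%:E)%E.
  exact: (hNy j).2.
have lift j (e : signs) : is_lift mT p (fun n => (rsgn e n)%:C *: y j n)
    (bohr (N j) (fun n => (rsgn e n)%:C *: y j n)).
  by apply: (is_lift_bohr hT p1) => n n0; case: leqP => // /y0 ->; rewrite scaler0.
have uL j (e : signs) : in_Lp mT p (bohr (N j) (fun n => (rsgn e n)%:C *: y j n)).
  exact: in_Lp_bohr.
(* the increments, as polynomials of a common length *)
pose M j := maxn (N j) (N j.+1); pose z j n := y j.+1 n - y j n.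
have zE j (c : nat -> R) w : bohr (N j.+1) (fun n => (c n)%:C *: y j.+1 n) w -
    bohr (N j) (fun n => (c n)%:C *: y j n) w = bohr (M j) (fun n => (c n)%:C *: z j n) w.
  rewrite (bohr_widen w (leq_maxr (N j) _)); last by move=> n /y0 ->; rewrite scaler0.
  rewrite [X in _ - X](bohr_widen w (leq_maxl _ (N j.+1))); last by move=> n /y0 ->; rewrite scaler0.
  by rewrite /bohr -sumrB; apply: eq_bigr => n _; rewrite /z !scalerBr.
have zN j : (Lp_norm mT p (bohr (M j) (z j)) <= (2 * (2 ^- j) ^+ 2)%:E)%E.
  have -> : bohr (M j) (z j) = fun w => bohr (N j.+1) (y j.+1) w - bohr (N j) (y j) w.
    apply/funext => w; have := zE j (fun=> 1) w.
    have b1 (v : nat -> X) : (fun n => (1 : R)%:C *: v n) = v.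
      by apply/funext => n; rewrite scale1r.
    by rewrite !b1.
  have mb i : strongly_measurable (bohr (N i) (y i)) by exact: sm_bohr.
  have [mf _] := fL.
  apply: le_trans (Lp_norm_tri mT p1 (mb _) mf (mb _)) _.
  rewrite Lp_normBC; apply: le_trans (leeD (fy j.+1) (fy j)) _.
  rewrite -EFinD lee_fin mulr_natl [leRHS]mulr2n lerD2r.
  have p0 i : 0 <= 2 ^- i :> R by rewrite invr_ge0 exprn_ge0.
  rewrite ler_sqr ?nnegrE//; rewrite lef_pV2 ?posrE ?exprn_gt0//.
  by rewrite ler_eXn2l ?ltr1n.
pose B j (c : nat -> R) := bohr_seminorm mT p (M j) (z j) c.
have hB j : rademacher_seminorm (M j) (B j) by exact: rademacher_bohr.
have B0 j c : 0 <= B j c by case: (hB j).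
pose g j (e : signs) := 2 ^+ j * B j (rsgn e).
have dg j : depends (M j) (fun e => 2 ^+ j * B j (rsgn e)).
  by move=> e e' ee'; rewrite (rademacher_depends1 (hB j) ee').
have ga j : (\int[mS]_e (g j e)%:E <= ((2 * C) * 2 ^- j)%:E)%E.
  have -> : (\int[mS]_e (g j e)%:E = (ave (M j) (fun e => 2 ^+ j * B j (rsgn e)))%:E)%E.
    apply: (@integral_depends _ _ hS (M j) (fun e => 2 ^+ j * B j (rsgn e)) id) => //.
    by move=> e; rewrite mulr_ge0// exprn_ge0.
  rewrite aveZ EFinM; have j0 : 0 < 2 ^+ j :> R by rewrite exprn_gt0.
  apply: (@le_trans _ _ ((2 ^+ j)%:E * (C%:E * (2 * (2 ^- j) ^+ 2)%:E))%E).
    apply: lee_wpmul2l; first by rewrite lee_fin ltW.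
    apply: le_trans (hb (M j) (z j)) _.
    by apply: lee_wpmul2l => //; rewrite lee_fin.
  rewrite -!EFinM lee_fin.
  suff -> : 2 ^+ j * (C * (2 * 2 ^- j ^+ 2)) = 2 * C * 2 ^- j by [].
  by field; rewrite gt_eqF.
have g0 j e : 0 <= g j e by rewrite mulr_ge0// exprn_ge0.
have mg j : measurable_fun setT (g j) by exact: (measurable_depends id (dg j)).
have aeg := ae_summable (mulr_ge0 (ler0n R 2) C0) g0 mg ga.
apply: (@filterS _ _ (ae_filter_ringOfSetsType mS) _ _ _ aeg) => e [A gA].
have {}gA j : g j e <= A.
  by apply: le_trans (gA j.+1); rewrite big_nat_recr//= lerDr sumr_ge0.
have A0 : 0 <= A by exact: le_trans (gA 0%N).
have uA j : (Lp_norm mT p (fun w => bohr (N j.+1) (fun n => (rsgn e n)%:C *: y j.+1 n) w -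
    bohr (N j) (fun n => (rsgn e n)%:C *: y j n) w)%R <= (A * 2 ^- j)%:E)%E.
  rewrite (_ : (fun w : torus R => _) = bohr (M j) (fun n => (rsgn e n)%:C *: z j n)); last first.
    by apply/funext => w; rewrite zE.
  have <- : (B j (rsgn e))%:E = Lp_norm mT p (bohr (M j) (fun n => (rsgn e n)%:C *: z j n)).
    rewrite /B /bohr_seminorm fineK// ge0_fin_numE ?Lp_norm_ge0//.
    by case: (in_Lp_bohr mT p1 (M j) (fun n => (rsgn e n)%:C *: z j n)).
  by rewrite lee_fin ler_pdivlMr ?exprn_gt0// mulrC; exact: gA.
have [h [hL hu]] := Lp_completeness p1 A0 (uL ^~ e) uA.
have coef a j : nonneg_index a -> rnorm (y j (index_nat a) - D (index_nat a)) <= (2 ^- j) ^+ 2.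
  move=> a0; rewrite -lee_fin; apply: le_trans (fy j).
  have bL : in_Lp mT p (bohr (N j) (y j)) by exact: in_Lp_bohr.
  have lb : is_lift mT p (y j) (bohr (N j) (y j)).
    by apply: (is_lift_bohr hT p1) => n n0; case: leqP => // /y0.
  have := fourier_norm p1 a (in_Lp_sub p1 fL bL).
  by rewrite (fourier_sub p1 a fL bL) fD.2// lb.2// rnormBC.
exists h; split; first split => // a a0.
  apply: (fourier_limit p1 hL (uL ^~ e) hu) => d d0; apply: nearW => j.
  by have [[_ ->]] := lift j e; rewrite // subrr rnorm0 ltW.
move=> a a0; apply: (fourier_limit p1 hL (uL ^~ e) hu) => d d0.
have /cvgrPdist_le/(_ _ d0) : (fun j => (2 ^- j) ^+ 2 : R) @ \oo --> (0 : R).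
  under eq_fun => j do rewrite -exprVn -exprM mulnC exprM.
  by apply: cvg_expr; rewrite ger0_norm ?exprn_ge0// expr2 -invfM invf_lt1// -natrM ltr1n.
apply: filterS => j; rewrite sub0r normrN ger0_norm ?(ltW (e0 j))//; apply: le_trans.
rewrite (lift j e).2// /randomize sgnE -scalerBr rnorm_real /rsgn normrX normrN normr1 expr1n mul1r.
exact: coef.
Qed.

End Sufficiency.

Theorem proposition3p1 (R : realType) (X : completeNormedModType R[i])
  (mC : probability (circle R) R) (mT : probability (torus R) R)
  (mS : probability signs R)
  (hC : is_haar_circle mC) (hT : is_haar_torus mT) (hS : is_haar_signs mS)
  (p : R) (hp : 2 <= p) :
  [<->
    (* (a) *)
    forall x : nat -> X,
      RUC mS (Hp_norm mT p) (fun n => dterm n (x n));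
    (* (b) *)
    exists C : R, 1 <= C /\ forall (N : nat) (x : nat -> X),
      (Hp_rad_norm mT mS p (\sum_(1 <= n < N.+1) dterm n (x n))%R <=
       C%:E * Hp_norm mT p (\sum_(1 <= n < N.+1) dterm n (x n))%R)%E;
    (* (c) *)
    forall D : dirichlet X, in_Hp mT p D -> in_Hp_rad mT mS p D;
    (* (d) *)
    exists C : R, 1 <= C /\ forall (N : nat) (x : nat -> X),
      (\int[mS]_e (rnorm (\sum_(1 <= n < N.+1) sgn R e n *: x n)%R)%:E <=
       C%:E * (\int[mC]_z
                 ((rnorm (\sum_(1 <= n < N.+1) sval z ^+ n *: x n)%R)%:E `^ p))
              `^ p^-1)%E ].
Proof.
have p1 : 1 <= p by apply: le_trans hp; rewrite ler1n.
have dE := @circle_bound_rad R mC mT mS hT hS p p1 X.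
have bE := rad_boundP (X := X) hT hS p1.
have db : (exists C : R, 1 <= C /\ circle_bound mC mS p (X := X) C) ->
    exists C : R, 1 <= C /\ rad_bound mT p (X := X) C.
  by move=> [C [C1 hd]]; exact: dE (le_trans ler01 C1) hd.
tfae.
- move=> /(RUC_circle_bound hC hT hS p1)/db[C [C1 hb]]; exists C; split => //.
  exact/bE.
- move=> [C [C1 /bE hb]] D; exact: (rad_bound_inclusion hT hS p1 (le_trans ler01 C1) hb).
- exact: inclusion_circle_bound.
- move=> /db[C [_ hb]] x; exact: (rad_bound_RUC hT hS p1 x hb).
Qed.
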